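(* Let $G$ be a locally compact group and let $H$ be a compact open subgroup of $G$ such that the Hecke pair $(G,H)$ is reduced. Suppose that $H$ is a normal subgroup of some closed normal subgroup $N$ of $G$. Let $p=\chi_H\in C_c(G)$, $A=C^*(G)$, and let $\mathcal{H}=pC_c(G)p$ be the Hecke algebra of $(G,H)$. Then the right inner product $\langle f,g\rangle_R=f^*g$ is positive on $C_c(G)p$, i.e. for every $f\in C_c(G)p$ there exist $n\ge 1$ and $g_1,\dots,g_n\in\mathcal{H}$ with $f^*f=\sum_{i=1}^n g_i^*g_i$; and hence $C^*(\mathcal{H})=pAp$.
   Context: A pair $(G,H)$ of a group and a subgroup is a Hecke pair if every double coset $HxH$ is a finite union of left cosets of $H$ (automatic when $H$ is compact and open). It is reduced if $\bigcap_{x\in G}xHx^{-1}=\{e\}$. Left Haar measure on $G$ is normalized so that $H$ has measure $1$; $C_c(G)$ is the usual convolution $*$-algebra with $f^*(x)=\overline{f(x^{-1})}\Delta(x^{-1})$ ($\Delta$ the modular function), regarded as a subalgebra of the full group $C^*$-algebra $A=C^*(G)$. Then $p=\chi_H$ is a projection ($p=p^*=p^2$), and the Hecke algebra of $(G,H)$ (the span of the characteristic functions of double cosets of $H$) is the $*$-algebra $\mathcal{H}=pC_c(G)p\subseteq pAp$, which is dense in $pAp$. The notation $C^*(\mathcal{H})=pAp$ means that $pAp$ is the enveloping $C^*$-algebra of $\mathcal{H}$: every $*$-representation of $\mathcal{H}$ by bounded operators on a Hilbert space extends to a $*$-representation of $pAp$. *)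

(* Defs.v *)
From HB Require Import structures.
From mathcomp Require Import all_boot all_order all_algebra.
From mathcomp Require Import complex.
From mathcomp Require Import all_classical all_reals all_analysis.
Import numFieldNormedType.Exports.
Import Order.TTheory GRing.Theory Num.Theory.

Set Implicit Arguments.
Unset Strict Implicit.
Unset Printing Implicit Defensive.

Local Open Scope classical_set_scope.
Local Open Scope ring_scope.
Local Open Scope complex_scope.

HB.structure Definition PreTopologicalGroup :=
  {G of PointedTopological G & Group G}.

HB.mixin Record PreTopologicalGroup_isTopologicalGroup G
    & PreTopologicalGroup G := {
  mulg_continuous : continuous (fun z : G * G => (z.1 * z.2)%g) ;
  invg_continuous : continuous (fun x : G => (x^-1)%g)
}.

(* The distinguished point of a [PointedTopological] type is arbitrary; it is
   there because the measurable types of the library are pointed. *)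
#[short(type="topologicalGroupType")]
HB.structure Definition TopologicalGroup :=
  {G of PreTopologicalGroup G & PreTopologicalGroup_isTopologicalGroup G}.

Section Subgroups.
Variable G : groupType.
Implicit Types H N : set G.

Definition subgroup H : Prop :=
  [/\ H 1%g, forall x y, H x -> H y -> H (x * y)%g
    & forall x, H x -> H (x^-1)%g].

Definition normal_subgroup H N : Prop :=
  [/\ subgroup H, H `<=` N & forall x h, N x -> H h -> H (x * h * x^-1)%g].

Definition reduced H : Prop :=
  \bigcap_(x in [set: G]) [set (x * h * x^-1)%g | h in H] = [set 1%g].

End Subgroups.

Notation borel T := (g_sigma_algebraType (@open T)).

Section Haar.
Context {R : realType} {G : topologicalGroupType}.
Variable mu : {measure set (borel G) -> \bar R}.
Local Open Scope ereal_scope.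

Definition radon_measure : Prop :=
  [/\ forall K : set G, compact K -> mu K < +oo,
      forall E : set (borel G), measurable E ->
        mu E = ereal_inf [set mu U | U in [set U : set G | open U /\ E `<=` U]]
    & forall U : set G, open U ->
        mu U = ereal_sup [set mu K | K in [set K : set G | compact K /\ K `<=` U]]].

Definition left_haar_measure : Prop :=
  [/\ radon_measure, mu [set: borel G] != 0
    & forall (x : G) (E : set (borel G)), measurable E ->
        mu [set (x * y)%g | y in (E : set G)] = mu E].

Definition modular_function (Delta : G -> R) : Prop :=
  forall (x : G) (E : set (borel G)), measurable E ->
    mu [set (y * x)%g | y in (E : set G)] = (Delta x)%:E * mu E.

End Haar.

Section Convolution.
Context {R : realType} {G : topologicalGroupType}.
Variables (mu : {measure set (borel G) -> \bar R}) (Delta : G -> R).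
Implicit Types f g : G -> R[i].

Definition Cintegral f : R[i] :=
  (\int[mu]_x complex.Re (f x)) +i* (\int[mu]_x complex.Im (f x)).

(* The topology of the complex numbers is carried by [R[i]^o]. *)
Definition Cc : set (G -> R[i]) :=
  [set f | continuous (f : G -> R[i]^o) /\ compact (closure [set x | f x != 0])].

Definition conv f g : G -> R[i] :=
  fun x => Cintegral (fun y => f y * g (y^-1 * x)%g).

Definition invol f : G -> R[i] :=
  fun x => (f (x^-1)%g)^* * (Delta (x^-1)%g)%:C.

Definition L1norm f : R := \int[mu]_x complex.Re `|f x|.

End Convolution.

Record hilbertSpace (R : realType) := HilbertSpace {
  hilbert_sort :> completeNormedModType R[i] ;
  dotp : hilbert_sort -> hilbert_sort -> R[i] ;
  dotpDZl : forall (a : R[i]) (u v w : hilbert_sort),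
    dotp (a *: u + v) w = a * dotp u w + dotp v w ;
  dotpC : forall u v : hilbert_sort, dotp u v = (dotp v u)^* ;
  dotp_norm : forall u : hilbert_sort, dotp u u = `|u| ^+ 2
}.

Section Operators.
Context {R : realType} {V : normedModType R[i]}.

Definition bounded_operator (T : V -> V) : Prop :=
  exists M : R, forall v, `|T v| <= M%:C * `|v|.

Definition opnorm (T : V -> V) : R :=
  sup [set complex.Re `|T v| | v in [set v : V | `|v| <= 1]].

End Operators.

(* [*]-representations by bounded operators of the [*]-algebra with carrier the
   subset [S] of [X], product [mul] and involution [star]; the values of [pi]
   outside [S] are irrelevant. *)
Record is_star_rep (R : realType) (X : lmodType R[i]) (mul : X -> X -> X)
    (star : X -> X) (S : set X) (V : hilbertSpace R)
    (pi : X -> {linear V -> V}) : Prop := IsStarRep {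
  star_rep_bounded : forall x, S x -> bounded_operator (pi x) ;
  star_rep_linear : forall a x y v, S x -> S y ->
    pi (a *: x + y) v = a *: pi x v + pi y v ;
  star_rep_mul : forall x y v, S x -> S y -> pi (mul x y) v = pi x (pi y v) ;
  star_rep_star : forall x v w, S x -> dotp (pi x v) w = dotp v (pi (star x) w)
}.

Record cstarAlgebra (R : realType) := CstarAlgebra {
  cstar_sort :> completeNormedModType R[i] ;
  cmul : cstar_sort -> cstar_sort -> cstar_sort ;
  cstar : cstar_sort -> cstar_sort ;
  cmulA : associative cmul ;
  cmulDZl : forall (k : R[i]) (a b c : cstar_sort),
    cmul (k *: a + b) c = k *: cmul a c + cmul b c ;
  cmulDZr : forall (k : R[i]) (a b c : cstar_sort),
    cmul c (k *: a + b) = k *: cmul c a + cmul c b ;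
  cstarDZ : forall (k : R[i]) (a b : cstar_sort),
    cstar (k *: a + b) = k^* *: cstar a + cstar b ;
  cstarK : involutive cstar ;
  cstarM : forall a b : cstar_sort, cstar (cmul a b) = cmul (cstar b) (cstar a) ;
  cnormM : forall a b : cstar_sort, `|cmul a b| <= `|a| * `|b| ;
  cnorm_star : forall a : cstar_sort, `|cmul (cstar a) a| = `|a| ^+ 2
}.

Section GroupCstar.
Context {R : realType} {G : topologicalGroupType}.
Variables (mu : {measure set (borel G) -> \bar R}) (Delta : G -> R).

(* The [*]-representations of [C_c(G)] which are contractive for the [L^1]-norm
   are the restrictions of the [*]-representations of [L^1(G)]. *)
Definition L1_star_rep (V : hilbertSpace R)
    (pi : (G -> R[i]) -> {linear V -> V}) : Prop :=
  is_star_rep (conv mu) (invol Delta) Cc pi /\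
  forall f, Cc f -> opnorm (pi f) <= L1norm mu f.

Definition universal_norm (f : G -> R[i]) : R :=
  sup [set r | exists (V : hilbertSpace R) (pi : (G -> R[i]) -> {linear V -> V}),
         L1_star_rep pi /\ r = opnorm (pi f)].

(* [A], together with [iota : C_c(G) -> A], is the completion of the convolution
   algebra for the universal norm; it is unique up to isomorphism. *)
Record is_group_cstar (A : cstarAlgebra R) (iota : (G -> R[i]) -> A) : Prop :=
IsGroupCstar {
  group_cstar_linear : forall a f g, Cc f -> Cc g ->
    iota (a *: f + g) = a *: iota f + iota g ;
  group_cstar_mul : forall f g, Cc f -> Cc g ->
    iota (conv mu f g) = cmul (iota f) (iota g) ;
  group_cstar_star : forall f, Cc f -> iota (invol Delta f) = cstar (iota f) ;
  group_cstar_norm : forall f, Cc f -> `|iota f| = (universal_norm f)%:C ;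
  group_cstar_dense : closure (iota @` Cc) = [set: A]
}.

End GroupCstar.

Section Hecke.
Context {R : realType} {G : topologicalGroupType}.
Variables (mu : {measure set (borel G) -> \bar R}) (Delta : G -> R).
Variable H : set G.

Definition hecke_proj : G -> R[i] := \1_H.

Definition Cc_proj : set (G -> R[i]) :=
  [set conv mu f hecke_proj | f in Cc].

Definition hecke_algebra : set (G -> R[i]) :=
  [set conv mu (conv mu hecke_proj f) hecke_proj | f in Cc].

Definition inner_R (f g : G -> R[i]) : G -> R[i] := conv mu (invol Delta f) g.

Definition inner_R_positive : Prop :=
  forall f, Cc_proj f -> exists n (g : 'I_n -> G -> R[i]),
    [/\ (1 <= n)%N, forall i, hecke_algebra (g i)
      & inner_R f f = \sum_(i < n) conv mu (invol Delta (g i)) (g i)].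

Definition corner (A : cstarAlgebra R) (p : A) : set A :=
  [set cmul (cmul p a) p | a in [set: A]].

(* [C*(H) = pAp], where [H] is the Hecke algebra and [p] the projection [hecke_proj]. *)
Definition hecke_enveloping (A : cstarAlgebra R) (iota : (G -> R[i]) -> A) : Prop :=
  forall (V : hilbertSpace R) (pi : (G -> R[i]) -> {linear V -> V}),
    is_star_rep (conv mu) (invol Delta) hecke_algebra pi ->
    exists rho : A -> {linear V -> V},
      is_star_rep (@cmul R A) (@cstar R A) (corner (iota hecke_proj)) rho /\
      forall h v, hecke_algebra h -> rho (iota h) v = pi h v.

End Hecke.

(* Main.v *)
(** Write [a_x] for the indicator function of the coset [xH] and [p = a_e], so
    that [a_x^* a_x = p].  The projections [q_x = a_x a_x^*] are multiples of the
    indicators of the conjugates [x H x^-1], which are all normal in [N], so they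
    commute.  A function [f] in [C_c(G) p] is a combination of finitely many
    [a_(x_i)], hence is annihilated by the product of the [1 - q_(x_i)].  Since
    [f^* f = (a_x^* f)^* (a_x^* f) + f'^* f'] with [f' = f - q_x f] and [a_x^* f] in
    the Hecke algebra, splitting off the [x_i] one after the other writes [f^* f] as
    a sum of squares.

    For a representation [pi] of the Hecke algebra and a vector [v], positivity says
    that the kernel [K(x, y) = <pi(a_x^* a_y) v, v>] on [G] is positive definite.  It
    is invariant under left translations, so [C_c(G)] acts by convolution, with norm
    at most the [L^1]-norm, on the Hilbert space of functions on [G] with reproducing
    kernel [K].  The coefficient of [h] at the kernel function of the unit is
    [<pi(h) v, v>], so that [|pi(h) v|^2 = <pi(h^* h) v, v>] is bounded by
    [||h^* h|| |v|^2 = ||h||^2 |v|^2] for the norm of [C^*(G)].  Thus [pi] is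
    contractive, and extends by continuity to the closure [pAp] of the Hecke algebra. *)

Require Import Defs.
From HB Require Import structures.
From mathcomp Require Import all_boot all_order all_algebra.
From mathcomp Require Import complex ring lra.
From mathcomp Require Import all_classical all_reals all_analysis.
From mathcomp Require Import measurable_realfun.
Import numFieldNormedType.Exports.
Import Order.TTheory GRing.Theory Num.Theory.

Set Implicit Arguments.
Unset Strict Implicit.
Unset Printing Implicit Defensive.

Local Open Scope classical_set_scope.
Local Open Scope ring_scope.
Local Open Scope complex_scope.

(* [conv] alone would be the convex combination of the library. *)
Local Notation conv := Defs.conv.

(** * Integration of compactly supported continuous functions *)

(** [G] is not assumed sigma-compact, so Haar measure need not be sigma-finite and the usual Fubini
    theorem does not apply. The iterated integrals that occur have continuous, compactly supported
    integrands, and for these the exchange is proved by cutting a compact set into pieces on which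
    the integrand hardly varies.

    The norm of [C^*(G)] is a supremum over representations of the whole group algebra, whereas [pi]
    is given on the Hecke algebra only, so [pi] has to be induced to [G]. That needs positivity on
    all of [C_c(G) p]: the kernel is the matrix of inner products of the vectors [a_x] tensor [v] in
    the induced space. Contractivity can be tested one vector at a time, so only the part generated
    by a single [v] is built. It is realized by scalar functions on [G], so the group algebra acts
    by scalar integrals and no vector-valued integration occurs.

    Since [H] is open, right [H]-invariant functions are locally constant; this supplies the
    continuity of all functions in that space. *)

Section ComplexContinuity.
Context {R : realType}.
Implicit Types z w : R[i].

Lemma normc_Re z : `|z| = (complex.Re `|z|)%:C.
Proof. by rewrite normc_def. Qed.

(* [conjc] is written out because [_^*] is read as [Num.conj] inside a product. *)
Lemma conjcM z w : conjc (z * w) = conjc z * conjc w.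
Proof. exact: rmorphM. Qed.

Lemma conjcD z w : conjc (z + w) = conjc z + conjc w.
Proof. exact: rmorphD. Qed.

Lemma real_complexM (x y : R) : (x * y)%:C = x%:C * y%:C.
Proof. exact: rmorphM. Qed.

Lemma Re_norm_ge0 z : 0 <= complex.Re `|z|.
Proof. by rewrite -lecR -normc_Re rmorph0. Qed.

Lemma Re_le_norm z : `|complex.Re z| <= complex.Re `|z|.
Proof. by rewrite -lecR -normc_Re normc_ge_Re. Qed.

Lemma Im_le_norm z : `|complex.Im z| <= complex.Re `|z|.
Proof.
rewrite normc_def /= -sqrtr_sqr ler_wsqrtr// lerDr.
exact: sqr_ge0.
Qed.

Lemma Re_continuous : continuous (@complex.Re R : R[i]^o -> R).
Proof.
move=> z; apply/(@cvgrPdist_lt _ _ _ _ (nbhs_filter (z : R[i]^o))) => e e0.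
have := nbhsx_ballx (z : R[i]^o) e%:C; rewrite -ball_normE ltcR => /(_ e0).
apply: filterS => w zw; rewrite -ltcR (le_lt_trans _ zw)//.
by rewrite -raddfB normc_ge_Re.
Qed.

Lemma Im_continuous : continuous (@complex.Im R : R[i]^o -> R).
Proof.
move=> z; apply/(@cvgrPdist_lt _ _ _ _ (nbhs_filter (z : R[i]^o))) => e e0.
have := nbhsx_ballx (z : R[i]^o) e%:C; rewrite -ball_normE ltcR => /(_ e0).
apply: filterS => w zw; rewrite -ltcR (le_lt_trans _ zw)//.
by rewrite -raddfB normc_Re lecR Im_le_norm.
Qed.

Lemma real_complex_continuous : continuous (real_complex R : R -> R[i]^o).
Proof.
move=> x; apply/cvgrPdist_lt => e; rewrite ltcE => /andP[/eqP e1 e0].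
(* A positive element of [R[i]] has imaginary part zero, so [e] is a real number. *)
have ee : e = (complex.Re e)%:C by case: e e1 {e0} => a b /= ->.
have := nbhsx_ballx x (complex.Re e) e0; rewrite -ball_normE.
apply: filterS => y xy; rewrite ee -rmorphB.
by rewrite normc_def /= expr0n /= addr0 sqrtr_sqr ltcR.
Qed.

Lemma continuous_complexP (T : topologicalType) (f : T -> R[i]) :
  continuous (f : T -> R[i]^o) <->
  continuous (fun x => complex.Re (f x)) /\ continuous (fun x => complex.Im (f x)).
Proof.
split=> [cf|[cr ci]].
  split=> x; apply: (continuous_comp (f := f : T -> R[i]^o)); try exact: cf.
    exact: Re_continuous.
  exact: Im_continuous.
have -> : (f : T -> R[i]^o) = (fun x => (complex.Re (f x))%:C + 'i%C * (complex.Im (f x))%:C).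
  by apply/funext => x; rewrite -complexE.
move=> x; apply: (@cvgD _ (R[i]^o)).
  apply: (@continuous_comp _ _ (R[i]^o) (fun x => complex.Re (f x))); first exact: cr.
  exact: real_complex_continuous.
apply: (@cvgM R[i]); first exact: cvg_cst.
apply: (@continuous_comp _ _ (R[i]^o) (fun x => complex.Im (f x))); first exact: ci.
exact: real_complex_continuous.
Qed.

Lemma continuous_conjc (T : topologicalType) (f : T -> R[i]) :
  continuous (f : T -> R[i]^o) -> continuous ((fun x => conjc (f x)) : T -> R[i]^o).
Proof.
move=> /continuous_complexP[cr ci]; apply/continuous_complexP; split.
  by rewrite (_ : (fun _ => _) = (fun x => complex.Re (f x)))//;
    apply/funext => y; case: (f y).
rewrite (_ : (fun _ => _) = (fun x => - complex.Im (f x))).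
  by move=> x; apply: cvgN; exact: ci.
by apply/funext => y; case: (f y).
Qed.

End ComplexContinuity.

Section CompactIntegration.
Context {R : realType} {X : ptopologicalType}.
Variable mu : {measure set (borel X) -> \bar R}.
Hypothesis hX : hausdorff_space X.
Hypothesis mu_compact : forall K : set X, compact K -> (mu K < +oo)%E.

Lemma open_borel (U : set X) : open U -> measurable (U : set (borel X)).
Proof. exact: sub_sigma_algebra. Qed.

Lemma compact_borel (K : set X) : compact K -> measurable (K : set (borel X)).
Proof.
move=> /(compact_closed hX) cK; rewrite -(setCK K).
by apply: measurableC; apply: open_borel; exact: closed_openC.
Qed.

Lemma continuous_borel (f : X -> R) (D : set (borel X)) :
  continuous f -> measurable_fun D (f : borel X -> R).
Proof.
move=> cf mD; apply: (measurability _ (measurable_realfun.RGenOInfty.measurableE R)) => //.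
move=> _ [_ [r ->] <-]; apply: measurableI => //; apply: open_borel.
by move/continuousP : cf; apply; exact: interval_open.
Qed.

Lemma compact_integrable (f : X -> R) (K : set X) (D : set (borel X)) :
  continuous f -> compact K -> measurable D -> D `<=` K ->
  mu.-integrable D (EFin \o f).
Proof.
move=> cf cK mD DK; apply: measurable_bounded_integrable => //.
- by rewrite (le_lt_trans _ (mu_compact cK))// le_measure// inE//; exact: compact_borel.
- exact: continuous_borel.
- have /compact_bounded[M [Mr MK]] : compact (f @` K).
    by apply: continuous_compact => //; exact: continuous_subspaceT.
  exists M; split => // y My x /= Dx; apply: MK => //.
  by exists x => //; exact: DK.
Qed.

Definition compact_off (f : X -> R) := exists K, compact K /\ forall x, ~ K x -> f x = 0.

Lemma Rintegral_compact (f : X -> R) (K : set X) : compact K ->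
  (forall x, ~ K x -> f x = 0) -> \int[mu]_(x in K) f x = \int[mu]_x f x.
Proof.
move=> cK fK; rewrite Rintegral_mkcond; apply: eq_Rintegral => x _.
by rewrite patchE; case: ifPn => //; rewrite notin_setE => /fK.
Qed.

Lemma compact_off_integrable (f : X -> R) :
  continuous f -> compact_off f -> mu.-integrable setT (EFin \o f).
Proof.
move=> cf [K [cK fK]].
have := compact_integrable cf cK (compact_borel cK) (@subset_refl _ _).
rewrite -(setTI K) => /(integrable_restrict mu (compact_borel cK) measurableT).
congr (integrable _ _ _); apply/funext => x /=.
rewrite /patch; case: ifPn => //=; by rewrite notin_setE => /fK ->.
Qed.

End CompactIntegration.

Lemma continuous_pair (T A B : topologicalType) (f : T -> A) (g : T -> B) :
  continuous f -> continuous g -> continuous (fun t => (f t, g t)).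
Proof. by move=> cf cg t; apply: cvg_pair; [exact: cf|exact: cg]. Qed.

Lemma continuous_uncurry_comp (T A B Z : topologicalType) (Phi : A -> B -> Z)
    (f : T -> A) (g : T -> B) :
  continuous (fun p : A * B => Phi p.1 p.2) -> continuous f -> continuous g ->
  continuous (fun t => Phi (f t) (g t)).
Proof.
move=> cP cf cg t.
apply: (@continuous_comp _ _ _ (fun t => (f t, g t)) (fun p : A * B => Phi p.1 p.2)).
  exact: continuous_pair.
exact: cP.
Qed.

Lemma fst_continuous (A B : topologicalType) : continuous (@fst A B).
Proof. by move=> p; exact: cvg_fst. Qed.

Lemma snd_continuous (A B : topologicalType) : continuous (@snd A B).
Proof. by move=> p; exact: cvg_snd. Qed.

(** * Fubini's theorem for continuous functions with compact support *)

Section Fubini.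
Context {R : realType} {X Y : ptopologicalType}.

Lemma slice_continuousl (Phi : X -> Y -> R) (y : Y) :
  continuous (fun p : X * Y => Phi p.1 p.2) -> continuous (Phi ^~ y).
Proof.
move=> cP; apply: continuous_uncurry_comp cP _ _; last exact: cst_continuous.
by move=> ?; exact: cvg_id.
Qed.

Lemma slice_continuousr (Phi : X -> Y -> R) (x : X) :
  continuous (fun p : X * Y => Phi p.1 p.2) -> continuous (Phi x).
Proof.
move=> cP; apply: continuous_uncurry_comp cP _ _; first exact: cst_continuous.
by move=> ?; exact: cvg_id.
Qed.

(** The difference vanishes at each point [(y, x0)]. Compactness of [C], in its near-covering form,
    turns smallness near each of these points into one neighbourhood of [x0] that serves all of
    [C]. *)
Lemma tube (Phi : X -> Y -> R) (C : set Y) (x0 : X) (e : R) :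
  continuous (fun p : X * Y => Phi p.1 p.2) -> compact C -> 0 < e ->
  \forall x \near x0, forall y, C y -> `|Phi x0 y - Phi x y| < e.
Proof.
move=> cP /compact_near_coveringP cC e0.
apply: (cC X (nbhs x0) (fun x y => `|Phi x0 y - Phi x y| < e)) => y Cy.
pose h (p : Y * X) := Phi x0 p.1 - Phi p.2 p.1.
have ch : h p @[p --> (y, x0)] --> (0 : R).
  rewrite -(subrr (Phi x0 y)).
  apply: (@cvgB _ _ _ _ _ (fun p : Y * X => Phi x0 p.1) (fun p => Phi p.2 p.1) _ _).
    apply: (continuous_uncurry_comp cP (f := fun=> x0)); last exact: fst_continuous.
    exact: cst_continuous.
  apply: (continuous_uncurry_comp cP); [exact: snd_continuous|exact: fst_continuous].
by move/cvgr0Pnorm_lt : ch => /(_ e e0).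
Qed.

End Fubini.

Section FubiniMeasure.
Context {R : realType} {X Y : ptopologicalType}.
Variables (mu : {measure set (borel X) -> \bar R}) (nu : {measure set (borel Y) -> \bar R}).
Hypotheses (hX : hausdorff_space X) (hY : hausdorff_space Y).
Hypothesis mu_compact : forall K : set X, compact K -> (mu K < +oo)%E.
Hypothesis nu_compact : forall K : set Y, compact K -> (nu K < +oo)%E.

Lemma le_Rintegral_norm_bound (f : Y -> R) (C : set Y) (D : set (borel Y)) (M : R) :
  continuous f -> compact C -> measurable D -> D `<=` C ->
  (forall y, C y -> `|f y| <= M) -> `|\int[nu]_(y in D) f y| <= M * fine (nu D).
Proof.
move=> cf cC mD DC fM.
have nuD : (nu D < +oo)%E.
  by rewrite (le_lt_trans _ (nu_compact cC))// le_measure// inE//; exact: compact_borel.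
have fi := compact_integrable hY nu_compact cf cC mD DC.
apply: (le_trans (le_normr_Rintegral mD fi)).
rewrite -Rintegral_cst//; apply: le_Rintegral => //.
- exact: integrable_norm.
- apply: measurable_bounded_integrable => //; exact: bounded_cst.
- by move=> y /DC; exact: fM.
Qed.

Lemma continuous_Rintegral (Phi : X -> Y -> R) (C : set Y) (D : set (borel Y)) :
  continuous (fun p : X * Y => Phi p.1 p.2) -> compact C -> measurable D ->
  D `<=` C -> continuous (fun x => \int[nu]_(y in D) Phi x y).
Proof.
move=> cP cC mD DC x0; apply/cvgrPdist_lt => e e0.
(* The summand 1 keeps [m] positive when [nu D] is 0 and makes the final inequality strict. *)
pose m := fine (nu D) + 1.
have m0 : 0 < m by rewrite ltr_wpDl// fine_ge0.
have e'0 : 0 < e / m by rewrite divr_gt0.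
have int x : nu.-integrable D (EFin \o Phi x).
  by apply: (compact_integrable hY nu_compact _ cC mD DC); exact: slice_continuousr.
apply: filterS (tube x0 cP cC e'0) => x Hx.
rewrite -RintegralB//.
have cB : continuous (fun y => Phi x0 y - Phi x y).
  by move=> y; apply: cvgB; exact: slice_continuousr.
apply: le_lt_trans (le_Rintegral_norm_bound (M := e / m) cB cC mD DC _) _.
  by move=> y /Hx/ltW.
rewrite -mulrA gtr_pMr// mulrC ltr_pdivrMr// mul1r /m ltrDl//.
Qed.

End FubiniMeasure.

Section FubiniMeasure.
Context {R : realType} {X Y : ptopologicalType}.
Variables (mu : {measure set (borel X) -> \bar R}) (nu : {measure set (borel Y) -> \bar R}).
Hypotheses (hX : hausdorff_space X) (hY : hausdorff_space Y).
Hypothesis mu_compact : forall K : set X, compact K -> (mu K < +oo)%E.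
Hypothesis nu_compact : forall K : set Y, compact K -> (nu K < +oo)%E.
Variables (Phi : X -> Y -> R) (K : set X) (C : set Y).
Hypotheses (cP : continuous (fun p : X * Y => Phi p.1 p.2)).
Hypotheses (cK : compact K) (cC : compact C).

Let Phi' (y : Y) (x : X) := Phi x y.

Let cP' : continuous (fun p : Y * X => Phi' p.1 p.2).
Proof.
by apply: (continuous_uncurry_comp cP); [exact: snd_continuous|exact: fst_continuous].
Qed.

Let inner y := \int[mu]_(x in K) Phi x y.

Let cinner : continuous inner.
Proof. exact: (continuous_Rintegral hX mu_compact cP' cK (compact_borel hX cK)). Qed.

Let couter (D : set (borel Y)) : measurable D -> D `<=` C ->
  continuous (fun x => \int[nu]_(y in D) Phi x y).
Proof. by move=> mD DC; exact: (continuous_Rintegral hY nu_compact cP cC mD DC). Qed.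

(** This error is finitely additive in [D], and on a set where [Phi] varies by less than [e] it is
    at most a constant times [e * nu D]. Cutting [C] into such sets makes the error of [C]
    arbitrarily small. *)
Let defect (D : set (borel Y)) :=
  \int[nu]_(y in D) inner y - \int[mu]_(x in K) \int[nu]_(y in D) Phi x y.

(* Near [y0] both iterated integrals are close to [nu D * inner y0]. *)
Let defect_small (D : set (borel Y)) (y0 : Y) (e : R) :
  measurable D -> D `<=` C ->
  (forall y, D y -> forall x, K x -> `|Phi' y0 x - Phi' y x| < e) ->
  `|defect D| <= 2%:R * e * fine (mu K) * fine (nu D).
Proof.
move=> mD DC HD.
have mK := compact_borel hX cK.
have nuD : (nu D < +oo)%E.
  by rewrite (le_lt_trans _ (nu_compact cC))// le_measure// inE//; exact: compact_borel.
have sl y : continuous (fun x => Phi x y) by exact: slice_continuousl.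
have sr x : continuous (Phi x) by exact: slice_continuousr.
have iK (f : X -> R) : continuous f -> mu.-integrable K (EFin \o f).
  by move=> cf; exact: (compact_integrable hX mu_compact cf cK mK).
have iD (f : Y -> R) : continuous f -> nu.-integrable D (EFin \o f).
  by move=> cf; exact: (compact_integrable hY nu_compact cf cC mD DC).
have e1 : `|\int[nu]_(y in D) inner y - inner y0 * fine (nu D)| <=
    e * fine (mu K) * fine (nu D).
  rewrite -Rintegral_cst// -RintegralB//; [|exact: iD|exact/iD/cst_continuous].
  apply: (le_trans (le_normr_Rintegral mD _)).
    by apply: iD => y; apply: cvgB; [exact: cinner|exact: cvg_cst].
  rewrite -[leRHS]Rintegral_cst//; apply: le_Rintegral => //.
  - apply: integrable_norm; apply: iD => y; apply: cvgB; [exact: cinner|exact: cvg_cst].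
  - exact/iD/cst_continuous.
  move=> y Dy; rewrite /inner -RintegralB//; [|exact: iK..].
  apply: (le_trans (le_normr_Rintegral mK _)).
    by apply: iK => x; apply: cvgB; exact: sl.
  rewrite -Rintegral_cst//; apply: le_Rintegral => //.
  - by apply: integrable_norm; apply: iK => x; apply: cvgB; exact: sl.
  - exact/iK/cst_continuous.
  by move=> x Kx; rewrite distrC ltW//; exact: HD.
have e2 : `|\int[mu]_(x in K) (\int[nu]_(y in D) Phi x y) - inner y0 * fine (nu D)| <=
    e * fine (mu K) * fine (nu D).
  rewrite /inner -RintegralZr//; last exact: iK.
  have cz : continuous (fun x => Phi x y0 * fine (nu D)).
    by move=> x; apply: cvgM; [exact: sl|exact: cvg_cst].
  rewrite -RintegralB//; [|exact/iK/couter|exact: iK].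
  apply: (le_trans (le_normr_Rintegral mK _)).
    by apply: iK => x; apply: cvgB; [exact: couter|exact: cz].
  rewrite mulrAC -[leRHS]Rintegral_cst//; apply: le_Rintegral => //.
  - by apply: integrable_norm; apply: iK => x; apply: cvgB; [exact: couter|exact: cz].
  - exact/iK/cst_continuous.
  move=> x Kx; rewrite -Rintegral_cst// -RintegralB//; [|exact: iD|exact/iD/cst_continuous].
  apply: (le_trans (le_normr_Rintegral mD _)).
    by apply: iD => y; apply: cvgB; [exact: sr|exact: cvg_cst].
  rewrite -Rintegral_cst//; apply: le_Rintegral => //.
  - apply: integrable_norm; apply: iD => y; apply: cvgB; [exact: sr|exact: cvg_cst].
  - exact/iD/cst_continuous.
  by move=> y Dy; rewrite distrC ltW//; exact: HD.
rewrite /defect -mulrA -mulrA mulr_natl mulr2n mulrA.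
rewrite -[X in `|X|](subrKA (inner y0 * fine (nu D))).
by apply: (le_trans (ler_normD _ _)); rewrite lerD// distrC.
Qed.

Let defect_setU (D E : set (borel Y)) : measurable D -> measurable E ->
  D `<=` C -> E `<=` C -> [disjoint D & E] ->
  defect (D `|` E) = defect D + defect E.
Proof.
move=> mD mE DC EC DE.
have mK := compact_borel hX cK.
have DEC : D `|` E `<=` C by rewrite subUset.
have mDE : measurable (D `|` E) by exact: measurableU.
rewrite /defect Rintegral_setU//; last first.
  exact: (compact_integrable hY nu_compact _ cC mDE DEC).
rewrite (@eq_Rintegral _ _ _ mu K (fun x
  => \int[nu]_(y in D) Phi x y + \int[nu]_(y in E) Phi x y)); last first.
  move=> x _; rewrite Rintegral_setU//.
  apply: (compact_integrable hY nu_compact _ cC mDE DEC).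
  exact: slice_continuousr.
rewrite RintegralD//; [by rewrite opprD addrACA| |].
- apply: (compact_integrable hX mu_compact _ cK mK) => //; exact: couter.
- apply: (compact_integrable hX mu_compact _ cK mK) => //; exact: couter.
Qed.

(** The interior makes these sets open, hence Borel, so that [D] can be cut along them. *)
Let W (e : R) (y0 : Y) : set Y :=
  interior [set y | forall x, K x -> `|Phi' y0 x - Phi' y x| < e].

(** The sets of the cover are split off from [D] one at a time. The pieces are disjoint, so their
    measures add up to [nu D] and the bound does not depend on the length of [s]. *)
Let defect_cover (e : R) (s : seq Y) (D : set (borel Y)) : 0 < e ->
  measurable D -> D `<=` C -> D `<=` (fun y => exists2 y0, y0 \in s & W e y0 y) ->
  `|defect D| <= 2%:R * e * fine (mu K) * fine (nu D).
Proof.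
move=> e0; elim: s D => [|y0 s IH] D mD DC Ds.
  have -> : D = set0 by apply/seteqP; split => // y /Ds[].
  rewrite /defect Rintegral_set0 sub0r normrN.
  rewrite (@eq_Rintegral _ _ _ mu K (cst 0)); last first.
    by move=> x _; rewrite Rintegral_set0.
  rewrite Rintegral_cst//; last exact: compact_borel.
  by rewrite mul0r normr0 !mulr_ge0// ?fine_ge0// ltW.
have mW : measurable (W e y0 : set (borel Y)).
  by apply: open_borel; exact: open_interior.
have mD1 : measurable (D `&` W e y0) by exact: measurableI.
have mD2 : measurable (D `\` W e y0) by exact: measurableD.
have D1C : D `&` W e y0 `<=` C by move=> y [/DC].
have D2C : D `\` W e y0 `<=` C by move=> y [/DC].
have D12 : [disjoint D `&` W e y0 & D `\` W e y0].
  by apply/disj_setPS => y [[_ ?] [_ ?]].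
have fin (E : set (borel Y)) : measurable E -> E `<=` C -> nu E \is a fin_num.
  move=> mE EC; rewrite ge0_fin_numE// (le_lt_trans _ (nu_compact cC))//.
  by rewrite le_measure// inE//; exact: compact_borel.
have -> : D = (D `&` W e y0) `|` (D `\` W e y0) by rewrite setUIDK.
rewrite defect_setU// measureU//; last exact/disj_set2P.
rewrite fineD ?fin// mulrDr (le_trans (ler_normD _ _))// lerD//.
  apply: (defect_small (y0 := y0)) => // y [_ /interior_subset].
  by move=> H x Kx; exact: H.
apply: IH => // y [/Ds[z]]; rewrite inE => /predU1P[->//|zs Wz _].
by exists z.
Qed.

Lemma Fubini_compact :
  \int[nu]_(y in C) \int[mu]_(x in K) Phi x y =
  \int[mu]_(x in K) \int[nu]_(y in C) Phi x y.
Proof.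
apply/eqP; rewrite -subr_eq0 -normr_le0 -[X in `|X|]/(defect C).
apply/ler_addgt0Pl => r r0; rewrite addr0.
(* With [e = r / m] the bound of [defect_cover] becomes [e * (m - 1)], which is at most [r]. *)
pose m := 2%:R * fine (mu K) * fine (nu C) + 1.
have m0 : 0 < m by rewrite ltr_wpDl// !mulr_ge0// fine_ge0.
pose e := r / m.
have e0 : 0 < e by rewrite divr_gt0.
have CW : C `<=` \bigcup_(y in C) W e y.
  move=> y Cy; exists y => //; exact: (tube y cP' cK e0).
have := cC; rewrite compact_cover => /(_ Y C (W e) (fun y _ => @open_interior _ _) CW)[s sC Cs].
have mC := compact_borel hY cC.
apply: (@le_trans _ _ (2%:R * e * fine (mu K) * fine (nu C))).
  apply: (@defect_cover e (finmap.enum_fset s) C e0 mC) => //.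
rewrite (_ : _ * _ = e * (m - 1)); last first.
  by rewrite /m; ring.
by rewrite /e mulrAC ler_pdivrMr// ler_pM2l// gerBl.
Qed.

End FubiniMeasure.

Section FubiniSupport.
Context {R : realType} {X Y : ptopologicalType}.
Variables (mu : {measure set (borel X) -> \bar R}) (nu : {measure set (borel Y) -> \bar R}).
Hypotheses (hX : hausdorff_space X) (hY : hausdorff_space Y).
Hypothesis mu_compact : forall K : set X, compact K -> (mu K < +oo)%E.
Hypothesis nu_compact : forall K : set Y, compact K -> (nu K < +oo)%E.

Lemma Fubini_compact_support (Phi : X -> Y -> R) (K : set X) (C : set Y) :
  continuous (fun p : X * Y => Phi p.1 p.2) -> compact K -> compact C ->
  (forall x y, ~ (K x /\ C y) -> Phi x y = 0) ->
  \int[nu]_y \int[mu]_x Phi x y = \int[mu]_x \int[nu]_y Phi x y.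
Proof.
move=> cP cK cC P0.
rewrite -(Rintegral_compact nu cC); last first.
  move=> y Cy; rewrite -(Rintegral_compact mu cK) ?(@eq_Rintegral _ _ _ _ _ (cst 0)).
  - by rewrite Rintegral_cst ?mul0r//; exact: compact_borel.
  - by move=> x _; rewrite P0// => -[].
  - by move=> x _; rewrite P0// => -[].
rewrite -[RHS](Rintegral_compact mu cK); last first.
  move=> x Kx; rewrite -(Rintegral_compact nu cC) ?(@eq_Rintegral _ _ _ _ _ (cst 0)).
  - by rewrite Rintegral_cst ?mul0r//; exact: compact_borel.
  - by move=> y _; rewrite P0// => -[].
  - by move=> y _; rewrite P0// => -[].
transitivity (\int[nu]_(y in C) \int[mu]_(x in K) Phi x y).
  apply: eq_Rintegral => y _; rewrite (Rintegral_compact mu cK)// => x Kx.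
  by rewrite P0// => -[].
rewrite (Fubini_compact hX hY mu_compact nu_compact cP cK cC).
apply: eq_Rintegral => x _; rewrite (Rintegral_compact nu cC)// => y Cy.
by rewrite P0// => -[].
Qed.

End FubiniSupport.

(** * Integrals under maps that scale the measure *)

Section RintegralTransport.
Context {R : realType} d (T : measurableType d) (mu : {measure set T -> \bar R}).

Lemma Rintegral_mscale (k : {nonneg R}) (f : T -> R) :
  mu.-integrable setT (EFin \o f) ->
  \int[mscale k mu]_x f x = k%:num * \int[mu]_x f x.
Proof.
move=> fi; have mf := measurable_int mu fi.
rewrite /Rintegral integralE [in RHS]integralE.
rewrite ge0_integral_mscale//; last exact: measurable_funepos.
rewrite ge0_integral_mscale//; last exact: measurable_funeneg.
have ip : (\int[mu]_x (EFin \o f)^\+ x)%E \is a fin_num.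
  exact/integrable_fin_num/integrable_funepos.
have iN : (\int[mu]_x (EFin \o f)^\- x)%E \is a fin_num.
  exact/integrable_fin_num/integrable_funeneg.
have dd : ((\int[mu]_x (EFin \o f)^\+ x) +? - (\int[mu]_x (EFin \o f)^\- x))%E.
  by rewrite fin_num_adde_defl// fin_numN.
by rewrite -muleBr// fineM// fin_numB ip iN.
Qed.

(** The preimage of a set under [phi] is its image under [psi], so the push-forward of [mu] along
    [phi] is [k] times [mu]. *)
Lemma Rintegral_image_scale (phi psi : T -> T) (k : {nonneg R}) (f : T -> R) :
  measurable_fun setT phi -> measurable_fun setT f ->
  cancel phi psi -> cancel psi phi ->
  (forall E, measurable E -> mu (psi @` E) = k%:num%:E * mu E)%E ->
  mu.-integrable setT (EFin \o f) -> mu.-integrable setT (EFin \o (f \o phi)) ->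
  \int[mu]_x f (phi x) = k%:num * \int[mu]_x f x.
Proof.
move=> mphi mf phiK psiK muE fi fphi.
rewrite -Rintegral_mscale// /Rintegral; congr fine.
have := @integral_pushforward _ _ _ _ _ phi mphi mu setT (EFin \o f).
rewrite preimage_setT => <- //; last exact/measurable_EFinP.
pose m1 : {measure set T -> \bar R} := pushforward mu phi.
apply: (@eq_measure_integral _ _ _ setT (mscale k mu) (m1 mphi)) => A mA _.
rewrite /m1 /= /pushforward /mscale /= -muE//; congr (mu _).
apply/seteqP; split => x /=.
  by move=> Ax; exists (phi x).
by move=> [y Ay <-]; rewrite psiK.
Qed.

End RintegralTransport.

Section GroupContinuity.
Context {G : topologicalGroupType}.

Lemma continuous_mulg (T : topologicalType) (f g : T -> G) :
  continuous f -> continuous g -> continuous (fun t => f t * g t)%g.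
Proof.
by apply: (@continuous_uncurry_comp _ _ _ _ (fun x y : G => x * y)%g); exact: mulg_continuous.
Qed.

Lemma continuous_invg (T : topologicalType) (f : T -> G) :
  continuous f -> continuous (fun t => (f t)^-1)%g.
Proof.
move=> cf t; apply: (@continuous_comp _ _ _ f (fun x : G => x^-1)%g); first exact: cf.
exact: invg_continuous.
Qed.

Lemma compact_mulg (K L : set G) : compact K -> compact L ->
  compact [set (p.1 * p.2)%g | p in K `*` L].
Proof.
move=> cK cL; apply: continuous_compact; last exact: compact_setX.
exact/continuous_subspaceT/mulg_continuous.
Qed.

Lemma compact_invg (K : set G) : compact K -> compact [set x^-1%g | x in K].
Proof.
move=> cK; apply: continuous_compact => //.
exact/continuous_subspaceT/invg_continuous.
Qed.

End GroupContinuity.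

(** * Continuous functions with compact support on a group *)

Section ContinuousCompactSupport.
Context {R : realType} {G : topologicalGroupType}.
Hypothesis hG : hausdorff_space G.
Implicit Types f g : G -> R[i].

(** An arbitrary compact set off which [f] vanishes is easier to produce for sums, products and
    composites than the closure of the support. In a Hausdorff space that closure is a closed subset
    of it, hence compact. *)
Lemma CcP f : Cc f <-> continuous (f : G -> R[i]^o) /\
  exists2 K, compact K & forall x, ~ K x -> f x = 0.
Proof.
split=> -[cf].
  move=> cK; split => //; exists (closure [set x | f x != 0]) => // x.
  by apply: contra_notP => /eqP fx; exact: subset_closure.
move=> [K cK fK]; split => //.
apply: (@subclosed_compact _ _ K) => //; first exact: closed_closure.
have /closure_id -> := compact_closed hG cK.
apply: closureS => x /= fx; apply: contrapT => /fK fx0.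
by rewrite fx0 eqxx in fx.
Qed.

Lemma CcM f (g : G -> R[i]) : Cc f -> continuous (g : G -> R[i]^o) ->
  Cc (fun x => f x * g x).
Proof.
move=> /CcP[cf [K cK fK]] cg; apply/CcP; split.
  by move=> x; apply: (@cvgM R[i]); [exact: cf|exact: cg].
by exists K => // x /fK ->; rewrite mul0r.
Qed.

Lemma CcZ a f : Cc f -> Cc (a *: f).
Proof.
move=> /CcP[cf [K cK fK]]; apply/CcP; split.
  by move=> x; apply: (@cvgZr _ R[i]^o); exact: cf.
by exists K => // x /fK; rewrite fctE => ->; rewrite scaler0.
Qed.

Lemma CcD f g : Cc f -> Cc g -> Cc (f + g).
Proof.
move=> /CcP[cf [K cK fK]] /CcP[cg [L cL gL]]; apply/CcP; split.
  by move=> x; apply: (@cvgD _ R[i]^o); [exact: cf|exact: cg].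
exists (K `|` L); first exact: compactU.
by move=> x /not_orP[/fK fx /gL gx]; rewrite fctE fx gx addr0.
Qed.

Lemma Cc0 : Cc (0 : G -> R[i]).
Proof.
apply/CcP; split; first exact: cst_continuous.
by exists set0 => //; exact: compact0.
Qed.

Lemma CcN f : Cc f -> Cc (- f).
Proof. by move=> /(CcZ (-1)); rewrite scaleN1r. Qed.

Lemma CcB f g : Cc f -> Cc g -> Cc (f - g).
Proof. by move=> cf /CcN; exact: CcD. Qed.

Lemma Cc_sum (I : Type) (s : seq I) (F : I -> G -> R[i]) :
  (forall i, Cc (F i)) -> Cc (\sum_(i <- s) F i).
Proof. by move=> cF; apply: (big_ind Cc); [exact: Cc0|exact: CcD|]. Qed.

Lemma Cc_comp f (phi psi : G -> G) : Cc f -> continuous phi -> continuous psi ->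
  cancel phi psi -> Cc (f \o phi).
Proof.
move=> /CcP[cf [K cK fK]] cphi cpsi phiK; apply/CcP; split.
  by move=> x; apply: (@continuous_comp _ _ _ phi (f : G -> R[i]^o)); [exact: cphi|exact: cf].
exists (psi @` K).
  by apply: continuous_compact => //; exact: continuous_subspaceT.
move=> x; apply: contra_notP => /eqP fx; exists (phi x) => //.
by apply: contrapT => /fK/eqP; apply/negP.
Qed.

Lemma Cc_conj f : Cc f -> Cc (fun x => conjc (f x)).
Proof.
move=> /CcP[cf [K cK fK]]; apply/CcP; split; first exact: continuous_conjc.
by exists K => // x /fK ->; rewrite conjc0.
Qed.

Lemma continuous_mulgl (y : G) : continuous (fun x => y * x)%g.
Proof.
by apply: (@continuous_mulg _ _ (fun=> y) id); [exact: cst_continuous|move=> ?; exact: cvg_id].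
Qed.

Lemma continuous_mulgr (y : G) : continuous (fun x => x * y)%g.
Proof.
by apply: (@continuous_mulg _ _ id (fun=> y)); [move=> ?; exact: cvg_id|exact: cst_continuous].
Qed.

Lemma Cc_mull y f : Cc f -> Cc (fun x => f (y * x)%g).
Proof.
move=> /Cc_comp; apply; [exact: continuous_mulgl|exact: (continuous_mulgl (y := y^-1%g))|].
exact: mulKg.
Qed.

Lemma Cc_mulr y f : Cc f -> Cc (fun x => f (x * y)%g).
Proof.
move=> /Cc_comp; apply; [exact: continuous_mulgr|exact: (continuous_mulgr (y := y^-1%g))|].
exact: mulgK.
Qed.

Lemma Cc_inv f : Cc f -> Cc (fun x => f x^-1%g).
Proof.
by move=> /Cc_comp; apply; [exact: invg_continuous|exact: invg_continuous|exact: invgK].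
Qed.

End ContinuousCompactSupport.

(** * The convolution algebra *)

#[local] Opaque Cc.

Section HaarIntegral.
Context {R : realType} {G : topologicalGroupType}.
Variable mu : {measure set (borel G) -> \bar R}.
Hypotheses (hG : hausdorff_space G) (haar : left_haar_measure mu).
Implicit Types f g : G -> R[i].

Lemma haar_compact (K : set G) : compact K -> (mu K < +oo)%E.
Proof. by case: haar => -[h _ _] _ _; exact: h. Qed.

Lemma Cc_integrable_Re f : Cc f ->
  mu.-integrable setT (EFin \o (fun x => complex.Re (f x))).
Proof.
move=> /(CcP hG)[/continuous_complexP[cf _] [K cK fK]].
apply: (compact_off_integrable hG haar_compact) => //.
by exists K; split => // x /fK ->.
Qed.

Lemma Cc_integrable_Im f : Cc f ->
  mu.-integrable setT (EFin \o (fun x => complex.Im (f x))).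
Proof.
move=> /(CcP hG)[/continuous_complexP[_ cf] [K cK fK]].
apply: (compact_off_integrable hG haar_compact) => //.
by exists K; split => // x /fK ->.
Qed.

Lemma Cc_integrable_norm f : Cc f ->
  mu.-integrable setT (EFin \o (fun x => complex.Re `|f x|)).
Proof.
move=> /(CcP hG)[cf [K cK fK]].
apply: (compact_off_integrable hG haar_compact); last first.
  by exists K; split => // x /fK ->; rewrite normr0.
move=> x; apply: (@continuous_comp _ _ _ (fun x => `|f x| : R[i]^o) (@complex.Re R)).
  exact: (@cvg_norm _ R[i]^o _ _ _ (f : G -> R[i]^o) _ (cf x)).
exact: Re_continuous.
Qed.

Lemma eq_Cintegral f g : f =1 g -> Cintegral mu f = Cintegral mu g.
Proof. by move=> /funext ->. Qed.

Lemma CintegralD f g : Cc f -> Cc g ->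
  Cintegral mu (fun x => f x + g x) = Cintegral mu f + Cintegral mu g.
Proof.
move=> cf cg; rewrite /Cintegral.
under eq_Rintegral do rewrite raddfD.
under [X in _ +i* X]eq_Rintegral do rewrite raddfD.
by rewrite !RintegralD//;
  [exact: Cc_integrable_Im|exact: Cc_integrable_Im|exact: Cc_integrable_Re|exact:
    Cc_integrable_Re].
Qed.

Lemma CintegralZ a f : Cc f -> Cintegral mu (fun x => a * f x) = a * Cintegral mu f.
Proof.
move=> cf; rewrite /Cintegral.
have [ir im] := (Cc_integrable_Re cf, Cc_integrable_Im cf).
have iZ (r : R) (h : G -> R) : mu.-integrable setT (EFin \o h) ->
    mu.-integrable setT (EFin \o (fun x => r * h x)).
  by move=> /(integrableZl measurableT r); apply: eq_integrable.
case: a => a b; apply/eqP; rewrite eq_complex /=; apply/andP; split; apply/eqP.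
  rewrite -!RintegralZl// -RintegralB//; [|exact: iZ|exact: iZ].
  by apply: eq_Rintegral => x _; case: (f x).
rewrite -!RintegralZl// -RintegralD//; [|exact: iZ|exact: iZ].
by apply: eq_Rintegral => x _; case: (f x).
Qed.

Lemma CintegralZr a f : Cc f -> Cintegral mu (fun x => f x * a) = Cintegral mu f * a.
Proof.
by move=> cf; rewrite mulrC -CintegralZ//; apply: eq_Cintegral => x; rewrite mulrC.
Qed.

Lemma Cintegral0 : Cintegral mu (fun=> 0) = 0.
Proof. by rewrite /Cintegral !Rintegral_cst//= mul0r. Qed.

Lemma Cintegral_conj f : Cc f -> Cintegral mu (fun x => conjc (f x)) = conjc (Cintegral mu f).
Proof.
move=> cf; apply/eqP; rewrite eq_complex /=; apply/andP; split; apply/eqP.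
  by apply: eq_Rintegral => x _; case: (f x).
rewrite -mulN1r -RintegralZl//; last exact: Cc_integrable_Im.
by apply: eq_Rintegral => x _; case: (f x) => a b /=; rewrite mulN1r.
Qed.

Lemma L1norm_ge0 f : 0 <= L1norm mu f.
Proof. by apply: Rintegral_ge0 => x _; exact: Re_norm_ge0. Qed.

Lemma norm_Cintegral f : Cc f -> complex.Re `|Cintegral mu f| <= L1norm mu f.
Proof.
move=> cf; set z := Cintegral mu f.
have [->|z0] := eqVneq z 0; first by rewrite normr0 L1norm_ge0.
(* [u] rotates the integral onto the positive real axis, where it equals its real part and the
   integrand can be compared pointwise. *)
pose u := `|z| / z.
have nu : `|u| = 1 by rewrite normrM normfV normr_id divff// normr_eq0.
have -> : `|z| = Cintegral mu (fun x => u * f x).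
  by rewrite CintegralZ// -/z /u divfK.
apply: le_Rintegral => //.
- by apply: Cc_integrable_Re; exact: (CcZ hG).
- exact: Cc_integrable_norm.
move=> x _; rewrite (le_trans (ler_norm _))// (le_trans (Re_le_norm _))//.
by rewrite normrM nu mul1r.
Qed.

Lemma CFubini (Phi : G -> G -> R[i]) (K L : set G) :
  continuous ((fun p : G * G => Phi p.1 p.2) : G * G -> R[i]^o) ->
  compact K -> compact L -> (forall x y, ~ (K x /\ L y) -> Phi x y = 0) ->
  Cintegral mu (fun y => Cintegral mu (fun x => Phi x y)) =
  Cintegral mu (fun x => Cintegral mu (fun y => Phi x y)).
Proof.
move=> /continuous_complexP[cr ci] cK cL P0.
apply/eqP; rewrite eq_complex /=; apply/andP; split; apply/eqP.
  apply: (@Fubini_compact_support _ _ _ mu mu hG hG haar_compact haar_compact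
    (fun x y => complex.Re (Phi x y)) K L cr cK cL) => //.
  by move=> x y /P0 ->.
apply: (@Fubini_compact_support _ _ _ mu mu hG hG haar_compact haar_compact
  (fun x y => complex.Im (Phi x y)) K L ci cK cL) => //.
by move=> x y /P0 ->.
Qed.

Lemma continuous_Cintegral (Phi : G -> G -> R[i]) (K : set G) :
  continuous ((fun p : G * G => Phi p.1 p.2) : G * G -> R[i]^o) ->
  compact K -> (forall x y, ~ K y -> Phi x y = 0) ->
  continuous ((fun x => Cintegral mu (Phi x)) : G -> R[i]^o).
Proof.
move=> /continuous_complexP[cr ci] cK P0; have mK := compact_borel hG cK.
apply/continuous_complexP; split => /=.
  rewrite (_ : (fun _ => _) = (fun x => \int[mu]_(y in K) complex.Re (Phi x y))).
    exact: (continuous_Rintegral hG haar_compact cr cK).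
  by apply/funext => x; rewrite (Rintegral_compact mu cK)// => y /P0 ->.
rewrite (_ : (fun _ => _) = (fun x => \int[mu]_(y in K) complex.Im (Phi x y))).
  exact: (continuous_Rintegral hG haar_compact ci cK).
by apply/funext => x; rewrite (Rintegral_compact mu cK)// => y /P0 ->.
Qed.

Lemma measurable_continuous (phi : G -> G) : continuous phi ->
  measurable_fun setT (phi : borel G -> borel G).
Proof.
move=> cphi; apply: (@measurability _ _ (borel G) (borel G) setT phi (@open G)) => //.
move=> _ [U oU <-]; rewrite setTI; apply: open_borel.
by move/continuousP : cphi; apply.
Qed.

Lemma Cintegral_image_scale (phi psi : G -> G) (k : R) f :
  0 <= k -> continuous phi -> continuous psi ->
  cancel phi psi -> cancel psi phi ->
  (forall E : set (borel G), measurable E -> mu (psi @` (E : set G)) = k%:E * mu E)%E ->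
  Cc f -> Cintegral mu (fun x => f (phi x)) = k%:C * Cintegral mu f.
Proof.
move=> k0 cphi cpsi phiK psiK muE cf.
have cfp := Cc_comp hG cf cphi cpsi phiK.
have mphi := measurable_continuous cphi.
apply/eqP; rewrite eq_complex /= !mul0r subr0 addr0; apply/andP; split; apply/eqP.
  apply: (@Rintegral_image_scale _ _ _ mu phi psi (NngNum k0) (fun x => complex.Re (f x)))
    => //.
  - by apply: continuous_borel; move/(CcP hG) : cf => [/continuous_complexP[]].
  - exact: Cc_integrable_Re.
  - exact: Cc_integrable_Re cfp.
apply: (@Rintegral_image_scale _ _ _ mu phi psi (NngNum k0) (fun x => complex.Im (f x))) => //.
- by apply: continuous_borel; move/(CcP hG) : cf => [/continuous_complexP[]].
- exact: Cc_integrable_Im.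
- exact: Cc_integrable_Im cfp.
Qed.

Lemma Cintegral_mull y f : Cc f -> Cintegral mu (fun x => f (y * x)%g) = Cintegral mu f.
Proof.
move=> cf; rewrite (@Cintegral_image_scale (fun x => y * x)%g (fun x => y^-1 * x)%g 1) ?mul1r//.
- exact: continuous_mulgl.
- exact: continuous_mulgl.
- exact: mulKg.
- exact: mulVKg.
- by move=> E mE; rewrite mul1e; case: haar => _ _ ->.
Qed.

Lemma continuous_conv_integrand f g :
  continuous (f : G -> R[i]^o) -> continuous (g : G -> R[i]^o) ->
  continuous ((fun p : G * G => f p.2 * g (p.2^-1 * p.1)%g) : G * G -> R[i]^o).
Proof.
move=> cf cg p; apply: (@cvgM R[i]).
  apply: (@continuous_comp _ _ _ snd (f : G -> R[i]^o)); last exact: cf.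
  exact: snd_continuous.
apply: (@continuous_comp _ _ _ (fun p : G * G => (p.2^-1 * p.1)%g) (g : G -> R[i]^o));
  last exact: cg.
apply: continuous_mulg; last exact: fst_continuous.
by apply: continuous_invg; exact: snd_continuous.
Qed.

(** Here and in the algebraic laws below the right factor is only assumed continuous: [C_c(G)] will
    act by convolution on a reproducing kernel space, whose elements need not have compact
    support. *)
Lemma continuous_conv f g : Cc f -> continuous (g : G -> R[i]^o) ->
  continuous (conv mu f g : G -> R[i]^o).
Proof.
move=> /(CcP hG)[cf [K cK fK]] cg.
apply: (continuous_Cintegral (Phi := fun x y => f y * g (y^-1 * x)%g) _ cK).
  exact: continuous_conv_integrand.
by move=> x y /fK ->; rewrite mul0r.
Qed.

Lemma Cc_conv_integrand f g x : Cc f -> continuous (g : G -> R[i]^o) ->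
  Cc (fun y => f y * g (y^-1 * x)%g).
Proof.
move=> cf cg; apply: (@CcM _ _ hG f (fun y => g (y^-1 * x)%g)) cf _ => y.
apply: (@continuous_comp _ _ _ (fun y : G => (y^-1 * x)%g) (g : G -> R[i]^o)); last exact: cg.
apply: continuous_mulg; last exact: cst_continuous.
exact: invg_continuous.
Qed.

Lemma Cc_conv f g : Cc f -> Cc g -> Cc (conv mu f g).
Proof.
move=> cf cg; apply/(CcP hG); split.
  by apply: continuous_conv => //; case/(CcP hG) : cg.
move/(CcP hG) : cf => [_ [K cK fK]]; move/(CcP hG) : cg => [_ [L cL gL]].
exists [set (p.1 * p.2)%g | p in K `*` L]; first exact: compact_mulg.
move=> x KLx; rewrite -Cintegral0; apply: eq_Cintegral => y.
have [Ky|/fK ->] := pselect (K y); last by rewrite mul0r.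
rewrite gL ?mulr0// => Lyx; apply: KLx; exists (y, y^-1 * x)%g => //=.
by rewrite mulVKg.
Qed.

Lemma convDl f1 f2 g : Cc f1 -> Cc f2 -> continuous (g : G -> R[i]^o) ->
  conv mu (f1 + f2) g = conv mu f1 g + conv mu f2 g.
Proof.
move=> c1 c2 cg; apply/funext => x; transitivity (Cintegral mu (fun y => f1 y * g
  (y^-1 * x)%g) +
  Cintegral mu (fun y => f2 y * g (y^-1 * x)%g)) => //.
rewrite -CintegralD; [|exact: Cc_conv_integrand..].
by apply: eq_Cintegral => y; exact: mulrDl.
Qed.

Lemma convZl a f g : Cc f -> continuous (g : G -> R[i]^o) ->
  conv mu (a *: f) g = a *: conv mu f g.
Proof.
move=> c1 cg; apply/funext => x.
transitivity (a * Cintegral mu (fun y => f y * g (y^-1 * x)%g)) => //.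
rewrite -CintegralZ; last exact: Cc_conv_integrand.
by apply: eq_Cintegral => y; exact/esym/mulrA.
Qed.

Lemma convDr f g1 g2 : Cc f -> continuous (g1 : G -> R[i]^o) ->
  continuous (g2 : G -> R[i]^o) ->
  conv mu f (g1 + g2) = conv mu f g1 + conv mu f g2.
Proof.
move=> cf c1 c2; apply/funext => x; transitivity (Cintegral mu (fun y => f y * g1
  (y^-1 * x)%g) +
  Cintegral mu (fun y => f y * g2 (y^-1 * x)%g)) => //.
rewrite -CintegralD; [|exact: Cc_conv_integrand..].
by apply: eq_Cintegral => y; exact: mulrDr.
Qed.

Lemma convZr a f g : Cc f -> continuous (g : G -> R[i]^o) ->
  conv mu f (a *: g) = a *: conv mu f g.
Proof.
move=> c1 cg; apply/funext => x.
transitivity (a * Cintegral mu (fun y => f y * g (y^-1 * x)%g)) => //.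
rewrite -CintegralZ; last exact: Cc_conv_integrand.
by apply: eq_Cintegral => y; exact: mulrCA.
Qed.

Lemma convA f g (F : G -> R[i]) : Cc f -> Cc g -> continuous (F : G -> R[i]^o) ->
  conv mu (conv mu f g) F = conv mu f (conv mu g F).
Proof.
move=> cf cg cF; apply/funext => x; rewrite /conv.
pose Phi z w := f z * g (z^-1 * w)%g * F (w^-1 * x)%g.
have [cf' [K cK fK]] := (CcP hG f).1 cf; have [cg' [L cL gL]] := (CcP hG g).1 cg.
transitivity (Cintegral mu (fun w => Cintegral mu (fun z => Phi z w))).
  apply: eq_Cintegral => w; rewrite -CintegralZr; first by [].
  exact: (Cc_conv_integrand w cf cg').
rewrite (@CFubini Phi K [set (p.1 * p.2)%g | p in K `*` L])//.
- apply: eq_Cintegral => z.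
  (* Left invariance replaces [w] by [z^-1 w] in the inner convolution. *)
  rewrite -(@Cintegral_mull z^-1%g (fun w => g w * F (w^-1 * (z^-1 * x))%g)); last first.
    exact: (Cc_conv_integrand _ cg cF).
  rewrite -CintegralZ; last exact: (Cc_mull hG z^-1%g (Cc_conv_integrand _ cg cF)).
  apply: eq_Cintegral => w; rewrite /Phi -mulrA; congr (_ * (_ * F _)).
  by rewrite invgM invgK -mulgA mulVKg.
- move=> p; apply: (@cvgM R[i]).
    apply: (@continuous_comp _ _ _ (fun p : G * G => (p.2, p.1)) (fun p : G * G => f p.2 * g
      (p.2^-1 * p.1)%g : R[i]^o)).
      by apply: continuous_pair; [exact: snd_continuous|exact: fst_continuous].
    exact: continuous_conv_integrand.
  apply: (@continuous_comp _ _ _ (fun p : G * G => (p.2^-1 * x)%g) (F : G -> R[i]^o));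
    last exact: cF.
  apply: continuous_mulg; last exact: cst_continuous.
  by apply: continuous_invg; exact: snd_continuous.
- exact: compact_mulg.
move=> z w zw; rewrite /Phi; have [Kz|/fK ->] := pselect (K z); last by rewrite !mul0r.
rewrite gL ?mulr0 ?mul0r// => Lzw; apply: zw; split => //; exists (z, z^-1 * w)%g => //=.
by rewrite mulVKg.
Qed.

End HaarIntegral.

(** * Reproducing kernel Hilbert spaces *)

Section Modulus.
Context {R : realType}.
Implicit Types z w : R[i].

Definition cmod z : R := complex.Re `|z|.

Lemma cmodE z : `|z| = (cmod z)%:C.
Proof. exact: normc_Re. Qed.

Lemma cmod_ge0 z : 0 <= cmod z.
Proof. exact: Re_norm_ge0. Qed.

Lemma cmodM z w : cmod (z * w) = cmod z * cmod w.
Proof. by apply: complexI; rewrite real_complexM -!cmodE normrM. Qed.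

Lemma cmodD z w : cmod (z + w) <= cmod z + cmod w.
Proof. by rewrite -lecR rmorphD/= -!cmodE ler_normD. Qed.

Lemma cmodN z : cmod (- z) = cmod z.
Proof. by rewrite /cmod normrN. Qed.

Lemma cmod0 : cmod 0 = 0.
Proof. by rewrite /cmod normr0. Qed.

Lemma cmod1 : cmod 1 = 1.
Proof. by rewrite /cmod normr1. Qed.

Lemma cmod_eq0 z : cmod z = 0 -> z = 0.
Proof. by move=> z0; apply/normr0_eq0; rewrite cmodE z0. Qed.

Lemma mulcJ z : z * conjc z = (cmod z ^+ 2)%:C.
Proof. by rewrite -sqr_normc cmodE rmorphXn. Qed.

Lemma Re_le_cmod z : complex.Re z <= cmod z.
Proof. exact: le_trans (ler_norm _) (Re_le_norm z). Qed.

Lemma ReM_real (r : R) z : complex.Re (r%:C * z) = r * complex.Re z.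
Proof. by case: z => a b /=; rewrite mul0r subr0. Qed.

Lemma cmod_real (r : R) : cmod r%:C = `|r|.
Proof. by rewrite /cmod normc_def /= expr0n addr0 sqrtr_sqr. Qed.

Lemma unimodular_phase z : exists2 u, cmod u = 1 & u * z = (cmod z)%:C.
Proof.
have [->|z0] := eqVneq z 0; first by exists 1; rewrite ?cmod1// mul1r cmod0.
exists (`|z| / z); last by rewrite divfK// cmodE.
by apply: complexI; rewrite -cmodE normrM normfV normr_id divff// normr_eq0.
Qed.

Lemma eq_complexP z w : complex.Re z = complex.Re w -> complex.Im z = complex.Im w -> z = w.
Proof. by case: z w => [a b] [c d] /= -> ->. Qed.

End Modulus.

Section KernelSums.
Context {R : realType} {X : Type}.
Variable K : X -> X -> R[i].
Implicit Types (F : X -> R[i]) (l m : seq (R[i] * X)) (a : R[i]).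

Definition formal_eval F l : R[i] := \sum_(c <- l) c.1 * F c.2.
Definition formal_scale a l := [seq (a * c.1, c.2) | c <- l].
(** A list stands for a formal combination of point evaluations. The conjugate makes
    [formal_eval (kernel_fun m) l] linear in [l] and conjugate-linear in [m]: for a positive
    definite [K] it is the semi-inner product of two such combinations. *)
Definition kernel_fun l : X -> R[i] := fun y => \sum_(c <- l) conjc c.1 * K y c.2.
Definition kernel_seminorm l : R := Num.sqrt (complex.Re (formal_eval (kernel_fun l) l)).

Lemma formal_eval_cat F l m : formal_eval F (l ++ m) = formal_eval F l + formal_eval F m.
Proof. by rewrite /formal_eval big_cat. Qed.

Lemma formal_eval_cons F c l : formal_eval F (c :: l) = c.1 * F c.2 + formal_eval F l.
Proof. by rewrite /formal_eval big_cons. Qed.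

Lemma formal_eval_nil F : formal_eval F [::] = 0.
Proof. by rewrite /formal_eval big_nil. Qed.

Lemma formal_eval_scale F a l : formal_eval F (formal_scale a l) = a * formal_eval F l.
Proof.
by rewrite /formal_eval big_map mulr_sumr; apply: eq_bigr => c _; rewrite mulrA.
Qed.

Lemma formal_eval1 F x : formal_eval F [:: (1, x)] = F x.
Proof. by rewrite /formal_eval big_seq1 mul1r. Qed.

Lemma formal_evalD F G l : formal_eval (F + G) l = formal_eval F l + formal_eval G l.
Proof. by rewrite /formal_eval -big_split; apply: eq_bigr => c _; exact: mulrDr. Qed.

Lemma formal_evalZ a F l : formal_eval (a *: F) l = a * formal_eval F l.
Proof. by rewrite /formal_eval mulr_sumr; apply: eq_bigr => c _; exact: mulrCA. Qed.

Lemma formal_eval0 l : formal_eval 0 l = 0.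
Proof. by rewrite -(scale0r (0 : X -> R[i])) formal_evalZ mul0r. Qed.

Lemma formal_evalN F l : formal_eval (- F) l = - formal_eval F l.
Proof. by rewrite -scaleN1r formal_evalZ mulN1r. Qed.

Lemma kernel_fun_cat l m : kernel_fun (l ++ m) = kernel_fun l + kernel_fun m.
Proof. by apply/funext => y; rewrite /kernel_fun big_cat. Qed.

Lemma kernel_fun_scale a l : kernel_fun (formal_scale a l) = conjc a *: kernel_fun l.
Proof.
apply/funext => y; rewrite /kernel_fun big_map.
transitivity (conjc a * \sum_(c <- l) conjc c.1 * K y c.2) => //.
by rewrite mulr_sumr; apply: eq_bigr => c _; rewrite conjcM mulrA.
Qed.

Lemma kernel_seminorm_ge0 l : 0 <= kernel_seminorm l.
Proof. exact: sqrtr_ge0. Qed.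

Definition kernel_bound F : set R :=
  [set M | 0 <= M /\ forall l, cmod (formal_eval F l) <= M * kernel_seminorm l].

Definition in_rkhs : {pred X -> R[i]} := fun F => `[< kernel_bound F !=set0 >].

(* The reproducing kernel space consists of the functions that are bounded as
   functionals on formal combinations of points, with the dual norm; it is complete
   without forming a quotient or a completion. *)
Definition rkhs_norm F : R := inf (kernel_bound F).

Lemma rkhs_norm_ge0 F : 0 <= rkhs_norm F.
Proof.
have [FK|/set0P/negP/negPn/eqP F0] := pselect (kernel_bound F !=set0).
  by apply: lb_le_inf => // M [].
(* The infimum of the empty set is 0 by convention. *)
by rewrite /rkhs_norm F0 inf0.
Qed.

Lemma rkhs_norm_le F M : kernel_bound F M -> rkhs_norm F <= M.
Proof. by move=> FM; apply: ge_inf => //; exists 0 => ? []. Qed.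

Lemma rkhs_norm_bound F l : F \in in_rkhs ->
  cmod (formal_eval F l) <= rkhs_norm F * kernel_seminorm l.
Proof.
move=> /asboolP[M FM].
(* At seminorm zero the division below is impossible, but there any single bound already forces the
   value 0. *)
have [s0|s0] := eqVneq (kernel_seminorm l) 0.
  by case: FM => _ /(_ l); rewrite s0 !mulr0.
have sp : 0 < kernel_seminorm l by rewrite lt_neqAle eq_sym s0 kernel_seminorm_ge0.
rewrite -ler_pdivrMr//; apply: lb_le_inf; first by exists M.
by move=> M' [_ h]; rewrite ler_pdivrMr.
Qed.

Lemma in_rkhsD F G : F \in in_rkhs -> G \in in_rkhs ->
  kernel_bound (F + G) (rkhs_norm F + rkhs_norm G).
Proof.
move=> FK GK; split; first by rewrite addr_ge0// rkhs_norm_ge0.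
move=> l; rewrite formal_evalD mulrDl (le_trans (cmodD _ _))// lerD//;
  exact: rkhs_norm_bound.
Qed.

Lemma in_rkhsZ a F : F \in in_rkhs -> kernel_bound (a *: F) (cmod a * rkhs_norm F).
Proof.
move=> FK; split; first by rewrite mulr_ge0 ?cmod_ge0 ?rkhs_norm_ge0.
by move=> l; rewrite formal_evalZ cmodM -mulrA ler_wpM2l ?cmod_ge0// rkhs_norm_bound.
Qed.

Lemma in_rkhs_submod : submod_closed in_rkhs.
Proof.
split.
  apply/asboolP; exists 0; split => // l; rewrite formal_eval0 cmod0.
  by rewrite mul0r.
move=> a F G FK GK; apply/asboolP.
exists (rkhs_norm (a *: F) + rkhs_norm G); apply: in_rkhsD => //.
by apply/asboolP; exists (cmod a * rkhs_norm F); exact: in_rkhsZ.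
Qed.

HB.instance Definition _ := GRing.isSubmodClosed.Build R[i] (X -> R[i]) in_rkhs in_rkhs_submod.

Record rkhs := Rkhs { rkhs_fun :> X -> R[i]; rkhsP : rkhs_fun \in in_rkhs }.

HB.instance Definition _ := [isSub for rkhs_fun].
HB.instance Definition _ := [Choice of rkhs by <:].
HB.instance Definition _ := [SubChoice_isSubLmodule of rkhs by <:].

Implicit Types u v : rkhs.

Definition rkhs_cnorm u : R[i] := (rkhs_norm u)%:C.

Let cnormD u v : rkhs_cnorm (u + v) <= rkhs_cnorm u + rkhs_cnorm v.
Proof.
rewrite -rmorphD lecR; apply: rkhs_norm_le.
exact: in_rkhsD (rkhsP u) (rkhsP v).
Qed.

Let norm_le_scale a u : rkhs_norm (a *: u : rkhs) <= cmod a * rkhs_norm u.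
Proof. by apply: rkhs_norm_le; exact: in_rkhsZ (rkhsP u). Qed.

Let cnormZ a u : rkhs_cnorm (a *: u) = `|a| * rkhs_cnorm u.
Proof.
rewrite cmodE -real_complexM /rkhs_cnorm; congr (_%:C); apply/eqP;
  rewrite eq_le norm_le_scale /=.
have [->|a0] := eqVneq a 0; first by rewrite cmod0 mul0r rkhs_norm_ge0.
have ap : 0 < cmod a.
  by rewrite lt_neqAle cmod_ge0 andbT eq_sym; apply: contra a0 => /eqP/cmod_eq0 ->.
rewrite mulrC -ler_pdivlMr// mulrC.
(* The remaining inequality is [norm_le_scale] for the scalar [a^-1] and the vector [a *: u]. *)
have e : a^-1 *: (a *: u) = u by rewrite scalerA mulVf// scale1r.
have := norm_le_scale a^-1 (a *: u); rewrite e.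
by rewrite (_ : cmod a^-1 = (cmod a)^-1)//; apply: complexI;
  rewrite -cmodE normfV cmodE fmorphV.
Qed.

Let cnorm_eq0 u : rkhs_cnorm u = 0 -> u = 0.
Proof.
move=> /complexI u0; apply: val_inj; apply/funext => x.
apply: cmod_eq0; apply/eqP; rewrite eq_le cmod_ge0 andbT.
by rewrite -formal_eval1 (le_trans (rkhs_norm_bound _ (rkhsP u)))// u0 mul0r.
Qed.

HB.instance Definition _ :=
  Lmodule_isNormed.Build R[i] rkhs cnormD cnormZ cnorm_eq0.

Lemma rkhs_normE u : `|u| = (rkhs_norm u)%:C.
Proof. by []. Qed.

Lemma cmod_eval_le u l :
  cmod (formal_eval u l) <= cmod `|u| * kernel_seminorm l.
Proof.
by rewrite rkhs_normE cmod_real ger0_norm ?rkhs_norm_ge0// rkhs_norm_bound// rkhsP.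
Qed.

Lemma eval_cmod_le u (M : R) : 0 <= M ->
  (forall l, cmod (formal_eval u l) <= M * kernel_seminorm l) -> `|u| <= M%:C.
Proof. by move=> M0 uM; rewrite rkhs_normE lecR; apply: rkhs_norm_le. Qed.

End KernelSums.

Section KernelComplete.
Context {R : realType} {X : Type}.
Variable K : X -> X -> R[i].
Local Notation T := (rkhs K).

Lemma complex_cvg (U : Type) (F : set_system U) (FF : Filter F) (f : U -> R[i]) (z : R[i]) :
  (complex.Re (f t) @[t --> F] --> complex.Re z) ->
  (complex.Im (f t) @[t --> F] --> complex.Im z) ->
  ((f t : R[i]^o) @[t --> F] --> (z : R[i]^o)).
Proof.
move=> fr fi.
have -> : (f : U -> R[i]^o) = (fun x => (complex.Re (f x))%:C + 'i%C * (complex.Im (f x))%:C).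
  by apply/funext => x; rewrite -complexE.
rewrite [X in _ --> X]complexE; apply: (@cvgD _ (R[i]^o)).
  exact: (cvg_comp _ _ fr (@real_complex_continuous R _)).
apply: (@cvgM R[i]); first exact: cvg_cst.
exact: (cvg_comp _ _ fi (@real_complex_continuous R _)).
Qed.

(** Evaluation at [x] is bounded by the seminorm of the point mass at [x], so it preserves Cauchy
    filters. The map [h] is meant to be the real or the imaginary part, since limits are taken in
    [R]. *)
Lemma rkhs_eval_cauchy (F : set_system T) (h : R[i] -> R) (x : X) :
  ProperFilter F -> cauchy F ->
  (forall z w, `|h z - h w| <= cmod (z - w)) ->
  cvg ((fun f : T => h (f x)) @ F).
Proof.
move=> FF /cauchy_ballP cF hlip; apply/cauchy_cvgP/cauchy_ballP => e e0.
rewrite near_map2.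
pose s := kernel_seminorm K [:: (1, x)] + 1.
have s0 : 0 < s by rewrite ltr_wpDl ?kernel_seminorm_ge0.
have es0 : 0 < (e / s)%:C by rewrite ltcR divr_gt0.
have [[A B] /= [FA FB] AB] := cF _ es0.
exists (A, B) => //= -[f g] [/= Af Bg].
have := AB (f, g) (conj Af Bg); rewrite -!ball_normE /= => fg.
rewrite (le_lt_trans (hlip _ _))//.
have -> : f x - g x = formal_eval (f - g) [:: (1, x)] by rewrite formal_eval1.
apply: (le_lt_trans (cmod_eval_le _ _)).
have fg' : cmod `|f - g| < e / s by rewrite -ltcR -cmodE normr_id.
apply: (@le_lt_trans _ _ (cmod `|f - g| * s)).
  by rewrite ler_wpM2l ?cmod_ge0// /s lerDl.
by rewrite -ltr_pdivlMr.
Qed.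

(** The limit is the pointwise limit [phi]. The Cauchy estimate survives in the limit uniformly over
    [l]; it shows that [f - phi] lies in the space for some [f], hence that [phi] does, and then
    that [F] converges to [phi] in norm. *)
Lemma rkhs_complete (F : set_system T) : ProperFilter F -> cauchy F -> cvg F.
Proof.
move=> FF cF; have /cauchy_ballP cF' := cF.
have cr x : cvg ((fun f : T => complex.Re (f x)) @ F).
  by apply: rkhs_eval_cauchy => // z w; rewrite -raddfB; exact: Re_le_norm.
have ci x : cvg ((fun f : T => complex.Im (f x)) @ F).
  by apply: rkhs_eval_cauchy => // z w; rewrite -raddfB; exact: Im_le_norm.
pose phi x : R[i] := (lim ((fun f : T => complex.Re (f x)) @ F)) +i* (lim ((fun f : T
  => complex.Im (f x)) @ F)).
have phi_x x : ((fun f : T => f x : R[i]^o) @ F --> (phi x : R[i]^o)).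
  by apply: complex_cvg; [exact: cr|exact: ci].
have phi_l l : ((fun f : T => formal_eval f l : R[i]^o) @ F --> (formal_eval phi l : R[i]^o)).
  elim: l => [|[a x] l IH].
    rewrite formal_eval_nil (_ : (fun _ => _) = fun=> 0); first exact: cvg_cst.
    by apply/funext => f; rewrite formal_eval_nil.
  rewrite formal_eval_cons (_ : (fun _ => _) = (fun f : T => a * f x + formal_eval f l)).
    apply: (@cvgD _ (R[i]^o)); last exact: IH.
    by apply: (@cvgM R[i]); [exact: cvg_cst|exact: phi_x].
  by apply/funext => f; rewrite formal_eval_cons.
have near_phi (e : R) : 0 < e -> F (fun f : T => forall l,
    cmod (formal_eval f l - formal_eval phi l) <= e * kernel_seminorm K l).
  move=> e0; have /cF' : 0 < e%:C by rewrite ltcR.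
  move=> [[A B] /= [FA FB] AB]; apply: filterS FA => f Af l.
  (* In the Cauchy estimate for [f] and [g], the function [g] is sent to the limit; the inequality
     is a closed condition. *)
  have cv : ((fun g : T => cmod (formal_eval f l - formal_eval g l)) @ F -->
      cmod (formal_eval f l - formal_eval phi l)).
    apply: (@cvg_comp _ _ _ (fun g : T => `|formal_eval f l - formal_eval g l| : R[i]^o)
      (@complex.Re R)); last exact: Re_continuous.
    apply: (@cvg_norm _ R[i]^o); apply: (@cvgB _ R[i]^o) => //; exact: cvg_cst.
  apply: (@closed_cvg _ _ F _ _ _ (@closed_le _ _) _ _ cv).
  apply: filterS FB => g Bg; have := AB (f, g) (conj Af Bg).
  rewrite /= -ball_normE /= => fg; rewrite -formal_evalN -formal_evalD.
  apply: (le_trans (cmod_eval_le (f - g) l)).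
  by rewrite ler_wpM2r ?kernel_seminorm_ge0// -lecR -cmodE normr_id ltW.
have phiK : phi \in in_rkhs K.
  have [f fphi] := filter_ex (near_phi 1 ltr01).
  have dK : (f : X -> R[i]) - phi \in in_rkhs K.
    apply/asboolP; exists 1; split => // l; rewrite formal_evalD formal_evalN; exact: fphi.
  have -> : phi = (f : X -> R[i]) - ((f : X -> R[i]) - phi).
    by rewrite opprB addrC subrK.
  by rewrite rpredB// rkhsP.
apply/cvg_ex; exists (Rkhs phiK); apply/cvgrPdist_le => e.
rewrite ltcE => /andP[/eqP e1 e0].
have -> : e = (complex.Re e)%:C by case: e e1 {e0} => a b /= ->.
apply: filterS (near_phi _ e0) => f fphi; rewrite distrC.
apply: eval_cmod_le; first exact: ltW.
by move=> l; rewrite formal_evalD formal_evalN; exact: fphi.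
Qed.

HB.instance Definition _ := Uniform_isComplete.Build (rkhs K) rkhs_complete.

End KernelComplete.

Lemma norm_cmod (R : realType) (V : normedModType R[i]) (x : V) : `|x| = (cmod `|x|)%:C.
Proof. by rewrite -cmodE normr_id. Qed.

Lemma cmod_norm (R : realType) (V : normedModType R[i]) (x : V) :
  cmod `|x| = complex.Re `|x|.
Proof. by rewrite /cmod normr_id. Qed.

Lemma cmod_normZ (R : realType) (V : normedModType R[i]) (a : R[i]) (x : V) :
  cmod `|a *: x| = cmod a * cmod `|x|.
Proof. by rewrite normrZ cmodM /cmod normr_id. Qed.

Lemma continuous_cmod_norm (R : realType) (T : topologicalType) (V : normedModType R[i])
  (f : T -> V) : continuous f -> continuous (fun t => cmod `|f t|).
Proof.
move=> cf; rewrite (_ : (fun _ => _) = (fun t => complex.Re `|f t|)); last first.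
  by apply/funext => t; rewrite /cmod normr_id.
move=> t; apply: (@continuous_comp T R[i]^o R (fun t => `|f t| : R[i]^o) (@complex.Re R)).
  exact: (@cvg_norm _ _ _ _ _ _ _ (cf t)).
exact: Re_continuous.
Qed.

Lemma bounded_linearW (R : realType) (V W : normedModType R[i]) (f : {linear V -> W}) (M : R) :
  (forall v, `|f v| <= M%:C * `|v|) -> continuous f.
Proof.
move=> fM; apply: bounded_linear_continuous; apply/linear_boundedP.
near=> r => v; apply: (le_trans (fM v)); apply: ler_wpM2r => //.
by near: r; apply: nbhs_pinfty_ge; apply/complex_realP; exists M.
Unshelve. all: by end_near. Qed.

Section RealContinuity.
Context {R : realType} {T : topologicalType}.
Implicit Types f g : T -> R.

Lemma continuous_realM f g : continuous f -> continuous g -> continuous (fun t => f t * g t).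
Proof. by move=> cf cg t; apply: cvgM; [exact: cf|exact: cg]. Qed.

Lemma continuous_realD f g : continuous f -> continuous g -> continuous (fun t => f t + g t).
Proof. by move=> cf cg t; apply: cvgD; [exact: cf|exact: cg]. Qed.

Lemma continuous_realB f g : continuous f -> continuous g -> continuous (fun t => f t - g t).
Proof. by move=> cf cg t; apply: cvgB; [exact: cf|exact: cg]. Qed.

Lemma continuous_realZ (a : R) f : continuous f -> continuous (fun t => a * f t).
Proof. by apply: continuous_realM; exact: cst_continuous. Qed.

Lemma continuous_addl (V : normedModType R[i]) (u : V) (f : T -> V) :
  continuous f -> continuous (fun t => u + f t).
Proof. by move=> cf t; apply: cvgD; [exact: cvg_cst|exact: cf]. Qed.

Lemma continuous_scale (V : normedModType R[i]) (a : R[i]) (f : T -> V) :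
  continuous f -> continuous (fun t => a *: f t).
Proof. by move=> cf t; apply: cvgZr; exact: cf. Qed.

End RealContinuity.

(** * The inner product of the reproducing kernel space *)

Section MooreAronszajn.
Context {R : realType} {X : Type}.
Variable K : X -> X -> R[i].
Hypothesis K_herm : forall x y, conjc (K x y) = K y x.
Hypothesis K_pos : forall l, 0 <= formal_eval (kernel_fun K l) l.
Implicit Types (l m : seq (R[i] * X)) (u v w : rkhs K).

Local Notation s := (kernel_seminorm K).
Local Notation E := (fun l m => formal_eval (kernel_fun K m) l).

Lemma kernel_seminorm_sqr l : E l l = (s l ^+ 2)%:C.
Proof.
have := K_pos l; rewrite lecE => /andP[/eqP El0 Er0].
by rewrite /kernel_seminorm sqr_sqrtr//; apply: eq_complexP.
Qed.

Lemma kernel_pairingC l m : conjc (E l m) = E m l.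
Proof.
rewrite /formal_eval raddf_sum /=.
under eq_bigr do rewrite /kernel_fun mulr_sumr raddf_sum /=.
rewrite exchange_big /=; apply: eq_bigr => c _.
rewrite /kernel_fun mulr_sumr; apply: eq_bigr => d _.
by rewrite !conjcM conjcK K_herm mulrCA.
Qed.

Lemma Re_conjc (z : R[i]) : complex.Re (conjc z) = complex.Re z.
Proof. by case: z. Qed.

Lemma kernel_seminorm_cat l m :
  s (l ++ m) ^+ 2 = s l ^+ 2 + s m ^+ 2 + 2%:R * complex.Re (E l m).
Proof.
apply: complexI; rewrite -kernel_seminorm_sqr kernel_fun_cat formal_evalD !formal_eval_cat.
rewrite !kernel_seminorm_sqr -(kernel_pairingC l m).
apply: eq_complexP; rewrite !raddfD /= ?Re_conjc; first by ring.
by case: (E l m) => a b /=; ring.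
Qed.

Lemma kernel_seminorm_scale a l : s (formal_scale a l) = cmod a * s l.
Proof.
apply/eqP; rewrite -(@eqrXn2 _ 2%N)//; last 2 first.
- exact: kernel_seminorm_ge0.
- by rewrite mulr_ge0 ?cmod_ge0 ?kernel_seminorm_ge0.
apply/eqP/complexI; rewrite -kernel_seminorm_sqr kernel_fun_scale formal_eval_scale.
rewrite formal_evalZ kernel_seminorm_sqr mulrA mulcJ -real_complexM; congr (_%:C).
by rewrite exprMn.
Qed.

Lemma eval_quadratic_le u l :
  2%:R * complex.Re (formal_eval u l) - s l ^+ 2 <= cmod `|u| ^+ 2.
Proof.
have h := le_trans (Re_le_cmod _) (cmod_eval_le u l).
have := sqr_ge0 (cmod `|u| - s l); rewrite sqrrB => h2.
by nra.
Qed.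

(* The square of the dual norm of [F] is the supremum of [2 Re F(l) - s(l)^2].  In
   this form, adding a kernel function to [F] amounts to translating [l]. *)
Lemma le_eval_quadratic (F : X -> R[i]) (B : R) :
  (forall l, 2%:R * complex.Re (formal_eval F l) - s l ^+ 2 <= B) ->
  0 <= B /\ forall l, cmod (formal_eval F l) <= Num.sqrt B * s l.
Proof.
move=> FB.
(* Scaling [l] by [t z], where [z] has modulus 1 and turns [F(l)] into its modulus, gives a
   quadratic inequality in the real variable [t]. *)
have key l (t : R) : 2%:R * t * cmod (formal_eval F l) - t ^+ 2 * s l ^+ 2 <= B.
  have [z z1 zF] := unimodular_phase (formal_eval F l).
  have := FB (formal_scale (t%:C * z) l).
  rewrite formal_eval_scale -mulrA zF ReM_real kernel_seminorm_scale cmodM z1 mulr1.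
  by rewrite cmod_real exprMn real_normK ?num_real// mulrA.
have B0 : 0 <= B by have := key [::] 0; rewrite mulr0 !mul0r expr0n mul0r subr0.
split => // l; have r0 := cmod_ge0 (formal_eval F l); have s0 := kernel_seminorm_ge0 K l.
have {}key := key l; set r := cmod _ in key r0 *.
have [sl0|sl0] := eqVneq (s l) 0.
  (* Without its quadratic term the inequality is linear in [t], and it fails at
     [t = (B + 1) / r]. *)
  rewrite sl0 mulr0 leNgt; apply/negP => rp.
  have := key ((B + 1) / r); rewrite sl0 expr0n mulr0 subr0 -mulrA divfK ?gt_eqF//.
  by lra.
have sp : 0 < s l by rewrite lt_neqAle eq_sym sl0.
rewrite -(@ler_pXn2r _ 2%N)// ?nnegrE//; last by rewrite mulr_ge0 ?sqrtr_ge0.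
rewrite exprMn sqr_sqrtr//.
(* This value of [t] maximizes [2 t r - t^2 s(l)^2]. *)
have := key (r / s l ^+ 2).
rewrite (_ : _ - _ = r ^+ 2 / s l ^+ 2); last by field.
by rewrite ler_pdivrMr// exprn_gt0.
Qed.

Lemma rkhs_sqrnorm_le u (B : R) :
  (forall l, 2%:R * complex.Re (formal_eval u l) - s l ^+ 2 <= B) -> cmod `|u| ^+ 2 <= B.
Proof.
move=> /le_eval_quadratic[B0 uB].
rewrite -(sqr_sqrtr B0) ler_pXn2r ?nnegrE ?cmod_ge0 ?sqrtr_ge0//.
by rewrite -lecR -cmodE normr_id; apply: eval_cmod_le => //; exact: sqrtr_ge0.
Qed.

(** Cauchy-Schwarz in quadratic form: expanding [s(m - l)^2 >= 0] gives the hypothesis of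
    [le_eval_quadratic] with [B = s(l)^2]. *)
Lemma kernel_fun_in l : kernel_fun K l \in in_rkhs K.
Proof.
apply/asboolP; exists (Num.sqrt (s l ^+ 2)); split; first exact: sqrtr_ge0.
apply: (le_eval_quadratic _).2 => m.
have := kernel_seminorm_cat m (formal_scale (-1) l).
rewrite kernel_seminorm_scale cmodN cmod1 mul1r kernel_fun_scale formal_evalZ.
rewrite rmorphN1 mulN1r raddfN /= => e.
by have := sqr_ge0 (s (m ++ formal_scale (-1) l)); rewrite e; lra.
Qed.

Definition kernel_vec l : rkhs K := Rkhs (kernel_fun_in l).

(** Completing the square, the quadratic expression of [u + kernel_vec l] at [m] equals that of [u]
    at [m - l] plus [2 Re u(l) + s(l)^2]. *)
Lemma rkhs_sqrnorm_shift_le u l :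
  cmod `|u + kernel_vec l| ^+ 2 <= cmod `|u| ^+ 2 + 2%:R * complex.Re
    (formal_eval u l) + s l ^+ 2.
Proof.
apply: rkhs_sqrnorm_le => m; rewrite formal_evalD raddfD /=.
have := eval_quadratic_le u (m ++ formal_scale (-1) l).
rewrite kernel_seminorm_cat formal_eval_cat formal_eval_scale mulN1r raddfB /=.
rewrite kernel_fun_scale formal_evalZ rmorphN1 mulN1r raddfN /=.
rewrite kernel_seminorm_scale cmodN cmod1 mul1r.
by lra.
Qed.

Lemma kernel_vec_scale a l : kernel_vec (formal_scale a l) = conjc a *: kernel_vec l.
Proof. by apply: val_inj; rewrite /= kernel_fun_scale. Qed.

Lemma rkhs_sqrnorm_shift u l :
  cmod `|u + kernel_vec l| ^+ 2 = cmod `|u| ^+ 2 + 2%:R * complex.Re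
    (formal_eval u l) + s l ^+ 2.
Proof.
apply/eqP; rewrite eq_le rkhs_sqrnorm_shift_le /=.
(* The reverse inequality comes from shifting [u + kernel_vec l] back by [-l]. *)
have := rkhs_sqrnorm_shift_le (u + kernel_vec l) (formal_scale (-1) l).
rewrite kernel_vec_scale rmorphN1 scaleN1r addrK formal_eval_scale formal_evalD mulN1r.
rewrite kernel_seminorm_scale cmodN cmod1 mul1r kernel_seminorm_sqr raddfN raddfD /=.
by lra.
Qed.

(** By the shift formula the squared distance is [|u|^2 - (2 Re u(l) - s(l)^2)]. If it always
    exceeded [e], the supremum formula for the norm would give [|u|^2 <= |u|^2 - e]. *)
Lemma kernel_vec_dense u (e : R) : 0 < e -> exists l, cmod `|u - kernel_vec l| ^+ 2 <= e.
Proof.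
move=> e0; apply: contrapT => /forallNP h.
have : cmod `|u| ^+ 2 <= cmod `|u| ^+ 2 - e.
  apply: rkhs_sqrnorm_le => l; have /negP := h l; rewrite -ltNge => he.
  have := rkhs_sqrnorm_shift u (formal_scale (-1) l).
  rewrite kernel_vec_scale rmorphN1 scaleN1r formal_eval_scale mulN1r.
  rewrite kernel_seminorm_scale cmodN cmod1 mul1r raddfN /=.
  by lra.
by move=> ?; lra.
Qed.

Lemma rkhs_continuous_eq (f g : rkhs K -> R) : continuous f -> continuous g ->
  (forall l, f (kernel_vec l) = g (kernel_vec l)) -> f =1 g.
Proof.
move=> cf cg fg u; apply/eqP; rewrite -subr_eq0; apply/negPn/negP => h0.
have cfg : continuous (fun u => f u - g u) by exact: continuous_realB.
have e0 : 0 < `|f u - g u| by rewrite normr_gt0.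
have /cvgrPdist_lt/(_ _ e0) := cfg u.
move=> /nbhs_ballP[e /= ep]; rewrite -ball_normE /= => ue.
have ec : e = (complex.Re e)%:C.
  by move: ep; rewrite ltcE; case: e {ue} => a b /= /andP[/eqP ->].
have er : 0 < complex.Re e by rewrite -ltcR -ec.
have [l ul] := @kernel_vec_dense u
  ((complex.Re e / 2%:R) ^+ 2) ltac:(by rewrite exprn_gt0// divr_gt0).
have /ue /= : `|u - kernel_vec l| < e.
  have ul' : cmod `|u - kernel_vec l| <= complex.Re e / 2%:R.
    by rewrite -(@ler_pXn2r _ 2%N)// nnegrE ?cmod_ge0// divr_ge0// ltW.
  rewrite ec norm_cmod ltcR (le_lt_trans ul')//.
  by rewrite ltr_pdivrMr// mulr_natr mulr2n ltrDl.
by rewrite fg subrr subr0 ltxx.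
Qed.

(* Polarization; bilinearity is checked on the kernel functions, which are dense. *)
Definition rkhs_redot u v : R := (cmod `|u + v| ^+ 2 - cmod `|u| ^+ 2 - cmod `|v| ^+ 2) / 2%:R.

(** With linearity in the first argument, the product of [u] and [i v] is [-i] times that of [u] and
    [v], and its real part is the imaginary part wanted. *)
Definition rkhs_dot u v : R[i] := rkhs_redot u v +i* rkhs_redot u ('i%C *: v).

Lemma rkhs_redot_continuous u (f : rkhs K -> rkhs K) : continuous f ->
  continuous (fun v => rkhs_redot u (f v)).
Proof.
move=> cf.
have c3 := continuous_cmod_norm (continuous_addl (u := u) cf).
have c4 := continuous_cmod_norm cf.
apply: continuous_realM; last exact: cst_continuous.
apply: continuous_realB; last exact: continuous_realM.
apply: continuous_realB; last exact: cst_continuous.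
exact: continuous_realM.
Qed.

Lemma kernel_vec_norm l : cmod `|kernel_vec l| ^+ 2 = s l ^+ 2.
Proof.
have := rkhs_sqrnorm_shift 0 l.
by rewrite add0r normr0 cmod0 formal_eval0 /= expr0n mulr0 !add0r.
Qed.

Lemma rkhs_redot_kernel u l : rkhs_redot u (kernel_vec l) = complex.Re (formal_eval u l).
Proof. by rewrite /rkhs_redot rkhs_sqrnorm_shift kernel_vec_norm; field. Qed.

Lemma rkhs_dot_kernel u l : rkhs_dot u (kernel_vec l) = formal_eval u l.
Proof.
apply: eq_complexP => /=; first exact: rkhs_redot_kernel.
(* [kernel_vec] is conjugate-linear, so the factor [i] becomes [-i] on the list. *)
rewrite (_ : 'i%C *: kernel_vec l = kernel_vec (formal_scale (- 'i%C) l)).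
  rewrite rkhs_redot_kernel formal_eval_scale.
  by case: (formal_eval u l) => a b /=; ring.
rewrite kernel_vec_scale; congr (_ *: _).
by apply: eq_complexP => /=; ring.
Qed.

Lemma rkhs_dotDZl (a : R[i]) u v w :
  rkhs_dot (a *: u + v) w = a * rkhs_dot u w + rkhs_dot v w.
Proof.
have cD (f : rkhs K -> rkhs K) : continuous f -> forall x,
    continuous (fun v => complex.Re (rkhs_dot x (f v))) /\
    continuous (fun v => complex.Im (rkhs_dot x (f v))).
  move=> cf x; split => /=; apply: rkhs_redot_continuous; first exact: cf.
  exact: continuous_scale.
have cid : continuous (id : rkhs K -> rkhs K) by move=> ?; exact: cvg_id.
have [cl1 cl2] := cD id cid (a *: u + v).
have [cu1 cu2] := cD id cid u.
have [cv1 cv2] := cD id cid v.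
have ReE (z1 z2 : R[i]) : complex.Re (a * z1 + z2) =
    complex.Re a * complex.Re z1 - complex.Im a * complex.Im z1 + complex.Re z2.
  by case: a z1 z2 {cl1 cl2} => [? ?] [? ?] [? ?].
have ImE (z1 z2 : R[i]) : complex.Im (a * z1 + z2) =
    complex.Re a * complex.Im z1 + complex.Im a * complex.Re z1 + complex.Im z2.
  by case: a z1 z2 {cl1 cl2 ReE} => [? ?] [? ?] [? ?].
apply: eq_complexP.
  rewrite ReE; move: w; apply: rkhs_continuous_eq; first exact: cl1.
    apply: continuous_realD; last exact: cv1.
    by apply: continuous_realB; exact: continuous_realZ.
  by move=> l; rewrite !rkhs_dot_kernel formal_evalD formal_evalZ ReE.
rewrite ImE; move: w; apply: rkhs_continuous_eq; first exact: cl2.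
  apply: continuous_realD; last exact: cv2.
  by apply: continuous_realD; exact: continuous_realZ.
by move=> l; rewrite !rkhs_dot_kernel formal_evalD formal_evalZ ImE.
Qed.

Lemma rkhs_redotC u v : rkhs_redot u v = rkhs_redot v u.
Proof. by rewrite /rkhs_redot (addrC u v) addrAC. Qed.

Lemma cmod_i : cmod ('i%C : R[i]) = 1.
Proof. by rewrite /cmod normc_def /= expr0n expr1n add0r sqrtr1. Qed.

Lemma rkhs_dotC u v : rkhs_dot u v = conjc (rkhs_dot v u).
Proof.
apply: eq_complexP => /=; first exact: rkhs_redotC.
(* Here [- u + i v = i (v + i u)], and factors of modulus 1 preserve the norm. *)
have -> : rkhs_redot v ('i%C *: u) = rkhs_redot ((-1) *: u) ('i%C *: v).
  have e1 (x : rkhs K) : cmod `|'i%C *: x| = cmod `|x| by rewrite cmod_normZ cmod_i mul1r.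
  have e2 : cmod `|(-1) *: u| = cmod `|u| by rewrite cmod_normZ cmodN cmod1 mul1r.
  have e3 : (-1) *: u + 'i%C *: v = 'i%C *: (v + 'i%C *: u).
    by rewrite scalerDr scalerA addrC -expr2 sqr_i.
  by rewrite /rkhs_redot e3 (e1 (v + 'i%C *: u)) (e1 u) (e1 v) e2 addrAC.
have := rkhs_dotDZl (-1) u 0 v; rewrite addr0.
have -> : rkhs_dot 0 v = 0.
  have := rkhs_dotDZl 1 0 0 v; rewrite scale1r addr0 mul1r.
  by move=> /eqP; rewrite -subr_eq subrr => /eqP.
rewrite addr0 mulN1r => /(congr1 (@complex.Im R)) /= ->.
by rewrite opprK.
Qed.

Lemma rkhs_dot_norm u : rkhs_dot u u = `|u| ^+ 2.
Proof.
rewrite norm_cmod -rmorphXn /=; apply: eq_complexP => /=.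
  rewrite /rkhs_redot (_ : u + u = (2%:R : R)%:C *: u).
    by rewrite cmod_normZ cmod_real ger0_norm//; field.
  by rewrite rmorph_nat scaler_nat mulr2n.
(* [1 + i] has squared modulus 2, so the three squared norms cancel and the imaginary part is 0. *)
rewrite /rkhs_redot (_ : u + 'i%C *: u = (1 +i* 1) *: u).
  have -> : cmod `|'i%C *: u| = cmod `|u| by rewrite cmod_normZ cmod_i mul1r.
  rewrite (cmod_normZ (1 +i* 1) u) exprMn.
  have -> : cmod (1 +i* 1 : R[i]) ^+ 2 = 2%:R.
    by rewrite /cmod normc_def /= sqr_sqrtr ?addr_ge0 ?sqr_ge0// expr1n.
  by field.
rewrite -{1}(scale1r u) -scalerDl; congr (_ *: _).
by apply: eq_complexP => /=; ring.
Qed.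

(** Density of the kernel functions is used twice: for [u] while [w] is a kernel function, and then
    for [w]. *)
Lemma rkhs_adjoint (A B : {linear rkhs K -> rkhs K}) : continuous A -> continuous B ->
  (forall l m, rkhs_dot (A (kernel_vec m)) (kernel_vec l) =
               rkhs_dot (kernel_vec m) (B (kernel_vec l))) ->
  forall u w, rkhs_dot (A u) w = rkhs_dot u (B w).
Proof.
move=> cA cB AB.
have cid : continuous (id : rkhs K -> rkhs K) by move=> ?; exact: cvg_id.
have ABl u l : rkhs_redot (A u) (kernel_vec l) = rkhs_redot u (B (kernel_vec l)).
  rewrite rkhs_redotC [RHS]rkhs_redotC.
  apply: (rkhs_continuous_eq (f := fun u => rkhs_redot (kernel_vec l) (A u))
    (g := fun u => rkhs_redot (B (kernel_vec l)) u)).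
  - exact: (rkhs_redot_continuous (f := A) cA).
  - exact: (rkhs_redot_continuous (f := id) cid).
  by move=> m; rewrite rkhs_redotC [RHS]rkhs_redotC; have /(congr1 (@complex.Re R)) := AB l m.
have ABr u w : rkhs_redot (A u) w = rkhs_redot u (B w).
  apply: (rkhs_continuous_eq (f := fun w => rkhs_redot (A u) w)
    (g := fun w => rkhs_redot u (B w))).
  - exact: (rkhs_redot_continuous (f := id) cid).
  - exact: (rkhs_redot_continuous (f := B) cB).
  exact: ABl.
by move=> u w; apply: eq_complexP => /=; rewrite -?linearZ ABr.
Qed.

Definition rkhs_hilbert : hilbertSpace R :=
  @HilbertSpace R (rkhs K) rkhs_dot rkhs_dotDZl rkhs_dotC rkhs_dot_norm.

End MooreAronszajn.

(** * Extension of contractive representations *)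

Lemma cmod_norm_gt0 (R : realType) (V : normedModType R[i]) (x : V) : x != 0 -> 0 < cmod `|x|.
Proof.
move=> x0; rewrite lt_neqAle cmod_ge0 andbT eq_sym; apply: contra x0 => /eqP e.
by rewrite -normr_eq0 norm_cmod e.
Qed.

Section HilbertSpace.
Context {R : realType} {V : hilbertSpace R}.
Implicit Types (u v w : V) (a : R[i]).

Lemma dotpDl u v w : dotp (u + v) w = dotp u w + dotp v w.
Proof. by rewrite -{1}(scale1r u) dotpDZl mul1r. Qed.

Lemma dotp0l w : dotp 0 w = 0.
Proof. by apply: (addrI (dotp 0 w)); rewrite -dotpDl !addr0. Qed.

Lemma dotpZl a u w : dotp (a *: u) w = a * dotp u w.
Proof. by rewrite -[a *: u]addr0 dotpDZl dotp0l addr0. Qed.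

Lemma dotpZr a u w : dotp w (a *: u) = conjc a * dotp w u.
Proof. by rewrite dotpC dotpZl conjcM -dotpC. Qed.

Lemma dotpBl u v w : dotp (u - v) w = dotp u w - dotp v w.
Proof. by rewrite dotpDl -scaleN1r dotpZl mulN1r. Qed.

Lemma dotpBr u v w : dotp w (u - v) = dotp w u - dotp w v.
Proof. by rewrite dotpC dotpBl raddfB /= -!dotpC. Qed.

Lemma dotp_ge0 u : 0 <= dotp u u.
Proof. by rewrite dotp_norm exprn_ge0. Qed.

Lemma dotp_cmod u : dotp u u = (cmod `|u| ^+ 2)%:C.
Proof. by rewrite dotp_norm [in LHS]norm_cmod rmorphXn. Qed.

Lemma dotp_le u v : cmod (dotp u v) <= cmod `|u| * cmod `|v|.
Proof.
have [->|v0] := eqVneq v 0.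
  by rewrite dotpC dotp0l conjc0 cmod0 mulr_ge0 ?cmod_ge0.
have n0 := cmod_norm_gt0 v0.
(* [a *: v] is the orthogonal projection of [u] onto the line through [v]. *)
pose a := dotp u v / (cmod `|v| ^+ 2)%:C.
have := dotp_ge0 (u - a *: v).
rewrite dotpBl !dotpBr dotpZl !dotpZr dotpZl !dotp_cmod (dotpC v u).
have e1 : conjc a * dotp u v = (cmod (dotp u v) ^+ 2 / cmod `|v| ^+ 2)%:C.
  rewrite /a conjcM conjc_inv conjc_real mulrAC [conjc _ * _]mulrC mulcJ.
  by rewrite -fmorphV -real_complexM.
have e2 : a * conjc (dotp u v) = (cmod (dotp u v) ^+ 2 / cmod `|v| ^+ 2)%:C.
  by rewrite /a mulrAC mulcJ -fmorphV -real_complexM.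
have e3 : conjc a * (a * (cmod `|v| ^+ 2)%:C) = (cmod (dotp u v) ^+ 2 / cmod `|v| ^+ 2)%:C.
  by rewrite {2}/a divfK ?e1// (fmorph_eq0 (real_complex R)) expf_eq0 gt_eqF.
rewrite e1 e2 e3 subrr subr0 -rmorphB ler0c subr_ge0.
rewrite ler_pdivrMr ?exprn_gt0// -exprMn ler_pXn2r ?nnegrE ?mulr_ge0 ?cmod_ge0//.
Qed.

End HilbertSpace.

Section OperatorNorm.
Context {R : realType} {V : normedModType R[i]}.

Lemma opnorm_ubound (T : {linear V -> V}) : bounded_operator T ->
  has_ubound [set complex.Re `|T v| | v in [set v : V | `|v| <= 1]].
Proof.
move=> [M TM]; exists `|M| => _ [w /= w1 <-].
rewrite -lecR -cmod_norm -norm_cmod (le_trans (TM w))//.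
rewrite -[leRHS]mulr1 (@le_trans _ _ (`|M|%:C * `|w|))//.
  by rewrite ler_wpM2r// lecR ler_norm.
by rewrite ler_wpM2l// ler0c.
Qed.

Lemma opnorm_ge0 (T : {linear V -> V}) : bounded_operator T -> 0 <= opnorm T.
Proof.
move=> /opnorm_ubound/ub_le_sup; apply; exists 0; rewrite /= ?normr0//.
by rewrite linear0 normr0.
Qed.

Lemma opnorm_le (T : {linear V -> V}) (v : V) : bounded_operator T ->
  cmod `|T v| <= opnorm T * cmod `|v|.
Proof.
move=> bT; rewrite !cmod_norm.
have [->|v0] := eqVneq v 0; first by rewrite linear0 normr0 mulr0.
have n0 := cmod_norm_gt0 v0; rewrite cmod_norm in n0.
pose w : V := ((complex.Re `|v|)^-1)%:C *: v.
have w1 : `|w| <= 1.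
  rewrite norm_cmod /w cmod_normZ cmod_real ger0_norm ?invr_ge0 ?(ltW n0)//.
  by rewrite cmod_norm mulVf ?gt_eqF.
have := ub_le_sup (opnorm_ubound bT); move=> /(_ (complex.Re `|T w|)).
rewrite -/(opnorm T) => /(_ (ex_intro2 _ _ w w1 erefl)).
have -> : complex.Re `|T w| = (complex.Re `|v|)^-1 * complex.Re `|T v|.
  rewrite /w linearZ -!cmod_norm /= cmod_normZ cmod_real ger0_norm// invr_ge0.
  exact: cmod_ge0.
by rewrite mulrC ler_pdivrMr.
Qed.

End OperatorNorm.

Section NormValues.
Context {R : realType} {V : normedModType R[i]}.
Implicit Types x y z : V.

Lemma cmod_normD x y : cmod `|x + y| <= cmod `|x| + cmod `|y|.
Proof. by rewrite -lecR rmorphD /= -!norm_cmod ler_normD. Qed.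

Lemma cmod_normN x : cmod `|- x| = cmod `|x|.
Proof. by rewrite normrN. Qed.

Lemma cmod_dist_sym x y : cmod `|x - y| = cmod `|y - x|.
Proof. by rewrite distrC. Qed.

Lemma cmod_dist_triangle y x z : cmod `|x - z| <= cmod `|x - y| + cmod `|y - z|.
Proof. by rewrite -[x - z](subrKA y) cmod_normD. Qed.

Lemma cmod_norm_eq0 x : cmod `|x| = 0 -> x = 0.
Proof. by move=> x0; apply/normr0_eq0; rewrite norm_cmod x0. Qed.

End NormValues.

(** The restriction [e <= 1] is there for estimates of products, where an approximant must itself be
    bounded; see [cmod_cmulB]. *)
Lemma small_eq0 (R : realType) (r M : R) : 0 <= r ->
  (forall e, 0 < e -> e <= 1 -> r <= e * M) -> r = 0.
Proof.
move=> r0 rM; apply/eqP; rewrite eq_le r0 andbT; apply/ler_addgt0Pl => e e0; rewrite addr0.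
have M0 : 0 <= M by have := rM 1 ltr01 (lexx _); rewrite mul1r; exact: le_trans.
have p0 : 0 < M + e + 1 by lra.
have d0 : 0 < e / (M + e + 1) by rewrite divr_gt0.
have d1 : e / (M + e + 1) <= 1 by rewrite ler_pdivrMr// mul1r; lra.
apply: (le_trans (rM _ d0 d1)); rewrite mulrAC ler_pdivrMr//.
by rewrite ler_pM2l//; lra.
Qed.

Lemma small_norm_eq (R : realType) (V : normedModType R[i]) (x y : V) (M : R) :
  (forall e, 0 < e -> e <= 1 -> cmod `|x - y| <= e * M) -> x = y.
Proof.
move=> xy; apply/eqP; rewrite -subr_eq0; apply/eqP/cmod_norm_eq0.
by apply: small_eq0 xy; exact: cmod_ge0.
Qed.

Section CstarNorm.
Context {R : realType} {A : cstarAlgebra R}.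
Implicit Types a b c : A.

Lemma cmod_cmul a b : cmod `|cmul a b| <= cmod `|a| * cmod `|b|.
Proof. by rewrite -lecR real_complexM -!norm_cmod cnormM. Qed.

Lemma cmod_cstar_mul a : cmod `|cmul (cstar a) a| = cmod `|a| ^+ 2.
Proof. by apply: complexI; rewrite -norm_cmod cnorm_star [in LHS]norm_cmod rmorphXn. Qed.

(** The C*-identity and submultiplicativity give [|b|^2 <= |cstar b| |b|]; this is applied to [a]
    and to [cstar a]. *)
Lemma cmod_cstar a : cmod `|cstar a| = cmod `|a|.
Proof.
have le b : cmod `|b| <= cmod `|cstar b|.
  have [->|b0] := eqVneq b 0; first by rewrite normr0 cmod0 cmod_ge0.
  have := cmod_cmul (cstar b) b; rewrite cmod_cstar_mul expr2.
  by rewrite ler_pM2r// cmod_norm_gt0.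
by apply/eqP; rewrite eq_le le andbT; have := le (cstar a); rewrite cstarK.
Qed.

Lemma cmulBl a b c : cmul (a - b) c = cmul a c - cmul b c.
Proof. by rewrite addrC -scaleN1r cmulDZl scaleN1r addrC. Qed.

Lemma cmulBr a b c : cmul c (a - b) = cmul c a - cmul c b.
Proof. by rewrite addrC -scaleN1r cmulDZr scaleN1r addrC. Qed.

Lemma cstarB a b : cstar (a - b) = cstar a - cstar b.
Proof. by rewrite addrC -scaleN1r cstarDZ rmorphN1 scaleN1r addrC. Qed.

End CstarNorm.

(** * Extension of a contractive representation to the closure *)

Section StarRepExtension.
Context {R : realType} {X : lmodType R[i]} {A : cstarAlgebra R} {V : hilbertSpace R}.
Variables (mul : X -> X -> X) (star : X -> X) (S : set X) (iota : X -> A).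
Variable pi : X -> {linear V -> V}.
Hypotheses (S0 : S 0) (S_ZD : forall a x y, S x -> S y -> S (a *: x + y)).
Hypotheses (S_mul : forall x y, S x -> S y -> S (mul x y)) (S_star : forall x, S x -> S
  (star x)).
Hypothesis iota_ZD : forall a x y, S x -> S y -> iota (a *: x + y) = a *: iota x + iota y.
Hypothesis iota_mul : forall x y, S x -> S y -> iota (mul x y) = cmul (iota x) (iota y).
Hypothesis iota_star : forall x, S x -> iota (star x) = cstar (iota x).
Hypothesis pi_rep : is_star_rep mul star S pi.
Hypothesis pi_le : forall x v, S x -> cmod `|pi x v| <= cmod `|iota x| * cmod `|v|.

Definition approximable (a : A) :=
  forall e : R, 0 < e -> exists2 x, S x & cmod `|a - iota x| <= e.

Let SB x y : S x -> S y -> S (x - y).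
Proof. by move=> Sx Sy; rewrite addrC -scaleN1r; exact: S_ZD. Qed.

Let iotaB x y : S x -> S y -> iota (x - y) = iota x - iota y.
Proof. by move=> Sx Sy; rewrite addrC -scaleN1r iota_ZD// scaleN1r addrC. Qed.

Let piB x y v : S x -> S y -> pi (x - y) v = pi x v - pi y v.
Proof.
by move=> Sx Sy; rewrite addrC -scaleN1r (star_rep_linear pi_rep)// scaleN1r addrC.
Qed.

Let pi_dist x y v : S x -> S y ->
  cmod `|pi x v - pi y v| <= cmod `|iota x - iota y| * cmod `|v|.
Proof. by move=> Sx Sy; rewrite -piB// -iotaB//; apply: pi_le; exact: SB. Qed.

(** [w] is the limit of [pi (x_ n) v] along approximants of [a]. The inequality against every [x]
    determines [w], and it is the only property of the limit used afterwards. *)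
Lemma extension_value (a : A) (v : V) : approximable a ->
  exists w, forall x, S x -> cmod `|w - pi x v| <= cmod `|a - iota x| * cmod `|v|.
Proof.
move=> aA; have pos n : 0 < (n.+1%:R^-1 : R) by rewrite invr_gt0.
pose x_ n := s2val (cid2 (aA _ (pos n))).
have Sx n : S (x_ n) by rewrite /x_; case: cid2.
have ax n : cmod `|a - iota (x_ n)| <= n.+1%:R^-1 by rewrite /x_; case: cid2.
pose w_ n := pi (x_ n) v.
have small (e : R) : 0 < e -> exists N, forall n, (N <= n)%N -> n.+1%:R^-1 *
  (cmod `|v| + 1) < e.
  move=> e0; have c0 : 0 < cmod `|v| + 1 by rewrite ltr_wpDl ?cmod_ge0.
  exists (Num.bound ((cmod `|v| + 1) / e)) => n Nn.
  rewrite mulrC ltr_pdivrMr// mulrC -ltr_pdivrMr//.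
  apply: (lt_le_trans (archi_boundP _)); first by rewrite divr_ge0 ?ltW.
  by rewrite ler_nat leqW.
have wn n m : (n <= m)%N -> cmod `|w_ n - w_ m| <= 2%:R * (n.+1%:R^-1 * (cmod `|v| + 1)).
  move=> nm; apply: (le_trans (pi_dist _ (Sx n) (Sx m))).
  rewrite mulrA ler_pM ?cmod_ge0 ?lerDl//.
  apply: (le_trans (cmod_dist_triangle a _ _)); rewrite mulr_natl mulr2n lerD//.
    by rewrite cmod_dist_sym.
  by apply: (le_trans (ax m)); rewrite lef_pV2 ?posrE// ler_nat.
have cw : cauchy (w_ @ \oo).
  apply: cauchy_exP => e; rewrite ltcE => /andP[/eqP e1 e0].
  have ee : e = (complex.Re e)%:C by case: e e1 {e0} => a' b' /= ->.
  have [N HN] := small (complex.Re e / 2%:R) ltac:(by rewrite divr_gt0).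
  exists (w_ N); exists N => // n /= Nn; rewrite -ball_normE /= ee norm_cmod ltcR.
  apply: (le_lt_trans (wn _ _ Nn)); rewrite mulrC -ltr_pdivlMr//.
  exact: HN N (leqnn _).
have : cvg (w_ @ \oo) by exact: cauchy_cvg.
move=> /cvg_ex[w /cvgrPdist_lt ww].
exists w => x Sx'; apply/ler_addgt0Pl => e e0.
have e20 : 0 < e / 2%:R by rewrite divr_gt0.
have [N1 _ HN1] := ww (e / 2%:R)%:C ltac:(by rewrite ltcR).
have [N2 HN2] := small _ e20.
pose n := maxn N1 N2.
have h1 : cmod `|w - w_ n| <= e / 2%:R.
  by rewrite -lecR -norm_cmod; apply/ltW/HN1; rewrite /= leq_maxl.
have h2 := HN2 n (leq_maxr _ _).
have h3 := le_trans (pi_dist v (Sx n) Sx') (ler_wpM2r (cmod_ge0 _) (cmod_dist_triangle a _ _)).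
have h4 : cmod `|iota (x_ n) - a| * cmod `|v| <= n.+1%:R^-1 * (cmod `|v| + 1).
  by rewrite ler_pM ?cmod_ge0 ?lerDl// cmod_dist_sym.
apply: (le_trans (cmod_dist_triangle (w_ n) _ _)).
rewrite mulrDl in h3; rewrite (splitr e) -addrA; apply: lerD => //.
apply: (le_trans h3); rewrite lerD2r; exact/ltW/(le_lt_trans h4 h2).
Qed.

(** The value 0 off the closure keeps the map linear in [v] for every [a]. *)
Definition extension_fun (a : A) (v : V) : V :=
  if pselect (approximable a) is left aA then sval (cid (extension_value v aA)) else 0.

Lemma extension_funP (a : A) (v : V) (x : X) : approximable a -> S x ->
  cmod `|extension_fun a v - pi x v| <= cmod `|a - iota x| * cmod `|v|.
Proof.
by move=> aA Sx; rewrite /extension_fun; case: pselect => // aA'; case: cid => w /= ->.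
Qed.

Lemma extension_linear (a : A) : linear (extension_fun a).
Proof.
move=> k v v'.
have [aA|aA] := pselect (approximable a); last first.
  by rewrite /extension_fun; case: pselect => // _; rewrite scaler0 addr0.
apply: (@small_norm_eq _ _ _ _ (cmod `|k *: v + v'| + cmod k * cmod `|v| + cmod `|v'|))
  => e e0 _.
have [x Sx ax] := aA _ e0.
have h w : cmod `|extension_fun a w - pi x w| <= e * cmod `|w|.
  by apply: (le_trans (extension_funP _ aA Sx)); rewrite ler_wpM2r ?cmod_ge0.
apply: (le_trans (cmod_dist_triangle (pi x (k *: v + v')) _ _)).
rewrite -addrA mulrDr lerD// linearP opprD addrACA -scalerBr.
apply: (le_trans (cmod_normD _ _)); rewrite mulrDr lerD//.
  by rewrite cmod_normZ mulrCA ler_wpM2l ?cmod_ge0// cmod_dist_sym.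
by rewrite cmod_dist_sym.
Qed.

Definition extension (a : A) : {linear V -> V} :=
  HB.pack (extension_fun a)
    (GRing.isLinear.Build R[i] V V _ (extension_fun a) (extension_linear a)).

Let extP (a : A) (v : V) (x : X) : approximable a -> S x ->
  cmod `|extension a v - pi x v| <= cmod `|a - iota x| * cmod `|v|.
Proof. exact: extension_funP. Qed.

Lemma approximable_ZD k a b : approximable a -> approximable b -> approximable (k *: a + b).
Proof.
move=> aA bA e e0; have d0 : 0 < cmod k + 1 by rewrite ltr_wpDl ?cmod_ge0.
have e'0 : 0 < e / (cmod k + 1) by rewrite divr_gt0.
have [x Sx ax] := aA _ e'0; have [y Sy yb] := bA _ e'0.
exists (k *: x + y); first exact: S_ZD.
rewrite iota_ZD// opprD addrACA -scalerBr (le_trans (cmod_normD _ _))// cmod_normZ.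
apply: (@le_trans _ _ (cmod k * (e / (cmod k + 1)) + e / (cmod k + 1))).
  by rewrite lerD// ler_wpM2l ?cmod_ge0.
by rewrite -[X in _ + X]mul1r -mulrDl mulrC divfK// gt_eqF.
Qed.

Lemma cmod_cmulB (a b : A) (x y : X) (e : R) : e <= 1 ->
  cmod `|a - iota x| <= e -> cmod `|b - iota y| <= e ->
  cmod `|cmul a b - cmul (iota x) (iota y)| <= e * (cmod `|b| + cmod `|a| + 1).
Proof.
move=> e1 ax yb; apply: (le_trans (cmod_dist_triangle (cmul (iota x) b) _ _)).
rewrite -cmulBl -cmulBr -addrA mulrDr lerD//.
  by apply: (le_trans (cmod_cmul _ _)); rewrite ler_wpM2r ?cmod_ge0.
apply: (le_trans (cmod_cmul _ _)); rewrite mulrC ler_pM ?cmod_ge0//.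
rewrite -[iota x](subKr a); apply: (le_trans (cmod_normD _ _)).
by rewrite cmod_normN lerD// (le_trans ax).
Qed.

Lemma approximable_mul a b : approximable a -> approximable b -> approximable (cmul a b).
Proof.
move=> aA bA e e0; pose M := cmod `|b| + cmod `|a| + 1.
have M0 : 0 < M by rewrite ltr_wpDl ?addr_ge0 ?cmod_ge0.
pose d := Num.min 1 (e / M).
have d0 : 0 < d by rewrite lt_min ltr01 divr_gt0.
have [x Sx ax] := aA _ d0; have [y Sy yb] := bA _ d0.
exists (mul x y); first exact: S_mul.
rewrite iota_mul//; apply: (le_trans (cmod_cmulB _ ax yb)).
  by rewrite ge_min lexx.
by rewrite -ler_pdivlMr// ge_min lexx orbT.
Qed.

Lemma approximable_star a : approximable a -> approximable (cstar a).
Proof.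
move=> aA e e0; have [x Sx ax] := aA _ e0; exists (star x); first exact: S_star.
by rewrite iota_star// -cstarB cmod_cstar.
Qed.

Lemma iota0 : iota 0 = 0.
Proof. by have := iotaB S0 S0; rewrite !subrr. Qed.

Lemma extension_le a v : approximable a -> cmod `|extension a v| <= cmod `|a| * cmod `|v|.
Proof.
move=> aA; have := extP v aA S0; rewrite iota0 subr0.
by have := piB v S0 S0; rewrite !subrr => ->; rewrite subr0.
Qed.

(** Each identity holds exactly for approximants [x], [y] in [S]. Passing through them, both sides
    differ by at most [e] times a constant independent of [e], hence they agree. *)
Lemma extension_star_rep (D : set A) : D `<=` approximable ->
  is_star_rep (@cmul R A) (@cstar R A) D extension.
Proof.
move=> DA; split.
- move=> a /DA aA; exists (cmod `|a|) => v; rewrite norm_cmod [X in _ * X]norm_cmod.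
  by rewrite -real_complexM lecR; exact: extension_le.
- move=> k a b v /DA aA /DA bA.
  apply: (@small_norm_eq _ _ _ _ (2%:R * (cmod k + 1) * cmod `|v|)) => e e0 _.
  have [x Sx ax] := aA _ e0; have [y Sy yb] := bA _ e0.
  have abA := approximable_ZD k aA bA.
  apply: (le_trans (cmod_dist_triangle (pi (k *: x + y) v) _ _)).
  have h1 : cmod `|extension (k *: a + b) v - pi (k *: x + y) v| <=
    (cmod k * e + e) * cmod `|v|.
    apply: (le_trans (extP v abA (S_ZD k Sx Sy))); rewrite ler_wpM2r ?cmod_ge0//.
    rewrite iota_ZD// opprD addrACA -scalerBr (le_trans (cmod_normD _ _))// cmod_normZ.
    by rewrite lerD// ler_wpM2l ?cmod_ge0.
  have h2 : cmod `|pi (k *: x + y) v - (k *: extension a v + extension b v)| <=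
      (cmod k * e + e) * cmod `|v|.
    rewrite (star_rep_linear pi_rep)// opprD addrACA -scalerBr.
    rewrite (le_trans (cmod_normD _ _))// cmod_normZ mulrDl lerD//.
      rewrite -mulrA ler_wpM2l ?cmod_ge0// cmod_dist_sym (le_trans (extP v aA Sx))//.
      by rewrite ler_wpM2r ?cmod_ge0.
    by rewrite cmod_dist_sym (le_trans (extP v bA Sy))// ler_wpM2r ?cmod_ge0.
  by apply: (le_trans (lerD h1 h2)); lra.
- move=> a b v /DA aA /DA bA.
  apply: (@small_norm_eq _ _ _ _ ((cmod `|b| + cmod `|a| + 1) * cmod `|v| +
    ((cmod `|a| + 1) * cmod `|v| + cmod `|extension b v|))) => e e0 e1.
  have [x Sx ax] := aA _ e0; have [y Sy yb] := bA _ e0.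
  apply: (le_trans (cmod_dist_triangle (pi (mul x y) v) _ _)); rewrite mulrDr lerD//.
    apply: (le_trans (extP v (approximable_mul aA bA) (S_mul Sx Sy))).
    by rewrite mulrA ler_wpM2r ?cmod_ge0// iota_mul// cmod_cmulB.
  rewrite (star_rep_mul pi_rep)//.
  apply: (le_trans (cmod_dist_triangle (pi x (extension b v)) _ _)); rewrite mulrDr lerD//.
    rewrite -linearB (le_trans (pi_le _ Sx))// mulrCA ler_pM ?cmod_ge0//.
      rewrite -[iota x](subKr a); apply: (le_trans (cmod_normD _ _)).
      by rewrite cmod_normN lerD// (le_trans ax).
    by rewrite cmod_dist_sym (le_trans (extP v bA Sy))// ler_wpM2r ?cmod_ge0.
  by rewrite cmod_dist_sym (le_trans (extP _ aA Sx))// ler_wpM2r ?cmod_ge0.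
move=> a v w /DA aA; apply/eqP; rewrite -subr_eq0; apply/eqP/cmod_eq0.
apply: (@small_eq0 _ _ (2%:R * (cmod `|v| * cmod `|w|))); first exact: cmod_ge0.
move=> e e0 _; have [x Sx ax] := aA _ e0.
have h1 : cmod (dotp (extension a v) w - dotp (pi x v) w) <= e * (cmod `|v| * cmod `|w|).
  rewrite -dotpBl (le_trans (dotp_le _ _))// mulrA ler_wpM2r ?cmod_ge0//.
  by rewrite (le_trans (extP v aA Sx))// ler_wpM2r ?cmod_ge0.
have h2 : cmod (dotp v (pi (star x) w) - dotp v (extension (cstar a) w)) <=
    e * (cmod `|v| * cmod `|w|).
  rewrite -dotpBr (le_trans (dotp_le _ _))// mulrCA ler_wpM2l ?cmod_ge0//.
  rewrite cmod_dist_sym (le_trans (extP w (approximable_star aA) (S_star Sx)))//.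
  by rewrite ler_wpM2r ?cmod_ge0// iota_star// -cstarB cmod_cstar.
rewrite -(subrKA (dotp (pi x v) w)) {2}(star_rep_star pi_rep)//.
by apply: (le_trans (cmodD _ _)); lra.
Qed.

Lemma extension_iota x v : S x -> extension (iota x) v = pi x v.
Proof.
move=> Sx; apply/eqP; rewrite -subr_eq0; apply/eqP/cmod_norm_eq0.
apply/eqP; rewrite eq_le cmod_ge0 andbT.
have xA : approximable (iota x).
  by move=> e e0; exists x => //; rewrite subrr normr0 cmod0 ltW.
by apply: (le_trans (extP v xA Sx)); rewrite subrr normr0 cmod0 mul0r.
Qed.

End StarRepExtension.

(** * The Hecke algebra of a compact open subgroup *)

Section CompactOpenSubgroup.
Context {R : realType} {G : topologicalGroupType}.
Variables (mu : {measure set (borel G) -> \bar R}) (Delta : G -> R) (H : set G).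
Hypotheses (hG : hausdorff_space G) (haar : left_haar_measure mu).
Hypotheses (modular : modular_function mu Delta).
Hypotheses (sH : subgroup H) (cH : compact H) (oH : open H) (muH : mu H = 1%E).
Implicit Types f g : G -> R[i].

Local Notation p := (@hecke_proj R G H).
Local Notation star := (invol Delta).
Local Notation "f ** g" := (conv mu f g) (at level 40, left associativity).

Lemma subgroup1 : H 1%g. Proof. by case: sH. Qed.

Lemma subgroupM x y : H x -> H y -> H (x * y)%g.
Proof. by case: sH => _ h _; exact: h. Qed.

Lemma subgroupV x : H x -> H x^-1%g.
Proof. by case: sH => _ _ h; exact: h. Qed.

Lemma subgroupMl h x : H h -> H (h * x)%g <-> H x.
Proof.
move=> Hh; split=> [Hx|Hx]; last exact: subgroupM.
by rewrite -(mulKg h x); apply: subgroupM => //; exact: subgroupV.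
Qed.

Lemma subgroupMr h x : H h -> H (x * h)%g <-> H x.
Proof.
move=> Hh; split=> [Hx|Hx]; last exact: subgroupM.
by rewrite -(mulgK h x); apply: subgroupM => //; exact: subgroupV.
Qed.

Lemma subgroupVE x : H x^-1%g <-> H x.
Proof. by split=> [/subgroupV|/subgroupV//]; rewrite invgK. Qed.

Lemma open_mulr (U : set G) x : open U -> open [set (y * x)%g | y in U].
Proof.
move=> oU; rewrite (_ : [set _ | _ in _] = (fun t => t * x^-1)%g @^-1` U).
  by move/continuousP : (continuous_mulgr (y := x^-1%g)); apply.
apply/seteqP; split => t /=; first by move=> [y Uy <-]; rewrite mulgK.
by move=> Ut; exists (t * x^-1)%g => //; rewrite mulgVK.
Qed.

(** The normalization of [mu] lets every property of [Delta] below be read off from the measures of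
    the cosets [Hx]. *)
Lemma modularE x : (mu [set (y * x)%g | y in H] = (Delta x)%:E)%E.
Proof. by rewrite modular ?muH ?mule1//; exact: open_borel. Qed.

Lemma modular_ge0 x : 0 <= Delta x.
Proof. by rewrite -lee_fin -modularE; exact: measure_ge0. Qed.

Lemma modularM x y : Delta (x * y)%g = Delta x * Delta y.
Proof.
apply: EFin_inj; rewrite -modularE mulrC EFinM -(modularE x) -modular; last first.
  by apply: open_borel; exact: open_mulr.
congr (mu _); apply/seteqP; split => t /=.
  by move=> [h Hh <-]; exists (h * x)%g; [exists h|rewrite mulgA].
by move=> [_ [h Hh <-] <-]; exists h => //; rewrite mulgA.
Qed.

Lemma modular_subgroup h : H h -> Delta h = 1.
Proof.
move=> Hh; apply: EFin_inj; rewrite -modularE -muH; congr (mu _).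
apply/seteqP; split => t /=; first by move=> [y Hy <-]; exact: subgroupM.
by move=> Ht; exists (t * h^-1)%g; [apply/subgroupM/subgroupV|rewrite mulgVK].
Qed.

Lemma modularV x : Delta x * Delta x^-1%g = 1.
Proof. by rewrite -modularM mulgV modular_subgroup//; exact: subgroup1. Qed.

(** * Invariant functions and indicators of cosets *)

Definition right_invariant f := forall x h, H h -> f (x * h)%g = f x.
Definition left_invariant f := forall h x, H h -> f (h * x)%g = f x.

Lemma nbhs_coset x : nbhs x (fun t => H (x^-1 * t)%g).
Proof.
apply: open_nbhs_nbhs; split; last by rewrite mulVg; exact: subgroup1.
by move/continuousP : (continuous_mulgl (y := x^-1%g)) => /(_ H oH).
Qed.

Lemma right_invariantE f x t : right_invariant f -> H (x^-1 * t)%g -> f t = f x.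
Proof. by move=> fr /(fr x); rewrite mulVKg. Qed.

(** The coset [xH] is an open neighbourhood of [x] on which [f] is constant. *)
Lemma right_invariant_continuous f : right_invariant f -> continuous (f : G -> R[i]^o).
Proof.
move=> fr x; apply: cvg_near_cst.
by apply: filterS (nbhs_coset x) => t; exact: right_invariantE.
Qed.

Lemma hecke_projE t : p t = (`[< H t >])%:R.
Proof. by rewrite /hecke_proj indicE; congr (_%:R); apply/idP/asboolP; rewrite inE. Qed.

Lemma hecke_proj_in t : H t -> p t = 1.
Proof. by move=> Ht; rewrite hecke_projE asboolT. Qed.

Lemma hecke_proj_out t : ~ H t -> p t = 0.
Proof. by move=> Ht; rewrite hecke_projE asboolF. Qed.

Lemma eq_hecke_proj s t : (H s <-> H t) -> p s = p t.
Proof. by move=> st; rewrite !hecke_projE (asbool_equiv_eq st). Qed.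

Lemma hecke_proj_right : right_invariant p.
Proof. by move=> x h Hh; apply: eq_hecke_proj; exact: subgroupMr. Qed.

Lemma hecke_proj_left : left_invariant p.
Proof. by move=> h x Hh; apply: eq_hecke_proj; exact: subgroupMl. Qed.

Lemma continuous_hecke_proj : continuous (p : G -> R[i]^o).
Proof. exact/right_invariant_continuous/hecke_proj_right. Qed.

Lemma Cc_hecke_proj : Cc p.
Proof.
apply/(CcP hG); split; first exact: continuous_hecke_proj.
by exists H => // x; exact: hecke_proj_out.
Qed.

Definition coset_fun x : G -> R[i] := fun t => p (x^-1 * t)%g.

Lemma Cc_coset_fun x : Cc (coset_fun x).
Proof. exact: (Cc_mull hG x^-1%g Cc_hecke_proj). Qed.

Lemma coset_fun_right x : right_invariant (coset_fun x).
Proof. by move=> t h Hh; rewrite /coset_fun mulgA hecke_proj_right. Qed.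

Lemma continuous_coset_fun x : continuous (coset_fun x : G -> R[i]^o).
Proof. exact/right_invariant_continuous/coset_fun_right. Qed.

Lemma Cintegral_hecke_proj : Cintegral mu p = 1.
Proof.
have mH : measurable (H : set (borel G)) by exact: open_borel.
apply/eqP; rewrite eq_complex /=; apply/andP; split; apply/eqP.
  rewrite (@eq_Rintegral _ _ _ mu setT (\1_H)); last first.
    by move=> x _; rewrite /hecke_proj !indicE; case: (x \in H).
  by rewrite /Rintegral integral_indic// setIT muH.
rewrite (@eq_Rintegral _ _ _ mu setT (cst 0)) ?Rintegral_cst ?mul0r//.
by move=> x _; rewrite /hecke_proj !indicE; case: (x \in H).
Qed.

Lemma Cintegral_coset_fun x f : right_invariant f ->
  Cintegral mu (fun t => coset_fun x t * f t) = f x.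
Proof.
move=> fr; rewrite (@eq_Cintegral _ _ _ _ (fun t => coset_fun x t * f x)); last first.
  move=> t; rewrite /coset_fun; have [Ht|/hecke_proj_out ->] := pselect (H (x^-1 * t)%g).
    by rewrite (right_invariantE fr Ht).
  by rewrite !mul0r.
rewrite (CintegralZr hG haar); last exact: Cc_coset_fun.
by rewrite (Cintegral_mull hG haar x^-1%g Cc_hecke_proj) Cintegral_hecke_proj mul1r.
Qed.

Lemma conv_projr f : right_invariant f -> f ** p = f.
Proof.
move=> fr; apply/funext => x; rewrite -[RHS](Cintegral_coset_fun x fr).
apply: eq_Cintegral => y; rewrite mulrC; congr (_ * _); apply: eq_hecke_proj.
by rewrite -subgroupVE invgM invgK.
Qed.

Lemma conv_projl f : left_invariant f -> p ** f = f.
Proof.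
move=> fl; apply/funext => x.
transitivity (Cintegral mu (fun y => p y * f x)).
  apply: eq_Cintegral => y; have [/subgroupV Hy|/hecke_proj_out ->] := pselect (H y).
    by rewrite fl.
  by rewrite !mul0r.
by rewrite (CintegralZr hG haar) ?Cintegral_hecke_proj ?mul1r//; exact: Cc_hecke_proj.
Qed.

Lemma conv_right_invariant f g : right_invariant g -> right_invariant (f ** g).
Proof.
by move=> gr x h Hh; apply: eq_Cintegral => y; rewrite mulgA gr.
Qed.

Lemma conv_left_invariant f g : Cc f -> continuous (g : G -> R[i]^o) ->
  left_invariant f -> left_invariant (f ** g).
Proof.
move=> cf cg fl h x Hh; rewrite /conv.
rewrite -(Cintegral_mull hG haar h (Cc_conv_integrand hG (h * x)%g cf cg)).
by apply: eq_Cintegral => y; rewrite fl// invgM -mulgA mulKg.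
Qed.

Lemma Cc_projP f : Cc_proj mu H f <-> Cc f /\ right_invariant f.
Proof.
split=> [[g cg <-]|[cf fr]]; last by exists f => //; exact: conv_projr.
split; first by apply: (Cc_conv hG haar) => //; exact: Cc_hecke_proj.
exact/conv_right_invariant/hecke_proj_right.
Qed.

Lemma hecke_algebraP f : hecke_algebra mu H f <->
  [/\ Cc f, left_invariant f & right_invariant f].
Proof.
have cp := Cc_hecke_proj.
split=> [[g cg <-]|[cf fl fr]].
  have cpg : Cc (p ** g) by exact: (Cc_conv hG haar).
  split; first exact: (Cc_conv hG haar).
    apply: conv_left_invariant => //; first exact: continuous_hecke_proj.
    apply: conv_left_invariant => //; first by case/(CcP hG) : cg.
    exact: hecke_proj_left.
  exact/conv_right_invariant/hecke_proj_right.
by exists f => //; rewrite conv_projl// conv_projr.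
Qed.

Lemma right_invariantD f g : right_invariant f -> right_invariant g ->
  right_invariant (f + g).
Proof. by move=> fr gr x h Hh; rewrite !fctE fr// gr. Qed.

Lemma right_invariantZ a f : right_invariant f -> right_invariant (a *: f).
Proof. by move=> fr x h Hh; rewrite !fctE fr. Qed.

Lemma left_invariantD f g : left_invariant f -> left_invariant g ->
  left_invariant (f + g).
Proof. by move=> fr gr x h Hh; rewrite !fctE fr// gr. Qed.

Lemma left_invariantZ a f : left_invariant f -> left_invariant (a *: f).
Proof. by move=> fr x h Hh; rewrite !fctE fr. Qed.

Lemma right_invariantB f g : right_invariant f -> right_invariant g ->
  right_invariant (f - g).
Proof.
by move=> fr gr; rewrite -scaleN1r; apply: right_invariantD => //; exact: right_invariantZ.
Qed.

Lemma coset_decomposition f : Cc f -> right_invariant f ->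
  exists l : seq (R[i] * G), f = \sum_(c <- l) c.1 *: coset_fun c.2.
Proof.
move=> /(CcP hG)[_ [K cK fK]] fr.
have [s fs] : exists s : seq G, forall t, f t != 0 -> exists2 x, x \in s & H (x^-1 * t)%g.
  pose U x : set G := [set t | H (x^-1 * t)%g].
  have oU x : K x -> open (U x).
    by move=> _; move/continuousP : (continuous_mulgl (y := x^-1%g)) => /(_ H oH).
  have KU : K `<=` cover K U.
    by move=> t Kt; exists t => //; rewrite /U /= mulVg; exact: subgroup1.
  have := cK; rewrite compact_cover => /(_ _ K U oU KU)[s _ Ks].
  exists (finmap.enum_fset s) => t ft.
  have /Ks[x xs Ux] : K t by apply: contrapT => /fK/eqP; exact/negP.
  by exists x.
elim: s f {K cK fK} fr fs => [|x s IH] f fr fs.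
  exists [::]; rewrite big_nil; apply/funext => t.
  by apply/eqP; apply: contraT => /fs[].
(* Subtracting this multiple kills [f] on [xH] and changes nothing elsewhere, so the remaining
   points of [s] cover the new support. *)
have [||l fl] := IH (f - f x *: coset_fun x).
- by apply: right_invariantB => //; apply: right_invariantZ; exact: coset_fun_right.
- move=> t; rewrite !fctE; have [Ht|Ht] := pselect (H (x^-1 * t)%g).
    by rewrite /coset_fun hecke_proj_in// (right_invariantE fr Ht) /GRing.scale/=
      mulr1 subrr eqxx.
  rewrite /coset_fun hecke_proj_out// scaler0 subr0 => /fs[y].
  by rewrite inE => /predU1P[->//|ys Hy]; exists y.
exists ((f x, x) :: l); rewrite big_cons /= -fl.
by rewrite addrC subrK.
Qed.

(** * The involution and the modular function *)

Lemma Cintegral_mulr y f : Cc f ->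
  Cintegral mu (fun x => f (x * y)%g) = (Delta y^-1%g)%:C * Cintegral mu f.
Proof.
move=> cf; apply: (@Cintegral_image_scale _ _ _ hG haar (fun x => x * y)%g (fun x
  => x * y^-1)%g) => //.
- exact: modular_ge0.
- exact: continuous_mulgr.
- exact: continuous_mulgr.
- exact: mulgK.
- exact: mulgVK.
- by move=> E mE; exact: modular.
Qed.

Lemma continuous_modular : continuous ((fun x => (Delta x)%:C) : G -> R[i]^o).
Proof.
apply: right_invariant_continuous => x h Hh.
by rewrite modularM (modular_subgroup Hh) mulr1.
Qed.

Lemma Cc_invol f : Cc f -> Cc (star f).
Proof.
move=> cf; apply: (@CcM _ _ hG (fun x => conjc (f x^-1%g)) (fun x => (Delta x^-1%g)%:C)).
  exact: (Cc_conj hG (Cc_inv hG cf)).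
move=> x; apply: (@continuous_comp _ _ _ (fun x : G => x^-1%g) ((fun x => (Delta x)%:C) :
  G -> R[i]^o)).
  exact: invg_continuous.
exact: continuous_modular.
Qed.

Lemma involE f x : star f x = conjc (f x^-1%g) * (Delta x^-1%g)%:C.
Proof. by []. Qed.

Lemma involK f : star (star f) = f.
Proof.
apply/funext => x; rewrite !involE conjcM conjcK conjc_real invgK -mulrA -real_complexM.
by rewrite modularV mulr1.
Qed.

Lemma involD f g : star (f + g) = star f + star g.
Proof. by apply/funext => x; rewrite !involE !fctE conjcD mulrDl. Qed.

Lemma involZ a f : star (a *: f) = conjc a *: star f.
Proof. by apply/funext => x; rewrite !involE !fctE conjcM -mulrA. Qed.

Lemma involB f g : star (f - g) = star f - star g.
Proof. by rewrite -(scaleN1r g) -(scaleN1r (star g)) involD involZ rmorphN1. Qed.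

Lemma invol_conv f g : Cc f -> Cc g -> star (f ** g) = star g ** star f.
Proof.
move=> cf cg; apply/funext => x; have csg := Cc_invol cg; have csf := Cc_invol cf.
have cg' : continuous (g : G -> R[i]^o) by case/(CcP hG) : cg.
have csf' : continuous (star f : G -> R[i]^o) by case/(CcP hG) : csf.
(* After this shift of the variable, the modular factors [Delta ((x y)^-1)] and [Delta y] multiply
   to [Delta (x^-1)]. *)
rewrite -[RHS](Cintegral_mull hG haar x (Cc_conv_integrand hG x csg csf')).
rewrite [LHS]involE -(Cintegral_conj hG haar (Cc_conv_integrand hG _ cf cg')).
rewrite -(CintegralZr hG haar _ (Cc_conj hG (Cc_conv_integrand hG _ cf cg'))).
apply: eq_Cintegral => y.
have e : (((x * y)^-1 * x)^-1 = y)%g by rewrite invgM invgK mulKg.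
rewrite !involE e invgM conjcM [in RHS]mulrACA [conjc (f y) * _]mulrC; congr (_ * _).
by rewrite -real_complexM modularM mulrAC [Delta _ * Delta y]mulrC modularV mul1r.
Qed.

Lemma Cintegral_conv f g : Cc f -> Cc g ->
  Cintegral mu (f ** g) = Cintegral mu f * Cintegral mu g.
Proof.
move=> cf cg; have [cf' [K cK fK]] := (CcP hG f).1 cf.
have [cg' [L cL gL]] := (CcP hG g).1 cg.
rewrite -(CintegralZr hG haar _ cf).
transitivity (Cintegral mu (fun y => Cintegral mu (fun x => f y * g (y^-1 * x)%g))).
  apply/esym; apply: (@CFubini _ _ _ hG haar (fun x y => f y * g (y^-1 * x)%g)
    [set (q.1 * q.2)%g | q in K `*` L] K) => //.
  - exact: continuous_conv_integrand.
  - exact: compact_mulg.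
  move=> x y xy; have [Ky|/fK ->] := pselect (K y); last by rewrite mul0r.
  rewrite gL ?mulr0// => Lyx; apply: xy; split => //; exists (y, y^-1 * x)%g => //=.
  by rewrite mulVKg.
apply: eq_Cintegral => y; rewrite (CintegralZ hG haar); last exact: (Cc_mull hG y^-1%g cg).
by rewrite (Cintegral_mull hG haar).
Qed.

(* Both sides are the double integral of [f(y^-1) p(xy)]: integrating first over [x]
   gives [f(y^-1) Delta(y^-1)], integrating first over [y] gives [p * f]. *)
Lemma Cintegral_inv f : Cc f ->
  Cintegral mu (fun x => f x^-1%g * (Delta x^-1%g)%:C) = Cintegral mu f.
Proof.
move=> cf; have [cf' [K cK fK]] := (CcP hG f).1 cf.
rewrite -[RHS]mul1r -Cintegral_hecke_proj -(Cintegral_conv Cc_hecke_proj cf).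
transitivity (Cintegral mu (fun y => Cintegral mu (fun x => f y^-1%g * p (x * y)%g))).
  apply: eq_Cintegral => y; rewrite (CintegralZ hG haar); last exact:
    (Cc_mulr hG y Cc_hecke_proj).
  by rewrite (Cintegral_mulr y Cc_hecke_proj) Cintegral_hecke_proj mulr1.
transitivity (Cintegral mu (fun x => Cintegral mu (fun y => f y^-1%g * p (x * y)%g))).
  apply: (@CFubini _ _ _ hG haar (fun x y => f y^-1%g * p (x * y)%g)
    [set (q.1 * q.2)%g | q in H `*` K] [set x^-1%g | x in K]) => //.
  - move=> q; apply: (@cvgM R[i]).
      apply: (@continuous_comp _ _ _ (fun q : G * G => q.2^-1%g) (f : G -> R[i]^o));
        last exact: cf'.
      by apply: continuous_invg; exact: snd_continuous.
    apply: (@continuous_comp _ _ _ (fun q : G * G => (q.1 * q.2)%g) (p : G -> R[i]^o)).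
      exact: mulg_continuous.
    exact: continuous_hecke_proj.
  - exact: compact_mulg.
  - exact: compact_invg.
  move=> x y xy; have [Ky|/fK ->] := pselect (K y^-1%g); last by rewrite mul0r.
  rewrite hecke_proj_out ?mulr0// => Hxy; apply: xy; split.
    by exists (x * y, y^-1)%g => //=; rewrite mulgK.
  by exists y^-1%g => //; rewrite invgK.
apply: eq_Cintegral => x.
rewrite -(@Cintegral_mull _ _ _ hG haar x^-1%g (fun y => f y^-1%g * p (x * y)%g)); last first.
  apply: (@CcM _ _ hG (fun y => f y^-1%g)); first exact: (Cc_inv hG cf).
  by case/(CcP hG) : (Cc_mull hG x Cc_hecke_proj).
by apply: eq_Cintegral => y; rewrite mulVKg invgM invgK mulrC.
Qed.

(** * Convolution with coset indicators and their projections *)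

Lemma conj_hecke_proj t : conjc (p t) = p t.
Proof. by rewrite hecke_projE conjc_nat. Qed.

Lemma continuous_translate x g : continuous (g : G -> R[i]^o) ->
  continuous ((fun s => g (x * s)%g) : G -> R[i]^o).
Proof.
move=> cg s; apply: (@continuous_comp _ _ _ (fun s => x * s)%g (g : G -> R[i]^o)).
  exact: continuous_mulgl.
exact: cg.
Qed.

(** [star (coset_fun x)] is [Delta x] times the indicator of [H x^-1]; the substitution of [u x] for
    [u] scales the integral by [Delta (x^-1)], which cancels that factor. *)
Lemma conv_invol_coset_fun x g : continuous (g : G -> R[i]^o) ->
  star (coset_fun x) ** g = p ** (fun s => g (x * s)%g).
Proof.
move=> cg; apply/funext => t; have cgx := continuous_translate (x := x) cg.
have := Cintegral_mulr x (Cc_conv_integrand hG t Cc_hecke_proj cgx).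
move=> /(congr1 (fun z => (Delta x)%:C * z)); rewrite mulrA -real_complexM modularV mul1r => Ex.
rewrite -[RHS]Ex.
rewrite -(CintegralZ hG haar _ (Cc_mulr hG x (Cc_conv_integrand hG t Cc_hecke_proj cgx))).
apply: eq_Cintegral => u; rewrite !involE /coset_fun conj_hecke_proj mulrA.
have -> : (x * ((u * x)^-1 * t) = u^-1 * t)%g by rewrite invgM !mulgA mulgV mul1g.
congr (_ * _).
have -> : p (x^-1 * u^-1)%g = p (u * x)%g.
  by rewrite -invgM; apply: eq_hecke_proj; exact: subgroupVE.
have [Hux|/hecke_proj_out ->] := pselect (H (u * x)%g); last by rewrite mul0r mulr0.
rewrite hecke_proj_in// mul1r mulr1; congr (_%:C).
have := modular_subgroup Hux; rewrite modularM => ux1.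
by rewrite -[LHS]mul1r -ux1 mulrAC modularV mul1r.
Qed.

Lemma conv_coset_fun x g t : continuous (g : G -> R[i]^o) ->
  (coset_fun x ** g) t = (p ** g) (x^-1 * t)%g.
Proof.
move=> cg; rewrite -[RHS](Cintegral_mull hG haar x^-1%g
  (Cc_conv_integrand hG _ Cc_hecke_proj cg)).
by apply: eq_Cintegral => u; rewrite invgM invgK -mulgA mulVKg.
Qed.

Lemma conv_invol_coset_fun_id x : star (coset_fun x) ** coset_fun x = p.
Proof.
rewrite conv_invol_coset_fun; last exact: continuous_coset_fun.
rewrite (_ : (fun _ => _) = p); last by apply/funext => s; rewrite /coset_fun mulKg.
exact/conv_projl/hecke_proj_left.
Qed.

Definition coset_proj x : G -> R[i] := coset_fun x ** star (coset_fun x).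

Lemma coset_projE x : coset_proj x = coset_fun x ** star (coset_fun x).
Proof. by []. Qed.

Lemma Cc_coset_proj x : Cc (coset_proj x).
Proof. exact: (Cc_conv hG haar (Cc_coset_fun x) (Cc_invol (Cc_coset_fun x))). Qed.

Lemma conv_coset_projE x g : continuous (g : G -> R[i]^o) ->
  coset_proj x ** g = coset_fun x ** (star (coset_fun x) ** g).
Proof. by move=> cg; apply: (convA hG haar (Cc_coset_fun x) (Cc_invol
  (Cc_coset_fun x)) cg). Qed.

(** Convolution with [coset_proj x] averages [g] over left translates by the conjugate [x H x^-1].
    Commutation is derived from this formula, without computing [coset_proj x] pointwise. *)
Lemma conv_coset_proj x g t : continuous (g : G -> R[i]^o) ->
  (coset_proj x ** g) t = Cintegral mu (fun v => p v * g (x * (v^-1 * (x^-1 * t)))%g).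
Proof.
move=> cg; have cgx := continuous_translate (x := x) cg.
rewrite conv_coset_projE// conv_invol_coset_fun// conv_coset_fun.
  rewrite conv_projl; first by [].
  exact: (conv_left_invariant Cc_hecke_proj cgx hecke_proj_left).
exact: (continuous_conv hG haar Cc_hecke_proj cgx).
Qed.

Lemma conv_coset_proj_fun x : coset_proj x ** coset_fun x = coset_fun x.
Proof.
rewrite conv_coset_projE; last exact: continuous_coset_fun.
by rewrite conv_invol_coset_fun_id conv_projr//; exact: coset_fun_right.
Qed.

Lemma invol_coset_proj x : star (coset_proj x) = coset_proj x.
Proof.
rewrite invol_conv ?involK//; first exact: Cc_coset_fun.
exact/Cc_invol/Cc_coset_fun.
Qed.

#[local] Opaque Defs.conv invol coset_proj.

(** * Commuting projections and sums of squares *)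

Variable N : set G.
Hypotheses (nN : normal_subgroup N [set: G]) (nH : normal_subgroup H N).

Lemma normal_conjg n h : N n -> H (n * h * n^-1)%g <-> H h.
Proof.
case: nH nN => _ _ nHN [[_ _ NV] _ _] Nn; split=> [Hh|]; last exact: nHN.
have := nHN _ _ (NV _ Nn) Hh.
by rewrite invgK !mulgA mulVg mul1g mulgVK.
Qed.

(** Elements of [N] normalize [H], so [Hn = nH], which has measure 1 by left invariance. *)
Lemma modular_normal n : N n -> Delta n = 1.
Proof.
move=> Nn; apply: EFin_inj; rewrite -modularE -muH.
case: haar => _ _ /(_ n _ (open_borel oH)) <-; congr (mu _).
apply/seteqP; split => t /= [h Hh <-].
  exists (n^-1 * (h * n))%g; last by rewrite mulVKg.
  by apply/(normal_conjg _ Nn); rewrite mulgA mulgV mul1g mulgK.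
exists (n * h * n^-1)%g; last by rewrite mulgVK.
exact/(normal_conjg _ Nn).
Qed.

Lemma Cintegral_conjg n f : Cc f -> N n ->
  Cintegral mu (fun w => f (n * w * n^-1)%g) = Cintegral mu f.
Proof.
move=> cf Nn; have := Cintegral_mulr n^-1%g (Cc_mull hG n cf).
rewrite (@eq_Cintegral _ _ _ _ (fun w => f (n * w * n^-1)%g)) => [->|w]; last by rewrite mulgA.
by rewrite invgK modular_normal// mul1r (Cintegral_mull hG haar).
Qed.

(* The conjugates [x H x^-1] and [y H y^-1] are both normal in [N], so each
   normalizes the other. *)
Lemma coset_proj_comm x y g : continuous (g : G -> R[i]^o) ->
  coset_proj x ** (coset_proj y ** g) = coset_proj y ** (coset_proj x ** g).
Proof.
move=> cg; apply/funext => t.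
have cq z : continuous (coset_proj z ** g : G -> R[i]^o).
  exact: (continuous_conv hG haar (Cc_coset_proj z) cg).
pose Phi v w := p v * p w * g (x * (v^-1 * (x^-1 * (y * (w^-1 * (y^-1 * t))))))%g.
have cP : continuous ((fun q : G * G => Phi q.1 q.2) : G * G -> R[i]^o).
  move=> q; apply: (@cvgM R[i]); first apply: (@cvgM R[i]).
  - apply: (@continuous_comp _ _ _ fst (p : G -> R[i]^o)); first exact: fst_continuous.
    exact: continuous_hecke_proj.
  - apply: (@continuous_comp _ _ _ snd (p : G -> R[i]^o)); first exact: snd_continuous.
    exact: continuous_hecke_proj.
  apply: (@continuous_comp _ _ _ (fun q : G * G =>
    x * (q.1^-1 * (x^-1 * (y * (q.2^-1 * (y^-1 * t))))))%g (g : G -> R[i]^o)); last exact: cg.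
  apply: (@continuous_mulg _ _ (fun=> x)); first exact: cst_continuous.
  apply: continuous_mulg; first by apply: continuous_invg; exact: fst_continuous.
  apply: (@continuous_mulg _ _ (fun=> x^-1%g)); first exact: cst_continuous.
  apply: (@continuous_mulg _ _ (fun=> y)); first exact: cst_continuous.
  apply: continuous_mulg; last exact: cst_continuous.
  by apply: continuous_invg; exact: snd_continuous.
transitivity (Cintegral mu (fun v => Cintegral mu (fun w => Phi v w))).
  rewrite conv_coset_proj; last exact: cq.
  apply: eq_Cintegral => v.
  have [Hv|/hecke_proj_out pv] := pselect (H v); last first.
    rewrite pv mul0r (@eq_Cintegral _ _ _ _ (fun=> 0)) ?Cintegral0// => w.
    by rewrite /Phi pv !mul0r.
  rewrite conv_coset_proj; last exact: cg.
  pose F w := p w * g (x * (v^-1 * (x^-1 * (y * (w^-1 * (y^-1 * t))))))%g.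
  (* Chosen so that [y n = x v x^-1 y]: conjugating the variable [w] by [n] then swaps the two
     averaging factors. Normality of [N] in [G] puts [n] in [N]. *)
  pose n := (y^-1 * (x * v * x^-1) * y)%g.
  have Nn : N n.
    case: nH nN => _ HN _ [_ _ nNG].
    by have := nNG y^-1%g _ I (nNG x _ I (HN _ Hv)); rewrite invgK.
  have cF : Cc F.
    apply: (@CcM _ _ hG p (fun w => g (x * (v^-1 * (x^-1 * (y * (w^-1 * (y^-1 * t))))))%g)).
      exact: Cc_hecke_proj.
    move=> w; apply: (@continuous_comp _ _ _ (fun w : G =>
      x * (v^-1 * (x^-1 * (y * (w^-1 * (y^-1 * t))))))%g (g : G -> R[i]^o)); last exact: cg.
    apply: (@continuous_mulg _ _ (fun=> x)); first exact: cst_continuous.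
    apply: (@continuous_mulg _ _ (fun=> v^-1%g)); first exact: cst_continuous.
    apply: (@continuous_mulg _ _ (fun=> x^-1%g)); first exact: cst_continuous.
    apply: (@continuous_mulg _ _ (fun=> y)); first exact: cst_continuous.
    by apply: continuous_mulg; [exact: invg_continuous|exact: cst_continuous].
  transitivity (p v * Cintegral mu F).
    congr (_ * _); rewrite -(Cintegral_conjg cF Nn); apply: eq_Cintegral => w.
    rewrite /F (eq_hecke_proj (normal_conjg w Nn)); congr (_ * g _).
    by rewrite /n !invgM !invgK !mulgA !(mulgVK, mulgV, mulVg, mul1g, mulg1, mulgK).
  rewrite -(CintegralZ hG haar _ cF).
  by apply: eq_Cintegral => w; rewrite /F /Phi mulrA.
transitivity (Cintegral mu (fun w => Cintegral mu (fun v => Phi v w))).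
  apply/esym; apply: (@CFubini _ _ _ hG haar Phi H H cP cH cH) => v w vw.
  rewrite /Phi; have [Hv|/hecke_proj_out ->] := pselect (H v); last by rewrite !mul0r.
  by rewrite (@hecke_proj_out w) ?mulr0 ?mul0r// => Hw; apply: vw.
rewrite conv_coset_proj; last exact: cq.
apply: eq_Cintegral => w; rewrite conv_coset_proj; last exact: cg.
rewrite -(CintegralZ hG haar); last first.
  apply: (@CcM _ _ hG p (fun v => g (x * (v^-1 * (x^-1 * (y * (w^-1 * (y^-1 * t))))))%g)).
    exact: Cc_hecke_proj.
  move=> v; apply: (@continuous_comp _ _ _ (fun v : G =>
    x * (v^-1 * (x^-1 * (y * (w^-1 * (y^-1 * t))))))%g (g : G -> R[i]^o)); last exact: cg.
  apply: (@continuous_mulg _ _ (fun=> x)); first exact: cst_continuous.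
  by apply: continuous_mulg; [exact: invg_continuous|exact: cst_continuous].
by apply: eq_Cintegral => v; rewrite /Phi mulrA [p w * _]mulrC.
Qed.

Definition coset_compl x f := f - coset_proj x ** f.

Lemma coset_complE x f : coset_compl x f = f - coset_proj x ** f.
Proof. by []. Qed.

Lemma Cc_coset_compl x f : Cc f -> Cc (coset_compl x f).
Proof. by move=> cf; exact: (CcB hG cf (Cc_conv hG haar (Cc_coset_proj x) cf)). Qed.

Lemma coset_compl_right x f : right_invariant f -> right_invariant (coset_compl x f).
Proof. by move=> fr; apply: right_invariantB => //; exact: conv_right_invariant. Qed.

Lemma Cc_continuous f : Cc f -> continuous (f : G -> R[i]^o).
Proof. by move=> /(CcP hG)[]. Qed.

Lemma convNr f g : Cc f -> continuous (g : G -> R[i]^o) -> f ** (- g) = - (f ** g).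
Proof.
by move=> cf cg; rewrite -[in LHS]scaleN1r (convZr hG haar _ cf cg) scaleN1r.
Qed.

Lemma conv0r f : Cc f -> f ** 0 = 0.
Proof.
by move=> cf; have := convZr hG haar 0 cf (Cc_continuous (Cc0 hG)); rewrite !scale0r.
Qed.

Lemma convBr f g h : Cc f -> Cc g -> Cc h -> f ** (g - h) = f ** g - f ** h.
Proof.
move=> cf cg ch; rewrite (convDr hG haar cf (Cc_continuous cg) (Cc_continuous (CcN hG ch))).
by rewrite (convNr cf (Cc_continuous ch)).
Qed.

Lemma convBl f g h : Cc f -> Cc g -> Cc h -> (f - g) ** h = f ** h - g ** h.
Proof.
move=> cf cg ch; rewrite (convDl hG haar cf (CcN hG cg) (Cc_continuous ch)).
rewrite -(scaleN1r g) (convZl hG haar _ cg (Cc_continuous ch)).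
by rewrite scaleN1r.
Qed.

Lemma coset_compl_comm x y f : Cc f ->
  coset_compl x (coset_compl y f) = coset_compl y (coset_compl x f).
Proof.
move=> cf; have cq z := Cc_coset_proj z.
have cqf z : Cc (coset_proj z ** f) by exact: (Cc_conv hG haar (cq z) cf).
rewrite !coset_complE (convBr (cq x) cf (cqf y)) (convBr (cq y) cf (cqf x)).
have -> := coset_proj_comm x y (Cc_continuous cf).
have subACA (V : zmodType) (a b c d : V) : a - b - (c - d) = a - c - (b - d).
  by rewrite !opprD !opprK addrACA.
move: (coset_proj x ** f) (coset_proj y ** f) (coset_proj y ** (coset_proj x ** f)) => b c d.
exact: subACA.
Qed.

Lemma coset_compl_coset_fun x : coset_compl x (coset_fun x) = 0.
Proof. by rewrite /coset_compl conv_coset_proj_fun subrr. Qed.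

Definition coset_compls s f := foldl (fun f x => coset_compl x f) f s.

Lemma coset_complZD x a f g : Cc f -> Cc g ->
  coset_compl x (a *: f + g) = a *: coset_compl x f + coset_compl x g.
Proof.
move=> cf cg; have cq := Cc_coset_proj x.
rewrite /coset_compl (convDr hG haar cq (Cc_continuous (CcZ hG a cf)) (Cc_continuous cg)).
rewrite (convZr hG haar a cq (Cc_continuous cf)) scalerBr opprD.
by rewrite addrACA.
Qed.

Lemma coset_complsZD s a f g : Cc f -> Cc g ->
  coset_compls s (a *: f + g) = a *: coset_compls s f + coset_compls s g.
Proof.
elim: s f g => //= x s IH f g cf cg.
by rewrite coset_complZD// IH//; exact: Cc_coset_compl.
Qed.

Lemma coset_compl0 x : coset_compl x 0 = 0.
Proof.
have := coset_complZD x (-1) (Cc0 hG) (Cc0 hG).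
by rewrite scaleN1r addNr scaleN1r addNr.
Qed.

Lemma coset_compls0 s : coset_compls s 0 = 0.
Proof. by elim: s => //= x s IH; rewrite coset_compl0. Qed.

Lemma coset_compls_comm s x f : Cc f ->
  coset_compls s (coset_compl x f) = coset_compl x (coset_compls s f).
Proof.
elim: s f => //= y s IH f cf; rewrite coset_compl_comm// IH//.
exact: Cc_coset_compl.
Qed.

(** Commutation moves the factor belonging to [x] next to [coset_fun x], which it annihilates. The
    normality of [H] in [N] enters the positivity argument through this step. *)
Lemma coset_compls_coset_fun s x : x \in s -> coset_compls s (coset_fun x) = 0.
Proof.
elim: s => //= y s IH; rewrite inE => /predU1P[<-|xs].
  by rewrite coset_compl_coset_fun coset_compls0.
rewrite coset_compls_comm; last exact: Cc_coset_fun.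
by rewrite IH// coset_compl0.
Qed.

Lemma coset_compls_eq0 (l : seq (R[i] * G)) s : {subset map snd l <= s} ->
  coset_compls s (\sum_(c <- l) c.1 *: coset_fun c.2) = 0.
Proof.
elim: l => [|[a x] l IH] ls; first by rewrite big_nil coset_compls0.
rewrite big_cons coset_complsZD; last 2 first.
- exact: Cc_coset_fun.
- by apply: (Cc_sum hG) => c; apply: (CcZ hG); exact: Cc_coset_fun.
rewrite coset_compls_coset_fun; last by apply: ls; rewrite inE eqxx.
by rewrite scaler0 add0r IH// => y yl; apply: ls; rewrite inE yl orbT.
Qed.

Lemma coset_proj_idem x : coset_proj x ** coset_proj x = coset_proj x.
Proof.
have ca := Cc_coset_fun x; have csa := Cc_invol ca.
rewrite {2}coset_projE -(convA hG haar (Cc_coset_proj x) ca (Cc_continuous csa)).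
by rewrite conv_coset_proj_fun -coset_projE.
Qed.

(** Pythagoras for the decomposition of [f] into [q ** f] and [f - q ** f]: the cross terms vanish
    because [q] is a projection. *)
Lemma inner_projection q f : Cc q -> star q = q -> q ** q = q -> Cc f ->
  star f ** f = star f ** (q ** f) + star (f - q ** f) ** (f - q ** f).
Proof.
move=> cq sq qq cf.
have cqf : Cc (q ** f) := Cc_conv hG haar cq cf.
have csf : Cc (star f) := Cc_invol cf.
have csfq : Cc (star f ** q) := Cc_conv hG haar csf cq.
have -> : star (f - q ** f) = star f - star f ** q by rewrite involB (invol_conv cq cf) sq.
have e1 : (star f ** q) ** f = star f ** (q ** f).
  exact: (convA hG haar csf cq (Cc_continuous cf)).
have e2 : (star f ** q) ** (q ** f) = star f ** (q ** f).
  rewrite (convA hG haar csf cq (Cc_continuous cqf)).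
  by rewrite -(convA hG haar cq cq (Cc_continuous cf)) qq.
rewrite (convBl csf csfq (CcB hG cf cqf)).
rewrite (convBr csf cf cqf) (convBr csfq cf cqf) e1 e2 subrr subr0.
by rewrite addrC subrK.
Qed.

Lemma inner_coset_compl x f : Cc f ->
  star f ** f = star (star (coset_fun x) ** f) ** (star (coset_fun x) ** f)
    + star (coset_compl x f) ** coset_compl x f.
Proof.
move=> cf; have ca := Cc_coset_fun x; have csa := Cc_invol ca.
have csaf := Cc_conv hG haar csa cf.
have -> : star (star (coset_fun x) ** f) ** (star (coset_fun x) ** f) =
    star f ** (coset_proj x ** f).
  rewrite (invol_conv csa cf) involK (convA hG haar (Cc_invol cf) ca (Cc_continuous csaf)).
  by rewrite (conv_coset_projE x (Cc_continuous cf)).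
exact: (inner_projection (Cc_coset_proj x) (invol_coset_proj x) (coset_proj_idem x) cf).
Qed.

Lemma hecke_conv_invol_coset_fun x f : Cc f -> right_invariant f ->
  hecke_algebra mu H (star (coset_fun x) ** f).
Proof.
move=> cf fr; apply/hecke_algebraP; split.
- exact: (Cc_conv hG haar (Cc_invol (Cc_coset_fun x)) cf).
- rewrite conv_invol_coset_fun; last exact: Cc_continuous.
  apply: (conv_left_invariant Cc_hecke_proj _ hecke_proj_left).
  exact/continuous_translate/Cc_continuous.
- exact: conv_right_invariant.
Qed.

Lemma inner_sum_squares s f : Cc f -> right_invariant f -> coset_compls s f = 0 ->
  exists gs : seq (G -> R[i]), (forall g, g \in gs -> hecke_algebra mu H g) /\
    star f ** f = \sum_(g <- gs) star g ** g.
Proof.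
elim: s f => [|x s IH] f cf fr /= f0.
  exists [::]; split => //; rewrite big_nil f0.
  by rewrite (conv0r (Cc_invol (Cc0 hG))).
have [gs [hgs fE]] := IH _ (Cc_coset_compl x cf) (@coset_compl_right x f fr) f0.
exists (star (coset_fun x) ** f :: gs); split.
  by move=> g; rewrite inE => /predU1P[->|/hgs//]; exact: hecke_conv_invol_coset_fun.
by rewrite big_cons -fE -inner_coset_compl.
Qed.

Lemma inner_R_is_positive : inner_R_positive mu Delta H.
Proof.
move=> f /Cc_projP[cf fr].
have [l fl] := coset_decomposition cf fr.
have [|gs [hgs fE]] := inner_sum_squares (s := map snd l) cf fr.
  by rewrite fl; exact: coset_compls_eq0.
(* The extra zero term makes the number of squares at least 1 even when [gs] is empty. *)
exists (size (0 :: gs)), (fun i => nth 0 (0 :: gs) i).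
have h0 : hecke_algebra mu H 0.
  by apply/hecke_algebraP; split => //; exact: (Cc0 hG).
split => //.
  move=> i; case: i => [[|i] /= ilt] //; apply: hgs; exact: mem_nth.
rewrite [inner_R _ _ _ _](_ : _ = star f ** f)// fE -(big_mkord xpredT (fun i => star (nth 0
  (0 :: gs) i) ** nth 0 (0 :: gs) i)).
rewrite -(big_nth 0 xpredT (fun g => star g ** g)) big_cons.
by rewrite (conv0r (Cc_invol (Cc0 hG))) add0r.
Qed.

(** * The convolution representation attached to an invariant kernel *)

Section PositiveDefiniteKernel.
Variable K : G -> G -> R[i].
Hypotheses (K_herm : forall x y, conjc (K x y) = K y x).
Hypotheses (K_pos : forall l, 0 <= formal_eval (kernel_fun K l) l).
Hypotheses (K_mull : forall t x y, K (t * x)%g (t * y)%g = K x y).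
Hypotheses (K_right : forall x, right_invariant (K x)).
Implicit Types (u v w : rkhs K) (l m : seq (R[i] * G)).

Definition translate t l := [seq (c.1, (t * c.2)%g) | c <- l].

Lemma formal_eval_translate (F : G -> R[i]) t l :
  formal_eval F (translate t l) = formal_eval (fun x => F (t * x)%g) l.
Proof. by rewrite /formal_eval big_map. Qed.

Lemma kernel_fun_translate t l x :
  kernel_fun K (translate t l) (t * x)%g = kernel_fun K l x.
Proof. by rewrite /kernel_fun big_map; apply: eq_bigr => c _ /=; rewrite K_mull. Qed.

Lemma kernel_seminorm_translate t l :
  kernel_seminorm K (translate t l) = kernel_seminorm K l.
Proof.
rewrite /kernel_seminorm formal_eval_translate; congr (Num.sqrt (complex.Re (formal_eval _ _))).
by apply/funext => x; rewrite kernel_fun_translate.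
Qed.

(** The difference of the point masses at [x h] and [x] has seminorm 0, so every function of the
    space vanishes on it. *)
Lemma rkhs_right_invariant u : right_invariant u.
Proof.
move=> x h Hh; apply/eqP; rewrite -subr_eq0; apply/eqP/cmod_eq0.
have -> : u (x * h)%g - u x = formal_eval u [:: (1, (x * h)%g); (-1, x)].
  by rewrite !formal_eval_cons formal_eval_nil /= mul1r mulN1r addr0.
apply/eqP; rewrite eq_le cmod_ge0 andbT (le_trans (cmod_eval_le _ _))//.
rewrite (_ : kernel_seminorm K _ = 0) ?mulr0//.
rewrite /kernel_seminorm; set F := kernel_fun _ _.
have F0 y : F y = 0.
  have -> : F y = conjc 1 * K y (x * h)%g + (conjc (-1) * K y x + 0).
    by rewrite /F /kernel_fun !big_cons big_nil.
  by rewrite K_right// conjc1 rmorphN1 mul1r mulN1r addr0 subrr.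
by rewrite !formal_eval_cons formal_eval_nil /= !F0 !mulr0 !addr0 /= sqrtr0.
Qed.

Lemma rkhs_continuous u : continuous (u : G -> R[i]^o).
Proof. exact/right_invariant_continuous/rkhs_right_invariant. Qed.

Lemma continuous_formal_eval (F : G -> R[i]) l : continuous (F : G -> R[i]^o) ->
  continuous ((fun s => formal_eval F (translate s^-1%g l)) : G -> R[i]^o).
Proof.
move=> cF; elim: l => [|[c x] l IH].
  rewrite (_ : (fun _ => _) = fun=> 0); first exact: cst_continuous.
  by apply/funext => s; rewrite /translate formal_eval_nil.
rewrite (_ : (fun _ => _) = (fun s => c * F (s^-1 * x)%g + formal_eval F
  (translate s^-1%g l))); last first.
  by apply/funext => s; rewrite /translate /= formal_eval_cons.
move=> s; apply: (@cvgD _ R[i]^o); last exact: IH.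
apply: (@cvgM R[i]); first exact: cvg_cst.
apply: (@continuous_comp _ _ _ (fun s => s^-1 * x)%g (F : G -> R[i]^o)); last exact: cF.
apply: continuous_mulg; last exact: cst_continuous.
exact: invg_continuous.
Qed.

Lemma formal_eval_conv f (F : G -> R[i]) l : Cc f -> continuous (F : G -> R[i]^o) ->
  formal_eval (f ** F) l =
  Cintegral mu (fun s => f s * formal_eval F (translate s^-1%g l)).
Proof.
move=> cf cF; elim: l => [|[c x] l IH].
  rewrite formal_eval_nil -(Cintegral0 mu); apply: eq_Cintegral => s.
  by rewrite formal_eval_nil mulr0.
have c1 := Cc_conv_integrand hG x cf cF.
rewrite formal_eval_cons IH /=.
transitivity (c * Cintegral mu (fun s => f s * F (s^-1 * x)%g) +
  Cintegral mu (fun s => f s * formal_eval F (translate s^-1%g l))) => //.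
rewrite -(CintegralZ hG haar c c1) -(CintegralD hG haar (CcZ hG c c1)); last first.
  exact: (CcM hG cf (continuous_formal_eval (l := l) cF)).
by apply: eq_Cintegral => s; rewrite formal_eval_cons /= mulrDr mulrCA.
Qed.

(** Translations preserve the seminorm of formal combinations, so the integrand at [s] is at most
    [|f(s)|] times the norm of [u] and the seminorm of [l]. *)
Lemma conv_bound f u l : Cc f ->
  cmod (formal_eval (f ** u) l) <= L1norm mu f * cmod `|u| * kernel_seminorm K l.
Proof.
move=> cf; have cu := rkhs_continuous (u := u); rewrite formal_eval_conv//.
have cfu := CcM hG cf (continuous_formal_eval (l := l) cu).
rewrite (le_trans (norm_Cintegral hG haar cfu))// -mulrA.
rewrite -[leRHS]RintegralZr//; last exact: (Cc_integrable_norm hG haar cf).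
apply: le_Rintegral => //.
- exact: (Cc_integrable_norm hG haar cfu).
- have := integrableZr measurableT (cmod `|u| * kernel_seminorm K l)
  (Cc_integrable_norm hG haar cf).
  by apply: eq_integrable.
move=> s _; rewrite -/(cmod _) cmodM ler_wpM2l ?Re_norm_ge0//.
by rewrite -(kernel_seminorm_translate s^-1%g l) cmod_eval_le.
Qed.

Lemma conv_in_rkhs f u : Cc f -> f ** u \in in_rkhs K.
Proof.
move=> cf; apply/asboolP; exists (L1norm mu f * cmod `|u|); split.
  by rewrite mulr_ge0 ?cmod_ge0// L1norm_ge0.
by move=> l; exact: conv_bound.
Qed.

Definition rkhs_conv f u : rkhs K :=
  if pselect (Cc f) is left cf then Rkhs (conv_in_rkhs u cf) else 0.

Lemma rkhs_convE f u : Cc f -> rkhs_conv f u = f ** u :> (G -> R[i]).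
Proof. by rewrite /rkhs_conv; case: pselect. Qed.

Lemma rkhs_conv_linear f : linear (rkhs_conv f).
Proof.
move=> a u v; apply: val_inj; rewrite /rkhs_conv; case: pselect => cf /=; last first.
  by rewrite scaler0 addr0.
have [cu cv] := (rkhs_continuous (u := u), rkhs_continuous (u := v)).
have cau : continuous ((a *: (u : G -> R[i])) : G -> R[i]^o).
  by apply: right_invariant_continuous; apply: right_invariantZ; exact: rkhs_right_invariant.
have e1 : f ** (a *: (u : G -> R[i]) + (v : G -> R[i])) =
    f ** (a *: (u : G -> R[i])) + f ** v := convDr hG haar cf cau cv.
have e2 := convZr hG haar a cf cu.
by rewrite e2 in e1.
Qed.

Definition rkhs_rep f : {linear rkhs K -> rkhs K} :=
  HB.pack (rkhs_conv f) (GRing.isLinear.Build R[i] (rkhs K) (rkhs K) _ (rkhs_conv f)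
    (rkhs_conv_linear f)).

Lemma rkhs_rep_bound f u : Cc f -> `|rkhs_rep f u| <= (L1norm mu f)%:C * `|u|.
Proof.
move=> cf; rewrite [X in _ * X]norm_cmod -real_complexM; apply: eval_cmod_le.
  by rewrite mulr_ge0 ?cmod_ge0// L1norm_ge0.
by move=> l; rewrite /= rkhs_convE//; exact: conv_bound.
Qed.

(** On kernel functions both sides are integrals that correspond under inversion; the modular factor
    in [star f] is exactly the one that inversion produces. Density does the rest. *)
Lemma rkhs_rep_star f u w : Cc f ->
  rkhs_dot (rkhs_rep f u) w = rkhs_dot u (rkhs_rep (star f) w).
Proof.
move=> cf; have csf := Cc_invol cf.
apply: (@rkhs_adjoint _ _ _ K_herm K_pos (rkhs_rep f) (rkhs_rep (star f))).
- by apply: bounded_linearW => v; exact: rkhs_rep_bound cf.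
- by apply: bounded_linearW => v; exact: rkhs_rep_bound csf.
move=> l m.
rewrite (rkhs_dotC K_herm K_pos (kernel_vec K_herm K_pos m)) !rkhs_dot_kernel.
have ck n : continuous (kernel_fun K n : G -> R[i]^o).
  exact: (rkhs_continuous (u := kernel_vec K_herm K_pos n)).
have -> : formal_eval (rkhs_rep f (kernel_vec K_herm K_pos m)) l = formal_eval
  (f ** kernel_fun K m) l.
  by congr (formal_eval _ _); exact: rkhs_convE.
have -> : formal_eval (rkhs_rep (star f) (kernel_vec K_herm K_pos l)) m =
    formal_eval (star f ** kernel_fun K l) m.
  by congr (formal_eval _ _); exact: rkhs_convE.
rewrite !formal_eval_conv//.
pose F s := f s * formal_eval (kernel_fun K m) (translate s^-1%g l).
have cF : Cc F := CcM hG cf (continuous_formal_eval (l := l) (ck m)).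
have cF2 := CcM hG csf (continuous_formal_eval (l := m) (ck l)).
rewrite -(Cintegral_conj hG haar cF2) -(Cintegral_inv cF).
apply: eq_Cintegral => s; rewrite /F involE !conjcM conjcK conjc_real.
rewrite (kernel_pairingC K_herm) invgK mulrAC; congr (_ * _).
rewrite formal_eval_translate; congr (formal_eval _ _); apply/funext => x.
by rewrite -(kernel_fun_translate s^-1%g) mulKg.
Qed.

Definition kernel_hilbert : hilbertSpace R := rkhs_hilbert K_herm K_pos.

Definition kernel_rep (f : G -> R[i]) : {linear kernel_hilbert -> kernel_hilbert} := rkhs_rep f.

Lemma kernel_rep_L1 : L1_star_rep mu Delta kernel_rep.
Proof.
split.
  split.
  - by move=> f cf; exists (L1norm mu f) => v; exact: rkhs_rep_bound.
  - move=> a f g v cf cg; apply: val_inj => /=.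
    have cv := rkhs_continuous (u := v).
    rewrite (rkhs_convE v (CcD hG (CcZ hG a cf) cg)) (rkhs_convE v cf) (rkhs_convE v cg).
    by rewrite (convDl hG haar (CcZ hG a cf) cg cv) (convZl hG haar a cf cv).
  - move=> f g v cf cg; apply: val_inj => /=.
    rewrite (rkhs_convE v (Cc_conv hG haar cf cg)) (rkhs_convE (rkhs_conv g v) cf)
      (rkhs_convE v cg).
    exact: (convA hG haar cf cg (rkhs_continuous (u := v))).
  - by move=> f v w cf; exact: rkhs_rep_star.
move=> f cf; apply: ge_sup.
  by exists (complex.Re `|kernel_rep f 0|); exists 0 => //=; rewrite normr0.
move=> _ [v /= v1 <-]; have v1' : `|v : rkhs K| <= 1 := v1.
have : `|rkhs_rep f v| <= (L1norm mu f)%:C.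
  apply: (le_trans (rkhs_rep_bound v cf)).
  by rewrite -[leRHS]mulr1 ler_wpM2l// ler0c L1norm_ge0.
by rewrite rkhs_normE lecR.
Qed.

End PositiveDefiniteKernel.

(** * Closure properties of the Hecke algebra *)

Lemma invol_left_invariant f : right_invariant f -> left_invariant (star f).
Proof.
move=> fr h x Hh; rewrite !involE !invgM modularM (fr _ _ (subgroupV Hh)).
by rewrite (modular_subgroup (subgroupV Hh)) mulr1.
Qed.

Lemma invol_right_invariant f : left_invariant f -> right_invariant (star f).
Proof.
move=> fl x h Hh; rewrite !involE !invgM modularM (fl _ _ (subgroupV Hh)).
by rewrite (modular_subgroup (subgroupV Hh)) mul1r.
Qed.

Lemma hecke_inner f g : Cc f -> right_invariant f -> Cc g -> right_invariant g ->
  hecke_algebra mu H (star f ** g).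
Proof.
move=> cf fr cg gr; apply/hecke_algebraP; split.
- exact: (Cc_conv hG haar (Cc_invol cf) cg).
- exact: (conv_left_invariant (Cc_invol cf) (Cc_continuous cg) (invol_left_invariant fr)).
- exact: conv_right_invariant.
Qed.

Lemma hecke_invol f : hecke_algebra mu H f -> hecke_algebra mu H (star f).
Proof.
move=> /hecke_algebraP[cf fl fr]; apply/hecke_algebraP; split.
- exact: Cc_invol.
- exact: invol_left_invariant.
- exact: invol_right_invariant.
Qed.

Lemma hecke_conv f g : hecke_algebra mu H f -> hecke_algebra mu H g ->
  hecke_algebra mu H (f ** g).
Proof.
move=> /hecke_algebraP[cf fl fr] /hecke_algebraP[cg gl gr]; apply/hecke_algebraP; split.
- exact: (Cc_conv hG haar cf cg).
- exact: (conv_left_invariant cf (Cc_continuous cg) fl).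
- exact: conv_right_invariant.
Qed.

Lemma hecke_ZD a f g : hecke_algebra mu H f -> hecke_algebra mu H g ->
  hecke_algebra mu H (a *: f + g).
Proof.
move=> /hecke_algebraP[cf fl fr] /hecke_algebraP[cg gl gr]; apply/hecke_algebraP; split.
- exact: (CcD hG (CcZ hG a cf) cg).
- exact: (left_invariantD (left_invariantZ a fl) gl).
- exact: (right_invariantD (right_invariantZ a fr) gr).
Qed.

Lemma hecke_0 : hecke_algebra mu H 0.
Proof. by apply/hecke_algebraP; split => //; exact: (Cc0 hG). Qed.

Lemma hecke_sum (s : seq (G -> R[i])) (F : (G -> R[i]) -> G -> R[i]) :
  (forall g, g \in s -> hecke_algebra mu H (F g)) ->
  hecke_algebra mu H (\sum_(g <- s) F g).
Proof.
elim: s => [|g s IH] hF; first by rewrite big_nil; exact: hecke_0.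
rewrite big_cons -[F g]scale1r; apply: hecke_ZD.
  by apply: hF; rewrite inE eqxx.
by apply: IH => g' g's; apply: hF; rewrite inE g's orbT.
Qed.

Lemma hecke_p : hecke_algebra mu H p.
Proof.
apply/hecke_algebraP; split; [exact: Cc_hecke_proj|exact: hecke_proj_left|].
exact: hecke_proj_right.
Qed.

Lemma invol_hecke_proj : star p = p.
Proof.
have ca := Cc_coset_fun 1%g.
by rewrite -(conv_invol_coset_fun_id 1%g) (invol_conv (Cc_invol ca) ca) involK.
Qed.

(** * The kernel of a vector in a representation of the Hecke algebra *)

Section HeckeRepresentation.
Variables (V : hilbertSpace R) (pi : (G -> R[i]) -> {linear V -> V}).
Hypothesis pi_rep : is_star_rep (conv mu) star (hecke_algebra mu H) pi.
Variable v : V.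

Lemma hecke_rep0 w : pi 0 w = 0.
Proof.
have := star_rep_linear pi_rep (-1) w hecke_0 hecke_0.
by rewrite scaler0 addr0 scaleN1r addNr.
Qed.

Definition hecke_state f := dotp (pi f v) v.

Lemma hecke_state_ZD a f g : hecke_algebra mu H f -> hecke_algebra mu H g ->
  hecke_state (a *: f + g) = a * hecke_state f + hecke_state g.
Proof. by move=> hf hg; rewrite /hecke_state (star_rep_linear pi_rep a v hf hg) dotpDZl. Qed.

Lemma hecke_state0 : hecke_state 0 = 0.
Proof. by rewrite /hecke_state hecke_rep0 dotp0l. Qed.

Lemma hecke_state_square g : hecke_algebra mu H g ->
  hecke_state (star g ** g) = (cmod `|pi g v| ^+ 2)%:C.
Proof.
move=> hg; have hsg := hecke_invol hg.
rewrite /hecke_state (star_rep_mul pi_rep v hsg hg) (star_rep_star pi_rep _ _ hsg).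
by rewrite involK dotp_cmod.
Qed.

(** [f] itself need not lie in the Hecke algebra, so [pi f] is meaningless and [hecke_state_square]
    does not apply to it; it applies to the squares into which [star f ** f] decomposes. *)
Lemma hecke_state_inner_ge0 f : Cc f -> right_invariant f -> 0 <= hecke_state (star f ** f).
Proof.
move=> cf fr; have [l fl] := coset_decomposition cf fr.
have [|gs [hgs ->]] := inner_sum_squares (s := map snd l) cf fr.
  by rewrite fl; exact: coset_compls_eq0.
elim: gs hgs => [|g gs IH] hgs; first by rewrite big_nil hecke_state0.
have hg : hecke_algebra mu H g by apply: hgs; rewrite inE eqxx.
have hgs' g' : g' \in gs -> hecke_algebra mu H g'.
  by move=> g's; apply: hgs; rewrite inE g's orbT.
rewrite big_cons -[X in X + _]scale1r hecke_state_ZD; last 2 first.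
- exact: (hecke_conv (hecke_invol hg) hg).
- by apply: hecke_sum => g' /hgs' hg'; exact: (hecke_conv (hecke_invol hg') hg').
by rewrite mul1r addr_ge0// ?IH// hecke_state_square// ler0c sqr_ge0.
Qed.

Definition hecke_kernel x y := hecke_state (star (coset_fun x) ** coset_fun y).

Let hp x y : hecke_algebra mu H (star (coset_fun x) ** coset_fun y).
Proof. exact: (hecke_conv_invol_coset_fun x (Cc_coset_fun y) (@coset_fun_right y)). Qed.

Lemma hecke_kernel_herm x y : conjc (hecke_kernel x y) = hecke_kernel y x.
Proof.
rewrite /hecke_kernel /hecke_state -dotpC [RHS](star_rep_star pi_rep v v (hp y x)).
rewrite (invol_conv (Cc_invol (Cc_coset_fun y)) (Cc_coset_fun x)).
by rewrite involK.
Qed.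

Lemma hecke_kernel_mull t x y : hecke_kernel (t * x)%g (t * y)%g = hecke_kernel x y.
Proof.
rewrite /hecke_kernel; congr (hecke_state _).
rewrite !conv_invol_coset_fun; [|exact: continuous_coset_fun..].
congr (_ ** _); apply/funext => s; rewrite /coset_fun; congr (p _).
by rewrite invgM !mulgA mulgVK.
Qed.

Lemma hecke_kernel_right x : right_invariant (hecke_kernel x).
Proof.
move=> y h Hh; rewrite /hecke_kernel; congr (hecke_state (_ ** _)).
apply/funext => s; rewrite /coset_fun invgM -mulgA.
exact: (hecke_proj_left _ (subgroupV Hh)).
Qed.

(* The conjugates make [kernel_fun] and [formal_eval] the two sides of the
   sesquilinear form [star f ** g]. *)
Definition coset_sum (l : seq (R[i] * G)) : G -> R[i] :=
  \sum_(c <- l) conjc c.1 *: coset_fun c.2.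

Lemma Cc_coset_sum l : Cc (coset_sum l).
Proof. by apply: (Cc_sum hG) => c; apply: (CcZ hG); exact: Cc_coset_fun. Qed.

Lemma coset_sum_cons c l : coset_sum (c :: l) = conjc c.1 *: coset_fun c.2 + coset_sum l.
Proof. by rewrite /coset_sum big_cons. Qed.

Lemma coset_sum_right l : right_invariant (coset_sum l).
Proof.
elim: l => [|c l IH]; first by rewrite /coset_sum big_nil.
rewrite coset_sum_cons; apply: right_invariantD => //.
apply: right_invariantZ; exact: coset_fun_right.
Qed.

Lemma hecke_kernel_fun l x :
  kernel_fun hecke_kernel l x = hecke_state (star (coset_fun x) ** coset_sum l).
Proof.
have ca := Cc_coset_fun x; have csa := Cc_invol ca.
elim: l => [|c l IH].
  by rewrite /kernel_fun /coset_sum !big_nil (conv0r csa) hecke_state0.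
have cc := Cc_continuous (CcZ hG (conjc c.1) (Cc_coset_fun c.2)).
have cl := Cc_continuous (Cc_coset_sum l).
rewrite coset_sum_cons (convDr hG haar csa cc cl).
rewrite (convZr hG haar (conjc c.1) csa (continuous_coset_fun (x := c.2))).
rewrite (hecke_state_ZD _ (hp x c.2)); last first.
  exact: (hecke_conv_invol_coset_fun x (Cc_coset_sum l) (@coset_sum_right l)).
by rewrite -IH /kernel_fun big_cons.
Qed.

Lemma hecke_kernel_eval l m :
  formal_eval (kernel_fun hecke_kernel l) m = hecke_state (star (coset_sum m) ** coset_sum l).
Proof.
have cl := Cc_coset_sum l; have cl' := Cc_continuous cl.
elim: m => [|c m IH].
  rewrite formal_eval_nil /coset_sum big_nil -/(coset_sum l).
  have -> : star 0 ** coset_sum l = 0.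
    have c0 := Cc_invol (Cc0 hG : Cc (0 : G -> R[i])).
    have e : star (0 : G -> R[i]) = 0 *: star 0 by rewrite -{1}(scale0r (0 :
      G -> R[i])) involZ conjc0.
    by rewrite e (convZl hG haar 0 c0 cl') scale0r.
  by rewrite hecke_state0.
rewrite formal_eval_cons hecke_kernel_fun coset_sum_cons involD involZ conjcK.
have csa := Cc_invol (Cc_coset_fun c.2); have csm := Cc_invol (Cc_coset_sum m).
rewrite (convDl hG haar (CcZ hG c.1 csa) csm cl') (convZl hG haar c.1 csa cl').
rewrite (hecke_state_ZD c.1); first by rewrite IH.
- exact: (hecke_conv_invol_coset_fun c.2 cl (@coset_sum_right l)).
- exact: (hecke_inner (Cc_coset_sum m) (@coset_sum_right m) cl (@coset_sum_right l)).
Qed.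

Lemma hecke_kernel_pos l : 0 <= formal_eval (kernel_fun hecke_kernel l) l.
Proof.
rewrite hecke_kernel_eval; apply: hecke_state_inner_ge0; first exact: Cc_coset_sum.
exact: coset_sum_right.
Qed.

Let xi : rkhs hecke_kernel := kernel_vec hecke_kernel_herm hecke_kernel_pos [:: (1, 1%g)].

(** [h] is a combination of coset indicators, and the kernel is constant on each coset [xH], of
    measure 1, so each one contributes its coefficient times the kernel at [(1, x)]. *)
Lemma Cintegral_hecke_kernel h : hecke_algebra mu H h ->
  Cintegral mu (fun s => h s * hecke_kernel 1%g s) = hecke_state h.
Proof.
move=> hh; have /hecke_algebraP[ch hl hr] := hh.
have -> : hecke_state h = hecke_state (star (coset_fun 1%g) ** h).
  congr (hecke_state _); rewrite conv_invol_coset_fun; last exact: Cc_continuous.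
  rewrite (_ : (fun _ => _) = h); first by rewrite conv_projl.
  by apply/funext => s; rewrite mul1g.
have [l0 hE] := coset_decomposition ch hr.
have [l {hE} ->] : exists l, h = coset_sum l.
  exists [seq (conjc c.1, c.2) | c <- l0]; rewrite hE /coset_sum big_map.
  by apply: eq_bigr => c _; rewrite conjcK.
rewrite -hecke_kernel_fun.
have ck : continuous (hecke_kernel 1%g : G -> R[i]^o).
  exact/right_invariant_continuous/hecke_kernel_right.
elim: l => [|c l IH].
  rewrite /kernel_fun big_nil -[RHS](Cintegral0 mu); apply: eq_Cintegral => s.
  by rewrite /coset_sum big_nil mul0r.
have c1 := CcM hG (Cc_coset_fun c.2) ck; have c2 := CcM hG (Cc_coset_sum l) ck.
transitivity (conjc c.1 * Cintegral mu (fun s => coset_fun c.2 s * hecke_kernel 1%g s) +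
  Cintegral mu (fun s => coset_sum l s * hecke_kernel 1%g s)).
  rewrite -(CintegralZ hG haar _ c1) -(CintegralD hG haar (CcZ hG _ c1) c2).
  apply: eq_Cintegral => s; rewrite coset_sum_cons.
  transitivity (conjc c.1 * (coset_fun c.2 s * hecke_kernel 1%g s) +
    coset_sum l s * hecke_kernel 1%g s) => //.
  by rewrite mulrA; exact: mulrDl.
rewrite IH (Cintegral_coset_fun c.2 (@hecke_kernel_right 1%g)).
by rewrite /kernel_fun big_cons.
Qed.

Lemma hecke_state_eval h : hecke_algebra mu H h ->
  formal_eval (h ** xi) [:: (1, 1%g)] = hecke_state h.
Proof.
move=> hh; rewrite formal_eval1 -(Cintegral_hecke_kernel hh).
apply: eq_Cintegral => s; congr (_ * _).
have -> : xi (s^-1 * 1)%g = conjc 1 * hecke_kernel (s^-1 * 1)%g 1%g + 0.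
  by rewrite /xi /= /kernel_fun big_cons big_nil.
by rewrite conjc1 mul1r addr0 -(hecke_kernel_mull s) mulVKg mulg1.
Qed.

(** The norm of [xi] is that of [pi p v]. Only an inequality holds because [pi] may be degenerate,
    so that [pi p] is a projection other than the identity. *)
Lemma xi_norm_le : cmod `|xi| <= cmod `|v|.
Proof.
rewrite -(@ler_pXn2r _ 2%N)// ?nnegrE ?cmod_ge0// kernel_vec_norm -lecR.
rewrite -(kernel_seminorm_sqr hecke_kernel_pos) hecke_kernel_eval.
have -> : coset_sum [:: (1, 1%g)] = coset_fun 1%g.
  by rewrite coset_sum_cons /coset_sum big_nil addr0 conjc1 scale1r.
have hpp := hecke_p; have pp : star p ** p = p.
  by rewrite invol_hecke_proj conv_projl//; exact: hecke_proj_left.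
have := hecke_state_square hpp; rewrite pp conv_invol_coset_fun_id => e.
have := dotp_ge0 (v - pi p v).
rewrite dotpBl !dotpBr [dotp v (pi p v)]dotpC -[dotp (pi p v) v]/(hecke_state p) e.
by rewrite conjc_real !dotp_cmod subrr subr0 -rmorphB ler0c subr_ge0 lecR.
Qed.

Lemma hecke_state_le h : hecke_algebra mu H h ->
  cmod (hecke_state h) <= universal_norm mu Delta h * cmod `|v| ^+ 2.
Proof.
move=> hh; have /hecke_algebraP[ch _ _] := hh.
pose rep := kernel_rep hecke_kernel_herm hecke_kernel_pos hecke_kernel_mull hecke_kernel_right.
have repL1 : L1_star_rep mu Delta rep by exact: kernel_rep_L1.
have opn : opnorm (rep h) <= universal_norm mu Delta h.
  apply: ub_le_sup.
    (* The [L^1]-norm bounds the set whose supremum is the universal norm, so each of its members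
       lies below that supremum. *)
    by exists (L1norm mu h) => _ [W [rho [[_ rhoL1] ->]]]; exact: rhoL1.
  by exists (kernel_hilbert hecke_kernel_herm hecke_kernel_pos), rep.
have brep : bounded_operator (rep h) := star_rep_bounded repL1.1 ch.
have un0 : 0 <= universal_norm mu Delta h := le_trans (opnorm_ge0 brep) opn.
rewrite -(hecke_state_eval hh).
have -> : formal_eval (h ** xi) [:: (1, 1%g)] = formal_eval
  (rkhs_rep hecke_kernel_mull hecke_kernel_right h xi) [:: (1, 1%g)].
  by congr (formal_eval _ _); rewrite /= rkhs_convE.
apply: (le_trans (cmod_eval_le _ _)).
have -> : kernel_seminorm hecke_kernel [:: (1, 1%g)] = cmod `|xi|.
  apply/eqP; rewrite -(@eqrXn2 _ 2%N) ?kernel_seminorm_ge0 ?cmod_ge0//.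
  by rewrite kernel_vec_norm.
have h1 : cmod `|rkhs_rep hecke_kernel_mull hecke_kernel_right h xi| <=
    universal_norm mu Delta h * cmod `|xi|.
  apply: le_trans (opnorm_le xi brep) _.
  by rewrite ler_wpM2r ?cmod_ge0.
apply: (le_trans (ler_wpM2r (cmod_ge0 _) h1)).
rewrite -mulrA ler_wpM2l// expr2; apply: ler_pM; rewrite ?cmod_ge0 ?xi_norm_le//.
Qed.

End HeckeRepresentation.

(** * Contractivity and extension to the corner *)

Section GroupCstarAlgebra.
Variables (A : cstarAlgebra R) (iota : (G -> R[i]) -> A).
Hypothesis iotaA : is_group_cstar mu Delta iota.

Lemma hecke_Cc f : hecke_algebra mu H f -> Cc f.
Proof. by case/hecke_algebraP. Qed.

Lemma hecke_rep_contractive (V : hilbertSpace R) (pi : (G -> R[i]) -> {linear V -> V}) f v :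
  is_star_rep (conv mu) star (hecke_algebra mu H) pi -> hecke_algebra mu H f ->
  cmod `|pi f v| <= cmod `|iota f| * cmod `|v|.
Proof.
move=> pi_rep hf; have cf := hecke_Cc hf; have csf := Cc_invol cf.
have hff := hecke_conv (hecke_invol hf) hf.
rewrite -(@ler_pXn2r _ 2%N)// ?nnegrE ?mulr_ge0 ?cmod_ge0// exprMn.
have := hecke_state_le pi_rep v hff.
rewrite (hecke_state_square pi_rep v hf) cmod_real ger0_norm ?sqr_ge0//.
move=> /le_trans; apply; rewrite ler_wpM2r ?sqr_ge0//.
rewrite -cmod_cstar_mul -(group_cstar_star iotaA cf) -(group_cstar_mul iotaA csf cf).
rewrite (group_cstar_norm iotaA (Cc_conv hG haar csf cf)) cmod_real.
exact: ler_norm.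
Qed.

Lemma corner_approximable : corner (iota p) `<=` approximable (hecke_algebra mu H) iota.
Proof.
move=> _ [b _ <-] e e0; have cp := Cc_hecke_proj.
(* Compression by [iota p] on both sides multiplies the approximation error by at most the square of
   its norm; the summand 1 keeps [M] positive. *)
pose M := cmod `|iota p| ^+ 2 + 1.
have M0 : 0 < M by rewrite ltr_wpDl ?sqr_ge0.
have : closure (iota @` Cc) b by rewrite (group_cstar_dense iotaA).
have d0 : 0 < (e / M)%:C by rewrite ltcR divr_gt0.
move=> /(_ _ (nbhsx_ballx b _ d0))[_ [[f cf <-]]]; rewrite -ball_normE /= norm_cmod ltcR => bf.
exists (p ** f ** p); first by exists f.
rewrite (group_cstar_mul iotaA (Cc_conv hG haar cp cf) cp) (group_cstar_mul iotaA cp cf).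
rewrite -cmulBl -cmulBr; apply: (le_trans (cmod_cmul _ _)).
apply: (le_trans (ler_wpM2r (cmod_ge0 _) (cmod_cmul _ _))).
rewrite mulrAC -expr2 mulrC; apply: (@le_trans _ _ (e / M * M)); last by rewrite divfK// gt_eqF.
by rewrite ler_pM ?cmod_ge0 ?sqr_ge0 ?lerDl// ltW.
Qed.

Lemma hecke_is_enveloping : hecke_enveloping mu Delta H iota.
Proof.
move=> V pi pi_rep.
have iZD a f g : hecke_algebra mu H f -> hecke_algebra mu H g ->
    iota (a *: f + g) = a *: iota f + iota g.
  by move=> /hecke_Cc cf /hecke_Cc cg; exact: (group_cstar_linear iotaA).
have iM f g : hecke_algebra mu H f -> hecke_algebra mu H g ->
    iota (f ** g) = cmul (iota f) (iota g).
  by move=> /hecke_Cc cf /hecke_Cc cg; exact: (group_cstar_mul iotaA).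
have iS f : hecke_algebra mu H f -> iota (star f) = cstar (iota f).
  by move=> /hecke_Cc cf; exact: (group_cstar_star iotaA).
have pi_le f v := @hecke_rep_contractive V pi f v pi_rep.
exists (extension hecke_ZD iZD pi_rep pi_le); split.
  exact: (extension_star_rep hecke_0 hecke_ZD hecke_conv hecke_invol iZD iM iS pi_rep pi_le
    corner_approximable).
by move=> f v hf; exact: extension_iota.
Qed.

End GroupCstarAlgebra.

End CompactOpenSubgroup.

Theorem theorem5p13 (R : realType) (G : topologicalGroupType) (H N : set G)
    (mu : {measure set (borel G) -> \bar R}) (Delta : G -> R)
    (A : cstarAlgebra R) (iota : (G -> R[i]) -> A) :
  hausdorff_space G -> locally_compact [set: G] ->
  subgroup H -> compact H -> open H -> reduced H ->
  closed N -> normal_subgroup N [set: G] -> normal_subgroup H N ->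
  left_haar_measure mu -> mu H = 1%E -> modular_function mu Delta ->
  is_group_cstar mu Delta iota ->
  inner_R_positive mu Delta H /\ hecke_enveloping mu Delta H iota.
Proof.
move=> hG _ sH cH oH _ _ nN nH haar muH modular iotaA; split.
  exact: (inner_R_is_positive hG haar modular sH cH oH muH nN nH).
exact: (hecke_is_enveloping hG haar modular sH cH oH muH nN nH iotaA).
Qed.
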